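(* Let $K$ be a field, let $(a_1,\ldots,a_r)$ be a sequence of positive integers, let $S=K[x_1,\ldots,x_r]$ be the polynomial ring graded by $\deg(x_i)=a_i$, $1\le i\le r$, let $M=\bigoplus_{n\ge 0}M_n$ be a finitely generated graded $S$-module, and let $w>0$ be a real number. Let $p$ be the projective dimension of $M$ and $\beta_{ij}(M)=\dim_K (\operatorname{Tor}^S_i(M,K))_j$ its graded Betti numbers. Put $R_M(w,\ell)=\operatorname{Res}_{z=\ell}\zeta_M(z,w)$ and $R_M(\ell)=\operatorname{Res}_{z=\ell}\zeta_M(z)$. Then (1) $\displaystyle R_M(w,\ell) = \sum_{i=0}^p \sum_{j\geq 0}\beta_{ij}(M) \frac{(-1)^{i+r-\ell}}{(\ell-1)!(r-\ell)!}B_{r-\ell}(w+j;a_1,\ldots,a_r)$ for $1\leq \ell \leq r$; (2) $\displaystyle R_M(\ell) = \sum_{i=0}^p \sum_{j\geq 0}\beta_{ij}(M)\frac{(-1)^{i+r-\ell}}{(\ell-1)!(r-\ell)!}B_{r-\ell}(j;a_1,\ldots,a_r)$ for $1\leq \ell\leq r$.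
   Context: For a finitely generated graded $S$-module $M=\bigoplus_{n\ge0}M_n$ put $H(M,n)=\dim_K M_n$; for real $w>0$ define $\zeta_M(z,w)=\sum_{n\ge 0}\frac{H(M,n)}{(n+w)^z}$ and $\zeta_M(z)=\lim_{w\searrow 0}(\zeta_M(z,w)-H(M,0)w^{-z})=\sum_{n\ge 1}\frac{H(M,n)}{n^z}$. These series converge absolutely for $\operatorname{Re} z>\dim M$ and extend to meromorphic functions on $\mathbb C$, whose residues are meant. The Bernoulli-Barnes polynomials $B_\ell(x;a_1,\ldots,a_r)$ are defined by $$\frac{z^r e^{xz}}{(e^{a_1z}-1)\cdots (e^{a_rz}-1)}=\sum_{\ell=0}^{\infty}B_{\ell}(x;a_1,\ldots,a_r) \frac{z^{\ell}}{\ell!}.$$ *)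

(* Defs.v *)
From Stdlib Require Import Reals Lra Factorial PeanoNat.
From Coquelicot Require Import Coquelicot.
From HB Require Import structures.
From mathcomp Require Import all_boot all_order all_algebra.
From mathcomp Require Import mpoly.

Set Implicit Arguments.
Unset Strict Implicit.
Unset Printing Implicit Defensive.

(** * Graded modules over a weighted polynomial ring *)

Section Algebra.

Local Open Scope ring_scope.
Import GRing.Theory.

Definition wdeg (r : nat) (a : 'I_r -> nat) (m : 'X_{1..r}) : nat :=
  (\sum_(i < r) m i * a i)%N.

Fact wdeg0 (r : nat) (a : 'I_r -> nat) : wdeg a 0%MM = 0%N.
Proof. by rewrite /wdeg big1 // => i _; rewrite mnm0E. Qed.

Fact wdegD (r : nat) (a : 'I_r -> nat) : 
  {morph wdeg a : m n / (m + n)%MM >-> (m + n)%N}.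
Proof.
move=> m n; rewrite /wdeg -big_split /=; apply: eq_bigr => i _.
by rewrite mnmDE mulnDl.
Qed.

HB.instance Definition _ (r : nat) (a : 'I_r -> nat) :=
  isMeasure.Build r (wdeg a) (wdeg0 a) (wdegD a).

(* An N-graded module over K[x_1, ..., x_r] with deg x_i = a i.  The fields
   [grcompD] and [grcompZ] make every component a K-subspace, since the
   constants are homogeneous of degree 0. *)
Record grModule (K : fieldType) (r : nat) (a : 'I_r -> nat) := GrModule {
  grmod :> lmodType {mpoly K[r]};
  grcomp : nat -> grmod -> Prop;
  grcomp0 : forall n, grcomp n 0;
  grcompD : forall n x y, grcomp n x -> grcomp n y -> grcomp n (x + y);
  grcompZ : forall d n (s : {mpoly K[r]}) x,
    s \is d.-homog for (wdeg a) -> grcomp n x -> grcomp (d + n) (s *: x);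
  grcomp_span : forall x, exists (N : nat) (c : nat -> grmod),
    (forall n, grcomp n (c n)) /\ x = \sum_(n < N) c n;
  grcomp_indep : forall (N : nat) (c : nat -> grmod),
    (forall n, grcomp n (c n)) -> \sum_(n < N) c n = 0 ->
    forall n, (n < N)%N -> c n = 0
}.

Section Modules.
Variables (K : fieldType) (r : nat).
Local Notation S := {mpoly K[r]}.
Implicit Types M N P : lmodType S.

Definition finitely_generated M : Prop :=
  exists (k : nat) (g : 'I_k -> M), forall x,
  exists c : 'I_k -> S, x = \sum_(i < k) c i *: g i.

(* dim_K (U / W) = d, for K-subspaces W <= U of an S-module. *)
Definition quo_dim M (U W : M -> Prop) (d : nat) : Prop :=
  exists b : 'I_d -> M, (forall i, U (b i)) /\
  forall x, U x ->
    exists! c : {ffun 'I_d -> K}, W (x - \sum_(i < d) (c i)%:MP *: b i).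

Definition has_dim M (U : M -> Prop) (d : nat) : Prop :=
  quo_dim U (fun x => x = 0) d.

Definition projective P : Prop :=
  forall (A B : lmodType S) (g : {linear A -> B}) (f : {linear P -> B}),
  (forall y, exists x, g x = y) ->
  exists h : {linear P -> A}, forall x, g (h x) = f x.

Definition proj_resolution M (P : nat -> lmodType S)
    (d : forall i, {linear P i.+1 -> P i}) (e : {linear P 0%N -> M}) : Prop :=
  [/\ forall i, projective (P i),
      forall y, exists x, e x = y,
      forall x, e x = 0 <-> exists y, d 0%N y = x
    & forall i (x : P i.+1), d i x = 0 <-> exists y, d i.+1 y = x].

Definition proj_res_of_length M (n : nat) : Prop :=
  exists (P : nat -> lmodType S) (d : forall i, {linear P i.+1 -> P i})
    (e : {linear P 0%N -> M}),
  proj_resolution d e /\ forall i, (n < i)%N -> forall x : P i, x = 0.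

Definition proj_dim M (p : nat) : Prop :=
  proj_res_of_length M p /\ forall q, proj_res_of_length M q -> (p <= q)%N.

(* The submodule mN, where m = (x_1, ..., x_r); the tensor product
   of N and K = S / m over S is N / mN. *)
Definition in_irrel N (x : N) : Prop :=
  exists c : 'I_r -> N, x = \sum_(i < r) 'X_i *: c i.

Section Tor.
Variables (a : 'I_r -> nat) (P : nat -> grModule K a).
Variable d : forall i, {linear P i.+1 -> P i}.

(* Cycles and boundaries of the complex P / mP in homological degree i and
   internal degree j, as subspaces of P_i. *)
Definition tor_cycle (i j : nat) : P i -> Prop :=
  match i with
  | 0%N => fun x => grcomp j x
  | i'.+1 => fun x => grcomp j x /\ in_irrel (d i' x)
  end.

Definition tor_boundary (i j : nat) (x : P i) : Prop :=
  exists y : P i.+1, grcomp j y /\ in_irrel (x - d i y).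

End Tor.

Arguments tor_cycle {a P} d i j _.
Arguments tor_boundary {a P} d i j _.

(* dim_K Tor_i^S(M, K)_j = b, where Tor is computed from a projective resolution
   of M by graded modules and maps of degree 0.  The dimension does not depend
   on the resolution, and such resolutions exist. *)
Definition betti_number (a : 'I_r -> nat) (M : grModule K a) (i j b : nat) : Prop :=
  exists (P : nat -> grModule K a) (d : forall i, {linear P i.+1 -> P i})
    (e : {linear P 0%N -> M}),
  [/\ proj_resolution (P := fun i => P i) d e,
      forall i n (x : P i.+1), grcomp n x -> grcomp n (d i x),
      forall n (x : P 0%N), grcomp n x -> grcomp n (e x)
    & quo_dim (tor_cycle d i j) (tor_boundary d i j) b].

End Modules.

End Algebra.

(** * Zeta functions, meromorphic continuation and residues *)

Section Analysis.

Local Open Scope R_scope.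

Definition Cexp (z : C) : C := (exp (Re z) * cos (Im z), exp (Re z) * sin (Im z)).

(* x^z for x > 0. *)
Definition Rcpow (x : R) (z : C) : C := Cexp (z * RtoC (ln x))%C.

(* f z = \sum_(k >= 0) c k * (z - p)^(k - m) on a punctured disc around p. *)
Definition laurent_expansion (f : C -> C) (p : C) (m : nat) (c : nat -> C) : Prop :=
  exists eps : R, 0 < eps /\
  forall z : C, 0 < Cmod (z - p) < eps ->
    is_pseries (K := C_AbsRing) (V := C_NormedModule) c (z - p)%C
      (Cpow (z - p) m * f z)%C.

(* The value of f at its poles is immaterial. *)
Definition meromorphic (f : C -> C) : Prop :=
  forall p : C, exists (m : nat) (c : nat -> C), laurent_expansion f p m c.

(* The coefficient of (z - p)^(-1) in the Laurent expansion of f at p. *)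
Definition is_residue (f : C -> C) (p rho : C) : Prop :=
  exists (m : nat) (c : nat -> C), laurent_expansion f p m.+1 c /\ rho = c m.

Definition zeta_term (h : nat -> nat) (x : nat -> R) (z : C) (n : nat) : C :=
  (RtoC (INR (h n)) / Rcpow (x n) z)%C.

(* Z is a meromorphic continuation of \sum_(n >= 0) h n / (x n)^z, which
   converges absolutely on some right half-plane. *)
Definition zeta_continuation (h : nat -> nat) (x : nat -> R) (Z : C -> C) : Prop :=
  meromorphic Z /\
  exists sigma : R, forall z : C, sigma < Re z ->
    ex_series (fun n => Cmod (zeta_term h x z n)) /\
    is_series (K := C_AbsRing) (V := C_NormedModule) (zeta_term h x z) (Z z).

(** * Bernoulli-Barnes polynomials *)

(* The formal power series quotient f / g, for g 0 <> 0. *)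
Fixpoint ps_div_upto (f g : nat -> R) (n : nat) : nat -> R :=
  match n with
  | 0%nat => fun _ => 0
  | n'.+1 => fun k =>
      if k == n' then (f n' - PS_mult (ps_div_upto f g n') g n') / g 0%nat
      else ps_div_upto f g n' k
  end.

Definition ps_div (f g : nat -> R) (n : nat) : R := ps_div_upto f g n.+1 n.

(* e^(x z) *)
Definition ps_exp (x : R) (k : nat) : R := x ^ k / INR (fact k).

(* (e^(x z) - 1) / z *)
Definition ps_expm1_div (x : R) (k : nat) : R := x ^ k.+1 / INR (fact k.+1).

Definition ps_one (k : nat) : R := if k == 0%nat then 1 else 0.

(* \prod_i (e^(a_i z) - 1) / z *)
Definition barnes_den (r : nat) (a : 'I_r -> nat) : nat -> R :=
  foldr (fun i g => PS_mult (ps_expm1_div (INR (a i))) g) ps_one (enum 'I_r).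

(* B_l(x; a_1, ..., a_r) *)
Definition bernoulli_barnes (r : nat) (a : 'I_r -> nat) (l : nat) (x : R) : R :=
  INR (fact l) * ps_div (ps_exp x) (barnes_den a) l.

Lemma ps_div_uptoE f g n k : (k < n)%N -> ps_div_upto f g n k = ps_div f g k.
Proof.
elim: n => // n IHn; rewrite ltnS leq_eqVlt => /orP[/eqP->|lt_kn] //.
by rewrite /= (ltn_eqF lt_kn) IHn.
Qed.

Lemma ps_div_upto_ge f g n k : (n <= k)%N -> ps_div_upto f g n k = 0.
Proof.
by elim: n => //= n IHn lt_nk; rewrite (gtn_eqF lt_nk) IHn // ltnW.
Qed.

Lemma PS_mult_ps_div f g : g 0%nat <> 0 -> PS_mult (ps_div f g) g =1 f.
Proof.
move=> g0 n.
have E: PS_mult (ps_div f g) g n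
        = PS_mult (ps_div_upto f g n) g n + ps_div f g n * g 0%nat.
  rewrite /PS_mult; case: n => [|n].
    by rewrite /= Rmult_0_l Rplus_0_l.
  rewrite !tech5 Nat.sub_diag (ps_div_upto_ge _ _ (leqnn _)) Rmult_0_l Rplus_0_r.
  congr (_ + _); apply: PartSum.sum_eq => i /leP le_in.
  by rewrite ps_div_uptoE.
by rewrite E /ps_div /= eqxx; field.
Qed.

Lemma barnes_den0 (r : nat) (a : 'I_r -> nat) :
  (forall i, 0 < a i)%N -> barnes_den a 0%nat <> 0.
Proof.
move=> a_gt0; rewrite /barnes_den; elim: (enum 'I_r) => [|i s IHs] /=.
  by rewrite /ps_one /=; lra.
rewrite /PS_mult /= => /Rmult_integral[|//].
rewrite /ps_expm1_div /= Rmult_1_r Rdiv_1_r => a0.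
by have /lt_0_INR: (0 < a i)%coq_nat by [apply/ltP]; rewrite a0; lra.
Qed.

(* The defining identity z^r e^(x z) / \prod_i (e^(a_i z) - 1)
   = \sum_l B_l(x; a) z^l / l!, with the denominators cleared. *)
Lemma bernoulli_barnesP (r : nat) (a : 'I_r -> nat) (x : R) :
  (forall i, 0 < a i)%N ->
  PS_mult (fun l => bernoulli_barnes a l x / INR (fact l)) (barnes_den a)
    =1 ps_exp x.
Proof.
move=> a_gt0 n; rewrite -[RHS](PS_mult_ps_div (ps_exp x) (barnes_den0 a_gt0)).
apply: PartSum.sum_eq => l _; congr (_ * _); rewrite /bernoulli_barnes; field.
exact: INR_fact_neq_0.
Qed.

(* \sum_(0 <= i <= p) \sum_(j >= 0) beta_ij (-1)^(i+r-l) / ((l-1)! (r-l)!)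
     * B_(r-l)(x + j; a).
   For Betti numbers the inner sums have finitely many nonzero terms. *)
Definition betti_residue (r : nat) (a : 'I_r -> nat) (p : nat)
    (beta : nat -> nat -> nat) (x : R) (l : nat) : R :=
  sum_n (fun i : nat => Series (fun j : nat =>
    INR (beta i j)
    * ((-1) ^ (i + (r - l))%N / (INR (fact (l - 1)%N) * INR (fact (r - l)%N)))
    * bernoulli_barnes a (r - l)%N (x + INR j))) p.

End Analysis.

(* Main.v *)
(* Algebra.  Reducing a graded projective resolution P of M modulo x_1, ..., x_k,
   for k = 0, ..., r, gives exact sequences
     0 -> coker (x_(k+1) | H_i^(k)) -> H_i^(k+1) -> ker (x_(k+1) | H_(i-1)^(k)) -> 0,
   so passing from k to k + 1 turns the Euler characteristic chi_j of the homology
   into chi_j - chi_(j - a_(k+1)).  It starts from the Hilbert function H(M, j) at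
   k = 0 and ends with \sum_i (-1)^i beta_ij at k = r.  All these homology modules
   are finitely generated over the remaining variables, so that beta_ij = 0 for
   large j.  Comparison of resolutions shows that beta_ij does not depend on P and
   vanishes for i > p.

   Hence \sum_n H(M, n) t^n = K(t) / \prod_i (1 - t^(a_i)) with
   K_j = \sum_i (-1)^i beta_ij.  For D = \prod_i a_i write K(t) / \prod_i (1 - t^(a_i))
   as N(t) / (1 - t^D)^r.  The coefficient binomial(m + r - 1, r - 1) of t^(D m)
   in (1 - t^D)^(-r) equals, up to the factor (-1)^(r-1) D, the coefficient of
   z^(r-1) in e^(-D m z) (z / (e^(D z) - 1))^r.  Expanding this in powers of
   y = D m + x gives Bernoulli-Barnes coefficients, and N(t) is turned back into
   K(t) by the substitution t = e^z.

   The zeta function is thus, up to an entire function, a finite combination of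
   functions \sum_m (D (m + x))^(k - z), that is, of shifted Hurwitz zeta functions,
   whose only pole is simple with residue 1.  The Hurwitz zeta function is
   continued by telescoping (m + x)^(1 - z) with the binomial series.  A
   meromorphic continuation has the same residues by the identity theorem. *)

Require Import Defs.
From Stdlib Require Import ClassicalEpsilon ZArith Reals Lra.
From Coquelicot Require Import Coquelicot.
From HB Require Import structures.
From mathcomp Require Import all_boot all_order all_algebra.
From mathcomp Require Import zify mpoly.
From mathcomp Require freeg ring.
From mathcomp Require Import boolp Rstruct.

Set Implicit Arguments.
Unset Strict Implicit.
Unset Printing Implicit Defensive.

(** * Dimensions of subquotients *)

(** The modules P_i may have infinite rank, so only the homology, not the complexes, can be counted
    or called Noetherian; dimensions and finite generation are carried together through all r steps.
    Homology is not formed as a quotient module: it is a pair of families of K-subspaces of P_i, and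
    maps between homologies are linear relations on representatives, so no linear choice of lifts is
    needed. The sequences are exact because x_(k+1) is regular on P_i / (x_1, ..., x_k) P_i, a
    property inherited from free modules. Finite generation is stated as generation from lower
    degrees above some bound; at k = r the variables kill the homology, so it becomes vanishing.

    The substitution t = e^z succeeds because N = K \prod_i (1 - t^D) / (1 - t^(a_i)): the factor z
    / (e^(D z) - 1) times (1 - e^(D z)) / (1 - e^(a_i z)) is the Bernoulli-Barnes factor z / (e^(a_i
    z) - 1). The centre x is free in each expansion; for the term t^j of N it is taken to be w + j,
    so that y = n + w for every j. *)

Lemma bounded_max (P : nat -> Prop) (d : nat) :
  (exists n, P n) -> (forall n, P n -> (n <= d)%N) ->
  exists2 n, P n & forall m, P m -> (m <= n)%N.
Proof.
move=> [n0 Pn0] Pd; pose b n := `[<P n>].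
have bP n : reflect (P n) (b n) by exact: asboolP.
have exb : exists n, b n by exists n0; apply/bP.
have bd n : b n -> (n <= d)%N by move/bP/Pd.
by case: (ex_maxnP exb bd) => n /bP Pn nmax; exists n => // m /bP; exact: nmax.
Qed.

Section Dimension.

Local Open Scope ring_scope.
Import GRing.Theory.

Variables (K : fieldType) (r : nat).
Local Notation S := {mpoly K[r]}.

Definition lincomb (V : lmodType S) d (b : 'I_d -> V) (c : 'rV[K]_d) : V :=
  \sum_i (c 0 i)%:MP *: b i.

Section Lincomb.
Variable V : lmodType S.

Lemma lincombP d (b : 'I_d -> V) k c1 c2 :
  lincomb b (k *: c1 + c2) = k%:MP *: lincomb b c1 + lincomb b c2.
Proof.
rewrite /lincomb scaler_sumr -big_split; apply: eq_bigr => i _ /=.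
by rewrite !mxE mpolyCD mpolyCM scalerDl scalerA.
Qed.

Lemma lincomb0 d (b : 'I_d -> V) : lincomb b 0 = 0.
Proof. by rewrite /lincomb big1 // => i _; rewrite mxE mpolyC0 scale0r. Qed.

Lemma lincombB d (b : 'I_d -> V) c1 c2 :
  lincomb b (c1 - c2) = lincomb b c1 - lincomb b c2.
Proof.
by rewrite [c1 - c2]addrC -[- c2]scaleN1r lincombP mpolyCN mpolyC1 scaleN1r addrC.
Qed.

Lemma lincomb_mul m d (b : 'I_d -> V) (B : 'M[K]_(m, d)) c :
  lincomb (fun i => lincomb b (row i B)) c = lincomb b (c *m B).
Proof.
rewrite /lincomb; under eq_bigr do rewrite scaler_sumr.
rewrite exchange_big /=; apply: eq_bigr => j _.
rewrite !mxE raddf_sum scaler_suml; apply: eq_bigr => i _ /=.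
by rewrite scalerA !mxE mpolyCM.
Qed.

Lemma lincomb_row_mx d1 d2 (b : 'I_(d1 + d2) -> V) (c : 'rV[K]_(d1 + d2)) :
  lincomb b c = lincomb (fun i => b (lshift d2 i)) (lsubmx c)
              + lincomb (fun i => b (rshift d1 i)) (rsubmx c).
Proof.
by rewrite /lincomb big_split_ord /=; congr (_ + _); apply: eq_bigr => i _; rewrite mxE.
Qed.

End Lincomb.

Definition subsp (V : lmodType S) (U : V -> Prop) : Prop :=
  U 0 /\ forall k x y, U x -> U y -> U (k%:MP *: x + y).

Section Subsp.
Variables (V : lmodType S) (U : V -> Prop).
Hypothesis Us : subsp U.

Lemma subspD x y : U x -> U y -> U (x + y).
Proof. by move=> Ux Uy; rewrite -[x]scale1r -mpolyC1; apply: Us.2. Qed.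

Lemma subspZ k x : U x -> U (k%:MP *: x).
Proof. by move=> Ux; rewrite -[_ *: x]addr0; apply: Us.2 => //; apply: Us.1. Qed.

Lemma subspN x : U x -> U (- x).
Proof. by move=> Ux; rewrite -scaleN1r -mpolyC1 -mpolyCN; apply: subspZ. Qed.

Lemma subspB x y : U x -> U y -> U (x - y).
Proof. by move=> Ux Uy; apply: subspD => //; apply: subspN. Qed.

Lemma subsp_sum (I : Type) (s : seq I) (P : pred I) (F : I -> V) :
  (forall i, P i -> U (F i)) -> U (\sum_(i <- s | P i) F i).
Proof.
move=> UF; elim/big_rec: _ => [|i x Pi Ux]; first exact: Us.1.
by apply: subspD => //; apply: UF.
Qed.

Lemma subsp_lincomb d (b : 'I_d -> V) c : (forall i, U (b i)) -> U (lincomb b c).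
Proof. by move=> Ub; apply: subsp_sum => i _; apply: subspZ. Qed.

Lemma subspDr x y : U y -> U (x + y) -> U x.
Proof. by move=> Uy Uxy; rewrite -[x](addrK y); apply: subspB. Qed.

Lemma subspDl x y : U x -> U (x + y) -> U y.
Proof. by rewrite addrC; apply: subspDr. Qed.

Lemma subspC x y : U (x - y) -> U (y - x).
Proof. by move=> /subspN; rewrite opprB. Qed.

Lemma subspBB x y z : U (x - y) -> U (y - z) -> U (x - z).
Proof. by move=> Uxy Uyz; rewrite -[x](subrK y) -addrA; apply: subspD. Qed.

End Subsp.

Lemma subsp_add (V : lmodType S) (U W : V -> Prop) : subsp U -> subsp W ->
  subsp (fun x => exists2 u, U u & W (x - u)).
Proof.
move=> Us Ws; split; first by exists 0; [exact: Us.1 | rewrite subr0; exact: Ws.1].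
move=> k x y [u Uu Wu] [v Uv Wv]; exists (k%:MP *: u + v); first exact: Us.2.
by rewrite opprD addrACA -scalerBr; apply: Ws.2.
Qed.

Lemma subsp_inter (V : lmodType S) (U W : V -> Prop) : subsp U -> subsp W ->
  subsp (fun x => U x /\ W x).
Proof.
move=> Us Ws; split; first by split; [exact: Us.1 | exact: Ws.1].
by move=> k x y [Ux Wx] [Uy Wy]; split; [exact: Us.2 | exact: Ws.2].
Qed.

Definition qdim (V : lmodType S) (U W : V -> Prop) (d : nat) : Prop :=
  exists b : 'I_d -> V, [/\ forall i, U (b i),
    forall c, W (lincomb b c) -> c = 0 &
    forall x, U x -> exists c, W (x - lincomb b c)].

Lemma quo_dimP (V : lmodType S) (U W : V -> Prop) d : subsp U -> subsp W ->
  quo_dim U W d <-> qdim U W d.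
Proof.
move=> Us Ws.
have toffun (b : 'I_d -> V) (c : 'rV[K]_d) :
    \sum_(i < d) ([ffun i => c 0 i] i)%:MP *: b i = lincomb b c.
  by apply: eq_bigr => i _; rewrite ffunE.
have torow (b : 'I_d -> V) (c : {ffun 'I_d -> K}) :
    lincomb b (\row_i c i) = \sum_(i < d) (c i)%:MP *: b i.
  by apply: eq_bigr => i _; rewrite mxE.
split=> [] [b].
  move=> [Ub bP]; exists b; split=> // [c Wc|x /bP[c [Wc _]]]; last first.
    by exists (\row_i c i); rewrite torow.
  (* The unique expansion of 0 is at once the zero family and [- c], so [c = 0]. *)
  have [c0 [_ c0P]] := bP _ Us.1.
  have E1: c0 = [ffun i => - c 0 i].
    apply: c0P; rewrite sub0r; apply: (subspN Ws).
    rewrite (eq_bigr (fun i => - ((c 0 i)%:MP *: b i))) => [|i _].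
      by rewrite sumrN; apply: (subspN Ws).
    by rewrite !ffunE mpolyCN scaleNr.
  have E2: c0 = [ffun i => 0].
    apply: c0P; rewrite big1 ?subrr; first exact: Ws.1.
    by move=> i _; rewrite ffunE mpolyC0 scale0r.
  apply/rowP => i; move: E1; rewrite E2 => /ffunP/(_ i).
  by rewrite !ffunE mxE => /esym/eqP; rewrite oppr_eq0 => /eqP.
move=> [Ub bI bS]; exists b; split=> // x Ux.
have [c Wc] := bS x Ux; exists [ffun i => c 0 i]; split; first by rewrite toffun.
move=> c'; rewrite -torow => Wc'.
have /bI E: W (lincomb b (\row_i c' i - c)).
  by rewrite lincombB; apply: (subspBB Ws) Wc; apply: (subspC Ws).
apply/ffunP => i; rewrite ffunE; move/rowP: E => /(_ i); rewrite !mxE.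
by move=> /eqP; rewrite subr_eq0 => /eqP.
Qed.

Lemma qdim_ext (V : lmodType S) (U W U' W' : V -> Prop) d : 
  (forall x, U x <-> U' x) -> (forall x, W x <-> W' x) ->
  qdim U W d -> qdim U' W' d.
Proof.
move=> UU WW [b [Ub bI bS]]; exists b; split=> [i|c /WW|x /UU/bS[c Wc]].
- exact/UU.
- exact: bI.
by exists c; apply/WW.
Qed.

(* Unlike [qdim_ext], [W] may be replaced by [W'] with the same trace on [U]. *)
Lemma qdim_trace (V : lmodType S) (U W W' : V -> Prop) d : subsp U ->
  (forall x, U x -> W x <-> W' x) -> qdim U W d -> qdim U W' d.
Proof.
move=> Us WW [b [Ub bI bS]]; exists b; split=> // [c|x Ux].
  by move=> /WW; move/(_ (subsp_lincomb Us c Ub)); apply: bI.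
have [c Wc] := bS x Ux; exists c; apply/WW => //.
by apply: (subspB Us) => //; apply: subsp_lincomb.
Qed.

(** Expanding each [b' i] along [b] modulo [W] gives a matrix with d' rows and d columns. A vector
    of its left kernel is a relation between the [b' i] modulo [W], so the rows are free. *)
Lemma qdim_le (V : lmodType S) (U W : V -> Prop) d d' : subsp W ->
  qdim U W d -> qdim U W d' -> (d' <= d)%N.
Proof.
move=> Ws [b [Ub bI bS]] [b' [Ub' bI' bS']].
pose f i := sval (cid (bS _ (Ub' i))).
have fP i : W (b' i - lincomb b (f i)).
  by rewrite /f; case: cid.
pose M := \matrix_i f i.
have free : row_free M.
  rewrite -kermx_eq0; apply/eqP/row_matrixP => i; rewrite row0; apply: bI'.
  set c := row i _; have cM : c *m M = 0 by apply/sub_kermxP; apply: row_sub.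
  apply: (subspDr Ws) (_ : W (- lincomb b (c *m M))) _.
    by rewrite cM lincomb0 oppr0; apply: Ws.1.
  rewrite -lincomb_mul -sumrB; apply: (subsp_sum Ws) => j _.
  by rewrite -scalerBr; apply: (subspZ Ws); rewrite rowK.
by rewrite -(eqP free); apply: rank_leq_col.
Qed.

Lemma qdim_uniq (V : lmodType S) (U W : V -> Prop) d d' : subsp W ->
  qdim U W d -> qdim U W d' -> d = d'.
Proof. by move=> Ws H H'; apply/eqP; rewrite eqn_leq !(@qdim_le _ U W). Qed.

Lemma qdim0 (V : lmodType S) (U W : V -> Prop) :
  (forall x, U x -> W x) -> qdim U W 0.
Proof.
move=> UW; exists (fun=> 0); split=> [[]//|c _|x /UW Wx]; first by rewrite thinmx0.
by exists 0; rewrite lincomb0 subr0.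
Qed.

(** Comparison and connecting maps between subquotients depend on a choice of representatives.
    Recorded as a relation between representatives, they are linear whatever the choices. *)
Definition linrel (V V' : lmodType S) (rho : V -> V' -> Prop) : Prop :=
  rho 0 0 /\ forall k x x' y y', rho x y -> rho x' y' ->
    rho (k%:MP *: x + x') (k%:MP *: y + y').

Section Linrel.
Variables (V V' : lmodType S) (rho : V -> V' -> Prop).
Hypothesis rhoL : linrel rho.

Lemma linrelB x x' y y' : rho x y -> rho x' y' -> rho (x - x') (y - y').
Proof.
move=> H H'; have := rhoL.2 (-1) _ _ _ _ H' H.
by rewrite mpolyCN mpolyC1 !scaleN1r ![- _ + _]addrC.
Qed.

Lemma linrel_sum (I : Type) (s : seq I) (P : pred I) (F : I -> V) (G : I -> V') :
  (forall i, P i -> rho (F i) (G i)) ->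
  rho (\sum_(i <- s | P i) F i) (\sum_(i <- s | P i) G i).
Proof.
move=> FG; elim/big_rec2: _ => [|i x y Pi xy]; first exact: rhoL.1.
by have := rhoL.2 1 _ _ _ _ (FG i Pi) xy; rewrite mpolyC1 !scale1r.
Qed.

Lemma linrel_lincomb d (b : 'I_d -> V) (b' : 'I_d -> V') c :
  (forall i, rho (b i) (b' i)) -> rho (lincomb b c) (lincomb b' c).
Proof.
move=> bb; apply: linrel_sum => i _.
by have := rhoL.2 (c 0 i) _ _ _ _ (bb i) rhoL.1; rewrite !addr0.
Qed.

(** Being total, onto and compatible with [W] and [W'], the relation induces an isomorphism of U/W
    with U'/W'; a basis is carried back through arbitrarily chosen related elements. *)
Lemma qdim_transfer (U W : V -> Prop) (U' W' : V' -> Prop) d :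
  subsp U -> subsp U' ->
  (forall x, U x -> exists2 y, U' y & rho x y) ->
  (forall y, U' y -> exists2 x, U x & rho x y) ->
  (forall x y, U x -> U' y -> rho x y -> W x <-> W' y) ->
  qdim U' W' d -> qdim U W d.
Proof.
move=> Us Us' tot surj WW [b [Ub bI bS]].
have ex i : exists x, U x /\ rho x (b i) by have [x] := surj _ (Ub i); exists x.
pose f i := sval (cid (ex i)).
have fP i : U (f i) /\ rho (f i) (b i).
  by rewrite /f; case: cid.
have Uf c : U (lincomb f c) by apply: subsp_lincomb => // i; case: (fP i).
have Ub' c : U' (lincomb b c) by apply: subsp_lincomb.
have fb c : rho (lincomb f c) (lincomb b c).
  by apply: linrel_lincomb => i; case: (fP i).
exists f; split=> [i|c Wc|x Ux]; first by case: (fP i).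
  by apply: bI; apply: (proj1 (WW _ _ (Uf c) (Ub' c) (fb c))).
have [y Uy xy] := tot x Ux; have [c Wc] := bS y Uy; exists c.
apply: (proj2 (WW _ _ _ _ _) Wc); [exact: (subspB Us)|exact: (subspB Us')|exact: linrelB].
Qed.

End Linrel.

Lemma qdim_ext_add (V : lmodType S) (U L W : V -> Prop) d1 d2 :
  subsp L -> subsp W ->
  (forall x, L x -> U x) -> (forall x, W x -> L x) ->
  qdim U L d1 -> qdim L W d2 -> qdim U W (d1 + d2).
Proof.
move=> Ls Ws LU WL [b1 [Ub1 bI1 bS1]] [b2 [Ub2 bI2 bS2]].
pose b (i : 'I_(d1 + d2)) := match split i with inl j => b1 j | inr j => b2 j end.
have bE c : lincomb b c = lincomb b1 (lsubmx c) + lincomb b2 (rsubmx c).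
  rewrite lincomb_row_mx; congr (_ + _); apply: eq_bigr => i _; rewrite /b.
    by rewrite -[lshift _ _]/(unsplit (inl i)) unsplitK.
  by rewrite -[rshift _ _]/(unsplit (inr i)) unsplitK.
have Lb2 c : L (lincomb b2 c) by apply: subsp_lincomb.
exists b; split=> [i|c|x Ux].
- by rewrite /b; case: split => j //; apply: LU.
- rewrite bE => Wc; rewrite -[c]hsubmxK.
  have c1 : lsubmx c = 0 by apply: bI1; apply: (subspDr Ls) (WL _ Wc).
  by move: Wc; rewrite c1 lincomb0 add0r => /bI2 ->; rewrite row_mx0.
have [c1 Lx] := bS1 x Ux; have [c2 Wx] := bS2 _ Lx.
by exists (row_mx c1 c2); rewrite bE row_mxKl row_mxKr opprD addrA.
Qed.

(* Rank-nullity for the map induced by [f] between two subquotients. *)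
Lemma qdim_map (V V' : lmodType S) (U W : V -> Prop) (U' W' : V' -> Prop)
    (f : V' -> V) d d' :
  (forall k x y, f (k%:MP *: x + y) = k%:MP *: f x + f y) ->
  subsp U -> subsp W -> subsp W' -> (forall x, W x -> U x) ->
  (forall y, U' y -> U (f y)) -> (forall y, W' y -> W (f y)) ->
  (forall y, W' y -> U' y) -> subsp U' ->
  qdim U W d -> qdim U' W' d' ->
  exists rho, [/\ (rho <= d)%N, (rho <= d')%N,
    qdim U (fun x => exists2 y, U' y & W (x - f y)) (d - rho) &
    qdim (fun y => U' y /\ W (f y)) W' (d' - rho)].
Proof.
move=> fP Us Ws Ws' WU fU fW WU' Us' [b [Ub bI bS]] [b' [Ub' bI' bS']].
have f0 : f 0 = 0.
  have := fP (-1) 0 0; rewrite mpolyCN mpolyC1 !scaleN1r oppr0 addr0.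
  by rewrite addNr.
have fB x y : f (x - y) = f x - f y.
  by rewrite addrC -scaleN1r -mpolyC1 -mpolyCN fP mpolyCN mpolyC1 scaleN1r addrC.
have flin c : f (lincomb b' c) = lincomb (fun i => f (b' i)) c.
  rewrite /lincomb; elim/big_rec2: _ => [//|i x y _ <-]; exact: fP.
pose g i := sval (cid (bS _ (fU _ (Ub' i)))).
have gP i : W (f (b' i) - lincomb b (g i)).
  by rewrite /g; case: cid.
(* [A] is the matrix of the induced map in the two bases and its rank is the required [rho]. The
   cokernel gets a basis from the complement [A^C] of the row space, the kernel one from
   [kermx A]. *)
pose A := \matrix_i g i.
have fA c : W (f (lincomb b' c) - lincomb b (c *m A)).
  rewrite flin -lincomb_mul -sumrB; apply: (subsp_sum Ws) => j _.
  by rewrite -scalerBr; apply: (subspZ Ws); rewrite rowK.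
exists (\rank A); split; [exact: rank_leq_col|exact: rank_leq_row| |].
  rewrite -mxrank_compl; pose B := row_base (A^C)%MS.
  exists (fun i => lincomb b (row i B)); split.
  - by move=> i; apply: (subsp_lincomb Us).
  - move=> c; rewrite lincomb_mul => [[y Uy Wy]].
    have [e We] := bS' y Uy.
    have E : c *m B = e *m A.
      apply/eqP; rewrite -subr_eq0; apply/eqP/bI; rewrite lincombB.
      apply: (subspBB Ws) Wy _; apply: (subspBB Ws) (fA e).
      by rewrite -fB; apply: fW.
    have : (c *m B <= A :&: A^C)%MS.
      rewrite sub_capmx {1}E submxMl /=.
      by rewrite (submx_trans (submxMl _ _)) // eq_row_base.
    rewrite capmx_compl submx0 => /eqP cB.
    by apply: (row_free_inj (row_base_free _)); rewrite mul0mx.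
  move=> x Ux; have [c Wc] := bS x Ux.
  have /sub_addsmxP [[e1 e2] /= cE] : (c <= A + A^C)%MS.
    by apply: submx_full; apply: addsmx_compl_full.
  have /submxP [e2' e2E] : (e2 *m (A^C)%MS <= B)%MS by rewrite eq_row_base submxMl.
  exists e2'; exists (lincomb b' e1); first exact: subsp_lincomb.
  rewrite lincomb_mul -e2E.
  have -> : x - lincomb b (e2 *m (A^C)%MS) - f (lincomb b' e1)
     = (x - lincomb b c) - (f (lincomb b' e1) - lincomb b (e1 *m A)).
    have -> : e2 *m (A^C)%MS = c - e1 *m A by rewrite cE addrC addKr.
    by rewrite lincombB !opprB [lincomb b (e1 *m A) - _]addrC !addrA.
  exact: (subspB Ws).
have rk : \rank (kermx A) = (d' - \rank A)%N by rewrite mxrank_ker.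
rewrite -rk; pose B := row_base (kermx A).
have BA : B *m A = 0 by apply/sub_kermxP; rewrite eq_row_base.
exists (fun i => lincomb b' (row i B)); split.
- move=> i; split; first exact: (subsp_lincomb Us').
  apply: (subspDr Ws) (fA _); rewrite -row_mul BA row0 lincomb0 oppr0.
  exact: Ws.1.
- move=> c; rewrite lincomb_mul => /bI' cB.
  by apply: (row_free_inj (row_base_free (kermx A))); rewrite mul0mx.
move=> y [Uy Wfy]; have [c Wc] := bS' y Uy.
have cA : c *m A = 0.
  apply: bI; apply: (subspDl Ws (x := f y - lincomb b (c *m A))); last first.
    by rewrite subrK.
  apply: (subspBB Ws) (fA c); rewrite -fB; exact: fW.
have /submxP [e cE] : (c <= B)%MS by rewrite eq_row_base; apply/sub_kermxP.
by exists e; rewrite lincomb_mul -cE.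
Qed.
End Dimension.

(** * Finiteness of graded modules *)

Lemma uniform_bound (P : nat -> nat -> Prop) (N : nat) :
  (forall n m m', (m <= m')%N -> P n m -> P n m') ->
  (forall n, exists m, P n m) -> exists m, forall n, (n <= N)%N -> P n m.
Proof.
move=> mono ex; elim: N => [|N [m IHm]].
  by have [m Pm] := ex 0%N; exists m => n; rewrite leqn0 => /eqP->.
have [m' Pm'] := ex N.+1; exists (maxn m m') => n.
rewrite leq_eqVlt ltnS => /orP[/eqP->|/IHm]; first by apply: mono Pm'; rewrite leq_maxr.
by apply: mono; rewrite leq_maxl.
Qed.

Section Chains.

Local Open Scope ring_scope.
Import GRing.Theory.

Variables (K : fieldType) (r : nat).
Local Notation S := {mpoly K[r]}.

(** Among the matrices with row space inside [A] one of maximal rank is chosen; adding a vector of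
    [A] to it cannot raise the rank. *)
Lemma subsp_rV_matrix d (A : 'rV[K]_d -> Prop) :
  A 0 -> (forall k x y, A x -> A y -> A (k *: x + y)) ->
  exists B : 'M[K]_d, forall c, A c <-> (c <= B)%MS.
Proof.
move=> A0 AD.
have A_lin m (M : 'M_(m, d)) : (forall i, A (row i M)) -> forall c, (c <= M)%MS -> A c.
  move=> AM c /submxP[e ->]; rewrite mulmx_sum_row.
  apply: (big_ind A) => // [x y Ax Ay|i _]; first by rewrite -[x]scale1r; apply: AD.
  by rewrite -[_ *: _]addr0; apply: AD.
pose P n := exists2 B : 'M[K]_d, \rank B = n & forall c, (c <= B)%MS -> A c.
have [|n [B rB]|n [B rB BA] nmax] := @bounded_max P d.
- by exists 0%N, 0; rewrite ?mxrank0 // => c; rewrite submx0 => /eqP ->.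
- by move=> _; rewrite -rB; apply: rank_leq_row.
exists B => c; split=> [Ac|]; last exact: BA.
have : (\rank (B + c)%MS <= n)%N.
  apply: nmax; exists (B + c)%MS => // x /sub_addsmxP[[u v] /= ->].
  rewrite -[u *m B]scale1r; apply: (AD); first by apply: BA; apply: submxMl.
  rewrite [v]mx11_scalar mul_scalar_mx -[_ *: _]addr0; exact: AD.
rewrite -rB => le_rk; apply: submx_trans (addsmxSr B c) _.
by have /mxrank_leqif_sup[_ <-] := addsmxSl B c; rewrite eqn_leq le_rk mxrankS ?addsmxSl.
Qed.

Definition spanned (V : lmodType S) (U W : V -> Prop) : Prop :=
  exists d (b : 'I_d -> V), forall x, U x -> exists c, W (x - lincomb b c).

Lemma qdim_spanned (V : lmodType S) (U W : V -> Prop) d : qdim U W d -> spanned U W.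
Proof. by move=> [b [_ _ bS]]; exists d, b. Qed.

(** Modulo [W] the chain is visible in the coordinate subspaces [B n] of K^d; it is constant from
    the step at which their rank is maximal. *)
Lemma spanned_chain (V : lmodType S) (U W : V -> Prop) (L : nat -> V -> Prop) :
  spanned U W -> (forall n, subsp (L n)) ->
  (forall n x, W x -> L n x) -> (forall n x, L n x -> U x) ->
  (forall n x, L n x -> L n.+1 x) ->
  exists n0, forall n x, L n x -> L n0 x.
Proof.
move=> [d [b bS]] Ls WL LU Lasc.
have Lmono m n x : (m <= n)%N -> L m x -> L n x.
  move=> /subnK <-; elim: (n - m)%N => //= e IHe /IHe; exact: Lasc.
have ex n : exists B : 'M[K]_d, forall c, L n (lincomb b c) <-> (c <= B)%MS.
  apply: subsp_rV_matrix; first by rewrite lincomb0; apply: (Ls n).1.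
  by move=> k x y Lx Ly; rewrite lincombP; apply: (Ls n).2.
pose B n := sval (cid (ex n)).
have BP n c : L n (lincomb b c) <-> (c <= B n)%MS.
  by rewrite /B; case: cid.
have Bmono m n : (m <= n)%N -> (B m <= B n)%MS.
  by move=> mn; apply/row_subP => i; apply/BP/(Lmono m) => //; apply/BP/row_sub.
pose P k := exists n, \rank (B n) = k.
have [|k [n <-]|k [n0 n0E] kmax] := @bounded_max P d.
- by exists (\rank (B 0%N)), 0%N.
- exact: rank_leq_row.
exists n0 => n x Lx; case: (leqP n n0) => [le_n|/ltnW le_n]; first exact: Lmono Lx.
have [c Wc] := bS _ (LU _ _ Lx).
have Lc : L n (lincomb b c).
  by apply: (subspDl (Ls n) (x := x - lincomb b c)); [exact: WL|rewrite subrK].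
apply: (subspDr (Ls n0) (y := - lincomb b c)); last exact: WL.
apply: (subspN (Ls n0)); apply/BP; move/BP: Lc => /submx_trans; apply.
have /mxrank_leqif_sup[_ <-] := Bmono _ _ le_n.
by rewrite n0E eqn_leq -{1}n0E mxrankS ?Bmono //=; apply: kmax; exists n.
Qed.

End Chains.

(** * Hilbert's basis theorem for graded families of subspaces *)

Section Noetherian.

Local Open Scope ring_scope.
Import GRing.Theory.

Variables (K : fieldType) (r : nat) (a : 'I_r -> nat).
Hypothesis a_gt0 : forall i, (0 < a i)%N.
Local Notation S := {mpoly K[r]}.
Implicit Types V : lmodType S.

(** The twist U(-m), which is zero in degrees below [m]. *)
Definition sh V (m : nat) (U : nat -> V -> Prop) (j : nat) (x : V) : Prop :=
  if (m <= j)%N then U (j - m)%N x else x = 0.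

(* Families [U 0, U 1, ...] of K-subspaces, not necessarily independent, with
   [x_i U_j] contained in [U_(j + a i)] for the first [k] variables. *)
Definition gsub V (k : nat) (U : nat -> V -> Prop) : Prop :=
  (forall j, subsp (U j)) /\
  forall i : 'I_r, (i < k)%N -> forall j x, U j x -> U (a i + j)%N ('X_i *: x).

Definition gens V (k : nat) (U W : nat -> V -> Prop) (j : nat) (x : V) : Prop :=
  exists2 c : 'I_r -> V, forall i : 'I_r, (i < k)%N -> sh (a i) U j (c i) &
  W j (x - \sum_(i < r | (i < k)%N) 'X_i *: c i).

(** With finite-dimensional components, finite generation of T/W means that above some degree [J]
    every element lies in (x_1, ..., x_k) T + W. It is required of all graded [T] between [W] and
    [U], so that subquotients inherit it. *)
Definition noeth V (k : nat) (U W : nat -> V -> Prop) : Prop :=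
  forall T, gsub k T -> (forall j x, W j x -> T j x) ->
  (forall j x, T j x -> U j x) ->
  exists J, forall j, (J < j)%N -> forall x, T j x -> gens k T W j x.

Lemma sh_subsp V m (U : nat -> V -> Prop) j : (forall j, subsp (U j)) -> subsp (sh m U j).
Proof.
rewrite /sh; case: leqP => // _ _; split=> // k x y -> ->.
by rewrite scaler0 addr0.
Qed.

Lemma sh_sub V m (U U' : nat -> V -> Prop) j x :
  (forall j x, U j x -> U' j x) -> sh m U j x -> sh m U' j x.
Proof. by move=> UU; rewrite /sh; case: leqP => // _; apply: UU. Qed.

Lemma shE V m (U : nat -> V -> Prop) j x : sh m U (m + j) x <-> U j x.
Proof. by rewrite /sh leq_addr addKn. Qed.

Lemma gsub_sh V k m (U : nat -> V -> Prop) : gsub k U -> gsub k (sh m U).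
Proof.
move=> [Us UX]; split=> [j|i ik j x]; first exact: sh_subsp.
rewrite /sh; case: leqP => [mj|_ ->]; last first.
  by case: leqP => _; rewrite scaler0 //; apply: (Us _).1.
by rewrite (leq_trans mj (leq_addl _ _)) -addnBA //; apply: UX.
Qed.

Lemma sum_ltnS V (k : nat) (kr : (k < r)%N) (F : 'I_r -> V) :
  \sum_(i < r | (i < k.+1)%N) F i
  = F (Ordinal kr) + \sum_(i < r | (i < k)%N) F i.
Proof.
rewrite (bigD1 (Ordinal kr)) ?leqnn //=; congr (_ + _).
apply: eq_bigl => i; rewrite ltnS leq_eqVlt -val_eqE /=.
by case: eqP => [->|]; rewrite ?ltnn ?andbT ?andbF.
Qed.

Lemma gens_subsp V k (U W : nat -> V -> Prop) j :
  (forall j, subsp (U j)) -> (forall j, subsp (W j)) -> subsp (gens k U W j).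
Proof.
move=> Us Ws; split.
  exists (fun=> 0) => [i _|]; first exact: (sh_subsp _ _ Us).1.
  by rewrite big1 ?subr0 => [|i _]; [exact: (Ws j).1|rewrite scaler0].
move=> s x y [c cU Wc] [d dU Wd].
exists (fun i => s%:MP *: c i + d i) => [i ik|].
  by apply: (sh_subsp _ _ Us).2; [exact: cU|exact: dU].
rewrite (eq_bigr (fun i => s%:MP *: ('X_i *: c i) + 'X_i *: d i)) => [|i _].
  rewrite big_split -scaler_sumr /= opprD addrACA -scalerBr.
  exact: (Ws j).2.
by rewrite scalerDr !scalerA mulrC.
Qed.

Lemma gens_W V k (U W : nat -> V -> Prop) j x : (forall j, subsp (U j)) ->
  W j x -> gens k U W j x.
Proof.
move=> Us Wx; exists (fun=> 0) => [i _|]; first exact: (sh_subsp _ _ Us).1.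
by rewrite big1 ?subr0 // => i _; rewrite scaler0.
Qed.

Lemma gens_X V k (U W : nat -> V -> Prop) j (i : 'I_r) x :
  (forall j, subsp (U j)) -> (forall j, subsp (W j)) ->
  (i < k)%N -> sh (a i) U j x -> gens k U W j ('X_i *: x).
Proof.
move=> Us Ws ik Ux; exists (fun i' => if i' == i then x else 0) => [i' _|].
  by case: eqP => [->|_] //; apply: (sh_subsp _ _ Us).1.
rewrite (bigD1 i) //= eqxx big1 ?addr0 ?subrr => [|i' /andP[_ /negPf->]].
  exact: (Ws j).1.
by rewrite scaler0.
Qed.

Lemma gsub_exp V k (U : nat -> V -> Prop) (i : 'I_r) n j x : gsub k U -> (i < k)%N ->
  U j x -> U (n * a i + j)%N ('X_i ^+ n *: x).
Proof.
move=> [Us UX] ik Ux; elim: n => [|n IHn]; first by rewrite scale1r.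
by rewrite exprS -scalerA mulSn -addnA; apply: UX.
Qed.

Lemma gsubW V k k' (U : nat -> V -> Prop) : (k' <= k)%N -> gsub k U -> gsub k' U.
Proof. by move=> kk [Us UX]; split=> // i ik; apply: UX; apply: leq_trans kk. Qed.

(* Hilbert's basis theorem, by induction on the number of variables. *)
Lemma noeth_of_fg V k (U W : nat -> V -> Prop) : (k <= r)%N ->
  gsub k U -> gsub k W -> (forall j x, W j x -> U j x) ->
  (forall j, spanned (U j) (W j)) ->
  (exists J, forall j, (J < j)%N -> forall x, U j x -> gens k U W j x) ->
  noeth k U W.
Proof.
elim: k U W => [|k IHk] U W.
  move=> _ Us Ws WU _ [J JP] T Ts WT TU; exists J => j /JP {}JP x /TU /JP [c _].
  rewrite big_pred0 // => Wx; apply: gens_W; first exact: Ts.1.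
  by rewrite subr0 in Wx.
move=> kr Ug Wg WU span [J0 J0P] T Tg WT TU.
have [[Us UX] [Ws WX]] := (Ug, Wg); have [Ts TX] := Tg.
pose i0 := Ordinal kr; pose X : S := 'X_i0; pose m := a i0.
have i0k : (i0 < k.+1)%N by [].
(* [W1] is W + X U, so U/W1 only involves the first [k] variables and the induction hypothesis
   applies to it. *)
pose W1 j x := exists2 u, sh m U j u & W j (x - X *: u).
have W1s j : subsp (W1 j).
  split; first by exists 0; [exact: (sh_subsp _ _ Us).1|rewrite scaler0 subr0; exact: (Ws j).1].
  move=> s x y [u Uu Wu] [v Uv Wv]; exists (s%:MP *: u + v).
    exact: (sh_subsp _ _ Us).2.
  rewrite scalerDr scalerA [X * _]mulrC -scalerA opprD addrACA -scalerBr.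
  exact: (Ws j).2.
have W1g : gsub k W1.
  split=> // i ik j x [u Uu Wu]; exists ('X_i *: u).
    by apply: (gsub_sh _ Ug).2 => //; apply: ltnW.
  by rewrite scalerA [X * _]mulrC -scalerA -scalerBr; apply: WX => //; apply: ltnW.
have WW1 j x : W j x -> W1 j x.
  by exists 0; [exact: (sh_subsp _ _ Us).1|rewrite scaler0 subr0].
have XU j u : sh m U j u -> U j (X *: u).
  rewrite /sh; case: leqP => [mj|_ ->]; last by rewrite scaler0; apply: (Us j).1.
  by move=> Uu; rewrite -(subnKC mj); apply: UX.
have W1U j x : W1 j x -> U j x.
  move=> [u /XU Uu /WU Wu]; apply: (subspDr (Us j)) Wu.
  exact: (subspN (Us j)).
have noeth1 : noeth k U W1.
  apply: (IHk) => //; [exact: ltnW|exact: gsubW Ug| |].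
    move=> j; have [d [b bP]] := span j; exists d, b => x /bP[c Wc].
    by exists c; apply: WW1.
  exists J0 => j Jj x /(J0P _ Jj)[c cU]; rewrite (sum_ltnS kr) opprD addrCA addrC => Wc.
  exists c => [i ik|]; first by apply: cU; apply: ltnW.
  by exists (c i0); [exact: cU|].
(* The leading-coefficient modules of Hilbert's proof, for the X-adic order: classes modulo [W1] of
   the [y] with X^n y in [T]. *)
pose L n j x := exists y, [/\ U j y, T (n * m + j)%N (X ^+ n *: y) & W1 j (x - y)].
have Ls n j : subsp (L n j).
  split.
    exists 0; split; [exact: (Us j).1|by rewrite scaler0; apply: (Ts _).1|].
    by rewrite subr0; apply: (W1s j).1.
  move=> s x x' [y [Uy Ty Wy]] [y' [Uy' Ty' Wy']]; exists (s%:MP *: y + y'); split.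
  - exact: (Us j).2.
  - by rewrite scalerDr scalerA mulrC -scalerA; apply: (Ts _).2.
  - by rewrite opprD addrACA -scalerBr; apply: (W1s j).2.
have Lg n : gsub k (L n).
  split=> // i ik j x [y [Uy Ty Wy]]; have ik1 := ltnW ik; exists ('X_i *: y); split.
  - exact: UX.
  - by rewrite scalerA mulrC -scalerA addnCA; apply: TX.
  - by rewrite -scalerBr; apply: W1g.2.
have W1L n j x : W1 j x -> L n j x.
  move=> Wx; exists 0; split; [exact: (Us j).1| |by rewrite subr0].
  by rewrite scaler0; apply: (Ts _).1.
have LU n j x : L n j x -> U j x.
  move=> [y [Uy _ /W1U Wy]]; rewrite -[x](subrK y); exact: (subspD (Us j)).
have Lasc n j x : L n j x -> L n.+1 j x.
  move=> [y [Uy Ty Wy]]; exists y; split=> //.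
  by rewrite exprS -scalerA mulSn -addnA; apply: TX.
have Lmono n n' j x : (n <= n')%N -> L n j x -> L n' j x.
  by move=> /subnK <-; elim: (n' - n)%N => //= e IHe /IHe; apply: Lasc.
pose Li j x := exists n, L n j x.
have Lig : gsub k Li.
  split=> [j|i ik j x [n Lx]]; last by exists n; apply: (Lg n).2.
  split; first by exists 0%N; apply: (Ls _ _).1.
  move=> s x y [n Lx] [n' Ly]; exists (maxn n n'); apply: (Ls _ _).2.
    by apply: Lmono Lx; rewrite leq_maxl.
  by apply: Lmono Ly; rewrite leq_maxr.
have [J JP] : exists J, forall j, (J < j)%N -> forall x, Li j x -> gens k Li W1 j x.
  by apply: noeth1 => // j x; [exists 0%N; apply: W1L|move=> [n /LU]].
(* Modulo [W1] the union of the chain is generated in degrees at most [J]. In these finitely many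
   degrees the chain stops because U_j / W_j is finite-dimensional; [Lstab] then climbs to all
   degrees by induction. *)
have [n0 n0P] : exists n0, forall j, (j <= J)%N -> forall n x, L n j x -> L n0 j x.
  apply: uniform_bound => [j n1 n2 n12 H n x /H|j]; first exact: Lmono.
  apply: (@spanned_chain _ _ _ (U j) (W1 j) (fun n => L n j)) => [|n|n x|n x|n x].
  2: exact: Ls. 2: exact: W1L. 2: exact: LU. 2: exact: Lasc.
  have [d [b bP]] := span j; exists d, b => x /bP[c Wc].
  by exists c; apply: WW1.
have Lstab j : forall n x, L n j x -> L n0 j x.
  elim/ltn_ind: j => j IHj n x Lx; case: (leqP j J) => [jJ|Jj]; first exact: n0P Lx.
  have [c cL Wc] : gens k Li W1 j x by apply: JP => //; exists n.
  rewrite -[x](subrK (\sum_(i < r | (i < k)%N) 'X_i *: c i)).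
  apply: (subspD (Ls _ _)); first exact: W1L.
  apply: (subsp_sum (Ls _ _)) => i ik; move: (cL i ik); rewrite /sh.
  case: leqP => [aj [n' Lc]|_ ->]; last by rewrite scaler0; apply: (Ls _ _).1.
  rewrite -[X in L _ X](subnKC aj); apply: (Lg _).2 => //; apply: IHj Lc.
  by have := a_gt0 i; lia.
have [J1 J1P] : exists J1, forall n, (n <= n0)%N -> forall j, (J1 < j)%N ->
    forall x, L n j x -> gens k (L n) W1 j x.
  apply: uniform_bound => [n j1 j2 j12 H j jj|n]; first by apply: H; lia.
  by apply: noeth1 => // j x; [exact: W1L|exact: LU].
have Gs t : subsp (gens k.+1 T W t) by exact: gens_subsp.
(* In degree [t] above this bound, X^n y with n <= n0 has [y] in degree above [J1], where [L n] is
   generated from lower degrees. The induction is on the degree of [y], which drops each time [n]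
   rises. *)
exists (J1 + n0 * m)%N => t Jt.
suff main j n y : t = (n * m + j)%N -> U j y -> T t (X ^+ n *: y) ->
    gens k.+1 T W t (X ^+ n *: y).
  by move=> x Tx; rewrite -[x]scale1r -(expr0 X); apply: main (TU _ _ Tx) _; rewrite ?scale1r.
elim/ltn_ind: j n y => j IHj n y tE Uy Ty.
(* It suffices to write X^n y, modulo W, as a generated element plus X^(n+1) u. *)
have finish z u : T t z -> gens k.+1 T W t z -> sh m U j u ->
    W t (X ^+ n *: y - z - X ^+ n.+1 *: u) -> gens k.+1 T W t (X ^+ n *: y).
  move=> Tz Gz Uu Wu; apply: (subspDr (Gs t) (y := - z)); first exact: (subspN (Gs t)).
  apply: (subspDr (Gs t) (y := - (X ^+ n.+1 *: u))); last exact: gens_W.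
  apply: (subspN (Gs t)).
  have Tu : T t (X ^+ n.+1 *: u).
    apply: (subspDl (Ts t)) (_ : T t (X ^+ n *: y - z - X ^+ n.+1 *: u + _)); last first.
      by rewrite subrK; apply: (subspB (Ts t)).
    exact: WT.
  move: Uu; rewrite /sh; case: leqP => [mj Uu|_ u0]; last first.
    by rewrite u0 scaler0; apply: (Gs t).1.
  apply: (IHj (j - m)%N) => //; first by have := a_gt0 i0; rewrite -/m; lia.
  by rewrite mulSn; lia.
have Ly : L n j y by exists y; rewrite subrr -tE; split=> //; apply: (W1s j).1.
case: (leqP n n0) => [nn0|n0n].
  have [|c cL [u Uu Wu]] := J1P n nn0 j _ y Ly.
    have : (n * m <= n0 * m)%N by rewrite leq_mul2r nn0 orbT.
    by lia.
  have ex (i : 'I_r) : exists y, (i < k)%N -> [/\ sh (a i) U j y,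
      sh (a i) T t (X ^+ n *: y) & sh (a i) W1 j (c i - y)].
    case: (leqP k i) => [_|/cL]; first by exists 0.
    rewrite /sh; case: (leqP (a i) j) => [aj|ja].
      move=> [y' [H1 H2 H3]]; exists y' => _; split=> //.
      by rewrite ifT; [rewrite tE -addnBA | lia].
    move=> ->; exists 0 => _; split; rewrite ?subrr ?scaler0 //.
    by case: ifP => // _; apply: (Ts _).1.
  pose e i := sval (cid (ex i)).
  have eP (i : 'I_r) : (i < k)%N -> [/\ sh (a i) U j (e i),
      sh (a i) T t (X ^+ n *: e i) & sh (a i) W1 j (c i - e i)].
    by rewrite /e; case: cid.
  have [u' Uu' Wu'] : W1 j (y - \sum_(i < r | (i < k)%N) 'X_i *: e i).
    apply: (subspBB (W1s j)) (_ : W1 j (y - \sum_(i < r | (i < k)%N) 'X_i *: c i)) _.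
      by exists u.
    rewrite -sumrB; apply: (subsp_sum (W1s j)) => i ik; rewrite -scalerBr.
    have [_ _] := eP i ik; rewrite /sh; case: leqP => [aj Wi|_ ->].
      by rewrite -(subnKC aj); apply: W1g.2.
    by rewrite scaler0; apply: (W1s j).1.
  apply: (finish (\sum_(i < r | (i < k)%N) 'X_i *: (X ^+ n *: e i)) u') => //.
  - apply: (subsp_sum (Ts t)) => i ik; have [_ + _] := eP i ik.
    rewrite /sh; case: leqP => [at' Ti|_ ->]; last by rewrite scaler0; apply: (Ts t).1.
    by rewrite -(subnKC at'); apply: TX => //; apply: ltnW.
  - apply: (subsp_sum (Gs t)) => i ik; have [_ ? _] := eP i ik.
    by apply: gens_X => //; apply: ltnW.
  - rewrite (eq_bigr (fun i => X ^+ n *: ('X_i *: e i))); last first.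
      by move=> i _; rewrite !scalerA mulrC.
    by rewrite -scaler_sumr exprSr -scalerA -!scalerBr tE; apply: (gsub_exp _ Wg).
(* For n > n0, stability replaces [y] modulo [W1] by some [y'] with X^n0 y' in [T]; then X^n y' is
   [X] times an element of [T]. *)
have [y' [Uy' Ty' [u Uu Wu]]] := Lstab _ _ _ Ly.
have nE : n = ((n - n0).-1.+1 + n0)%N by lia.
have Ty1 : T ((n - n0).-1 * m + (n0 * m + j))%N (X ^+ (n - n0).-1 *: (X ^+ n0 *: y')).
  exact: (gsub_exp _ Tg).
have XnE : X ^+ n *: y' = X *: (X ^+ (n - n0).-1 *: (X ^+ n0 *: y')).
  by rewrite !scalerA -exprS -exprD; congr (X ^+ _ *: _); lia.
have tE' : t = (m + ((n - n0).-1 * m + (n0 * m + j)))%N.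
  by rewrite tE {1}nE mulnDl mulSn; lia.
apply: (finish (X ^+ n *: y') u) => //.
- by rewrite XnE tE'; apply: TX.
- by rewrite XnE; apply: gens_X => //; rewrite tE'; apply/shE.
- by rewrite exprSr -scalerA -!scalerBr tE; apply: (gsub_exp _ Wg).
Qed.

Lemma noeth_sub V k (U W U' W' : nat -> V -> Prop) :
  (forall j x, U' j x -> U j x) -> (forall j x, W j x -> W' j x) ->
  noeth k U W -> noeth k U' W'.
Proof.
move=> UU WW nUW T Tg WT TU.
have [|j x|J JP] := nUW T Tg; [by move=> j x /WW/WT|by move=> /TU/UU|].
by exists J => j /JP {}JP x /JP[c cT Wc]; exists c => //; apply: WW.
Qed.

Lemma gensS V k (U U' W : nat -> V -> Prop) j x :
  (forall j x, U j x -> U' j x) -> gens k U W j x -> gens k U' W j x.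
Proof. by move=> UU [c cU Wc]; exists c => // i /cU; apply: sh_sub. Qed.

Lemma gsub_sum V k (U : nat -> V -> Prop) j (c : 'I_r -> V) : gsub k U ->
  (forall i : 'I_r, (i < k)%N -> sh (a i) U j (c i)) ->
  U j (\sum_(i < r | (i < k)%N) 'X_i *: c i).
Proof.
move=> [Us UX] cU; apply: (subsp_sum (Us j)) => i ik; move: (cU i ik).
rewrite /sh; case: leqP => [aj Uc|_ ->]; last by rewrite scaler0; apply: (Us j).1.
by rewrite -(subnKC aj); apply: UX.
Qed.

(** An extension of Noetherian modules. Generation of T + L modulo [L], with coefficients lifted to
    [T], reduces an element of [T] to one lying in both [T] and [L], where generation modulo [W] is
    available. *)
Lemma noeth_ext V k (U L W : nat -> V -> Prop) : gsub k L ->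
  (forall j, subsp (U j)) -> (forall j, subsp (W j)) ->
  (forall j x, L j x -> U j x) -> (forall j x, W j x -> L j x) ->
  noeth k U L -> noeth k L W -> noeth k U W.
Proof.
move=> Lg Us Ws LU WL nUL nLW T Tg WT TU; have [[Ls LX] [Ts TX]] := (Lg, Tg).
pose T1 j x := exists2 u, T j u & L j (x - u).
have [|||J1 J1P] := nUL T1.
- split=> [j|i ik j x [u Tu Lu]]; first exact: subsp_add.
  by exists ('X_i *: u); [exact: TX | rewrite -scalerBr; apply: LX].
- by move=> j x Lx; exists 0; rewrite ?subr0 //; apply: (Ts j).1.
- by move=> j x [u /TU Tu /LU Lu]; apply: (subspDr (Us j)) Lu; apply: (subspN (Us j)).
have [|||J2 J2P] := nLW (fun j x => T j x /\ L j x).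
- split=> [j|i ik j x [Tx Lx]]; first exact: subsp_inter.
  by split; [exact: TX | exact: LX].
- by move=> j x Wx; split; [exact: WT | exact: WL].
- by move=> j x [].
exists (maxn J1 J2) => j; rewrite gtn_max => /andP[J1j J2j] x Tx.
have [|c cT1 Lc] := J1P j J1j x; first by exists x; rewrite ?subrr //; apply: (Ls j).1.
have ex (i : 'I_r) : exists y, (i < k)%N -> sh (a i) T j y /\ sh (a i) L j (c i - y).
  case: (leqP k i) => [_|/cT1]; first by exists 0.
  rewrite /sh; case: ifP => _ => [[y Ty Ly]|->]; first by exists y.
  by exists 0; rewrite subr0.
pose e i := sval (cid (ex i)).
have eP (i : 'I_r) : (i < k)%N -> sh (a i) T j (e i) /\ sh (a i) L j (c i - e i).
  by rewrite /e; case: cid.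
have Le : L j (x - \sum_(i < r | (i < k)%N) 'X_i *: e i).
  apply: (subspBB (Ls j)) Lc _; rewrite -sumrB.
  rewrite (eq_bigr (fun i => 'X_i *: (c i - e i))) => [|i _]; last by rewrite scalerBr.
  by apply: gsub_sum => // i /eP[].
have Te : T j (\sum_(i < r | (i < k)%N) 'X_i *: e i) by apply: gsub_sum => // i /eP[].
rewrite -[x](subrK (\sum_(i < r | (i < k)%N) 'X_i *: e i)).
have Gs := gens_subsp k j Ts Ws.
apply: (subspD Gs).
  apply: gensS (J2P j J2j _ _); first by move=> ? ? [].
  by split=> //; apply: (subspB (Ts j)).
by apply: (subsp_sum Gs) => i ik; apply: gens_X => //; case: (eP i ik).
Qed.

(* [rho] relates degree [m + s] on the left with degree [m] on the right. *)
Lemma noeth_transfer V V' k s (U W : nat -> V -> Prop) (U' W' : nat -> V' -> Prop)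
    (rho : nat -> V -> V' -> Prop) :
  gsub k U' -> gsub k W' -> (forall j x, W' j x -> U' j x) ->
  (forall m, linrel (rho m)) ->
  (forall (i : 'I_r) m x y, (i < k)%N -> rho m x y -> rho (a i + m)%N ('X_i *: x) ('X_i *: y)) ->
  (forall m x, U (m + s)%N x -> exists2 y, U' m y & rho m x y) ->
  (forall m x y, U (m + s)%N x -> rho m x y -> W' m y -> W (m + s)%N x) ->
  noeth k U' W' -> noeth k U W.
Proof.
move=> Ug' Wg' WU' rhoL rhoX tot WW nUW T Tg WT TU; have [Ts TX] := Tg.
(* [T0] is the image of [T] in [U']; the hypothesis on [U'] and [W'] is applied to T0 + W'. *)
pose T0 m y := U' m y /\ exists2 x, T (m + s)%N x & rho m x y.
have T0g : gsub k T0.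
  split=> [m|i ik m y [Uy [x Tx xy]]].
    split; first by split; [exact: (Ug'.1 _).1 | exists 0; [exact: (Ts _).1 | exact: (rhoL m).1]].
    move=> l y y' [Uy [x Tx xy]] [Uy' [x' Tx' xy']]; split; first exact: (Ug'.1 _).2.
    by exists (l%:MP *: x + x'); [exact: (Ts _).2 | exact: (rhoL m).2].
  split; first exact: Ug'.2.
  by exists ('X_i *: x); [rewrite -addnA; apply: TX | apply: rhoX].
pose T' m y := exists2 u, T0 m u & W' m (y - u).
have [|||J JP] := nUW T'.
- split=> [m|i ik m x [u Tu Wu]]; first by apply: subsp_add; [exact: T0g.1|exact: Wg'.1].
  by exists ('X_i *: u); [exact: T0g.2 | rewrite -scalerBr; apply: Wg'.2].
- move=> m x Wx; exists 0; [exact: (T0g.1 m).1|by rewrite subr0].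
- move=> m x [u [Uu _] /WU' Wu]; apply: (subspDr (Ug'.1 m)) Wu.
  exact: (subspN (Ug'.1 m)).
exists (J + s)%N => j Jj x Tx; have [m jE] : exists m, j = (m + s)%N.
  by exists (j - s)%N; lia.
rewrite {j}jE in Jj Tx *; have Jm : (J < m)%N by lia.
have [y Uy xy] := tot m x (TU _ _ Tx).
have [|c cT' Wc] := JP m Jm y.
  by exists y; [split=> //; exists x|rewrite subrr; apply: (Wg'.1 _).1].
have ex (i : 'I_r) : exists z, (i < k)%N -> exists u, [/\ sh (a i) T (m + s)%N z,
    sh (a i) W' m (c i - u) & rho m ('X_i *: z) ('X_i *: u)].
  case: (leqP k i) => [_|ik]; first by exists 0.
  have := cT' i ik; rewrite /sh; case: (leqP (a i) m) => [am|_].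
    move=> [u [Uu [z Tz zu]] Wu]; exists z => _; exists u; split=> //.
      by rewrite ifT; [rewrite -addnBAC|lia].
    by rewrite -(subnKC am); apply: rhoX.
  move=> ->; exists 0 => _; exists 0; split; rewrite ?subrr ?scaler0 //.
    by case: ifP => // _; apply: (Ts _).1.
  exact: (rhoL m).1.
pose e i := sval (cid (ex i)).
have eP (i : 'I_r) : (i < k)%N -> exists u, [/\ sh (a i) T (m + s)%N (e i),
    sh (a i) W' m (c i - u) & rho m ('X_i *: e i) ('X_i *: u)].
  by rewrite /e; case: cid.
have ex2 (i : 'I_r) : exists u, (i < k)%N -> [/\ sh (a i) T (m + s)%N (e i),
    sh (a i) W' m (c i - u) & rho m ('X_i *: e i) ('X_i *: u)].
  by case: (leqP k i) => [_|/eP[u uP]]; [exists 0|exists u].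
pose f i := sval (cid (ex2 i)).
have fP (i : 'I_r) : (i < k)%N -> [/\ sh (a i) T (m + s)%N (e i),
    sh (a i) W' m (c i - f i) & rho m ('X_i *: e i) ('X_i *: f i)].
  by rewrite /f; case: cid.
exists e => [i /fP[]//|].
apply: (WW m _ (y - \sum_(i < r | (i < k)%N) 'X_i *: f i)).
- apply: TU; apply: (subspB (Ts _)) => //.
  by apply: gsub_sum => // i /fP[].
- by apply: (linrelB (rhoL m)) => //; apply: (linrel_sum (rhoL m)) => i /fP[].
apply: (subspBB (Wg'.1 m)) Wc _; rewrite -sumrB.
rewrite (eq_bigr (fun i => 'X_i *: (c i - f i))) => [|i _]; last by rewrite scalerBr.
by apply: gsub_sum => // i /fP[].
Qed.

Lemma noeth_triv V k (U W : nat -> V -> Prop) :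
  (forall j x, U j x -> W j x) -> noeth k U W.
Proof.
move=> UW T Tg _ TU; exists 0%N => j _ x /TU/UW Wx.
by apply: gens_W => //; apply: Tg.1.
Qed.

End Noetherian.

(** * Graded and projective modules *)

Section Graded.

Local Open Scope ring_scope.
Import GRing.Theory.

Variables (K : fieldType) (r : nat) (a : 'I_r -> nat).
Local Notation S := {mpoly K[r]}.

Lemma homogC (k : K) : k%:MP_[r] \is 0.-homog for (wdeg a).
Proof. by rewrite -[k]mulr1 mpolyCM mpolyC1 mul_mpolyC; apply/dhomogZ/dhomog1. Qed.

Lemma homogX (i : 'I_r) : ('X_i : S) \is (a i).-homog for (wdeg a).
Proof.
rewrite dhomogX; change (wdeg a U_(i)%MM == a i); rewrite /wdeg (bigD1 i) //= mnm1E eqxx mul1n big1 ?addn0 // => j.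
by rewrite mnm1E eq_sym => /negPf->.
Qed.

Section OneModule.
Variable M : grModule K a.
Implicit Types x y : M.

Lemma grcomp_subsp n : subsp (grcomp (g := M) n).
Proof.
split=> [|k x y Mx My]; first exact: grcomp0.
by apply: grcompD => //; rewrite -[n]add0n; apply: grcompZ => //; apply: homogC.
Qed.

Lemma grcomp_gsub k : gsub a k (grcomp (g := M)).
Proof. by split=> [j|i _ j x Mx]; [exact: grcomp_subsp | apply: grcompZ (homogX i) Mx]. Qed.

Definition decomposes (c : nat -> M) (N : nat) x : Prop :=
  [/\ forall n, grcomp n (c n), forall n, (N <= n)%N -> c n = 0 &
      x = \sum_(n < N) c n].

Lemma decomposes_le c N N' x : decomposes c N x -> (N <= N')%N -> decomposes c N' x.
Proof.
move=> [cM c0 ->] NN; split=> // [n Nn|]; first by apply: c0; apply: leq_trans Nn.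
rewrite -(subnKC NN) big_split_ord /= [X in _ = _ + X]big1 ?addr0 // => i _.
by apply: c0; rewrite leq_addr.
Qed.

Lemma decomposes_uniq c N c' N' x :
  decomposes c N x -> decomposes c' N' x -> c =1 c'.
Proof.
move=> cx c'x n; pose m := maxn n.+1 (maxn N N').
have [cM _ xE] := decomposes_le (N' := m) cx ltac:(rewrite /m; lia).
have [cM' _ xE'] := decomposes_le (N' := m) c'x ltac:(rewrite /m; lia).
apply/eqP; rewrite -subr_eq0; apply/eqP.
apply: (@grcomp_indep _ _ _ M m (fun n => c n - c' n)) => [k||].
- exact: (subspB (grcomp_subsp k)).
- by rewrite sumrB -xE -xE' subrr.
- by rewrite /m; lia.
Qed.

Lemma decomposes_ex x : exists c, exists N, decomposes c N x.
Proof.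
have [N [c [cM ->]]] := grcomp_span x.
exists (fun n => if (n < N)%N then c n else 0), N; split=> [n|n|].
- by case: ifP => // _; apply: grcomp0.
- by rewrite ltnNge => ->.
- by apply: eq_bigr => i _; rewrite ltn_ord.
Qed.

(** The homogeneous component of degree [n], read off a chosen decomposition; [decomposes_uniq]
    makes the choice irrelevant. *)
Definition gc n x : M := sval (cid (decomposes_ex x)) n.

Lemma gc_decomposes x : exists N, decomposes (gc^~ x) N x.
Proof. by rewrite /gc; case: cid. Qed.

Lemma gcE c N x n : decomposes c N x -> gc n x = c n.
Proof. by move=> cx; have [N' xN'] := gc_decomposes x; apply: decomposes_uniq xN' cx n. Qed.

Lemma gc_grcomp n x : grcomp n (gc n x).
Proof. by have [N []] := gc_decomposes x. Qed.

Lemma gcD n : {morph gc n : x y / x + y}.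
Proof.
move=> x y; have [N1 D1] := gc_decomposes x; have [N2 D2] := gc_decomposes y.
have [M1 Z1 E1] := decomposes_le D1 (leq_maxl N1 N2).
have [M2 Z2 E2] := decomposes_le D2 (leq_maxr N1 N2).
apply: (@gcE (fun n => gc n x + gc n y) (maxn N1 N2)); split=> [k|k kN|].
- exact: grcompD.
- by rewrite Z1 ?Z2 ?addr0.
- by rewrite big_split /= -E1 -E2.
Qed.

Lemma gcZ d n s x : s \is d.-homog for (wdeg a) ->
  gc n (s *: x) = if (d <= n)%N then s *: gc (n - d) x else 0.
Proof.
move=> sd; have [N [MN ZN EN]] := gc_decomposes x.
apply: (@gcE (fun n => if (d <= n)%N then s *: gc (n - d) x else 0) (d + N)%N).
split=> [k|k kN|].
- by case: leqP => dk; [rewrite -{1}(subnKC dk); apply: grcompZ|apply: grcomp0].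
- by case: ifP => // _; rewrite ZN ?scaler0 //; lia.
rewrite {1}EN big_split_ord /= [X in _ = X + _]big1 ?add0r => [|i _]; last by rewrite leqNgt ltn_ord.
by rewrite scaler_sumr; apply: eq_bigr => i _; rewrite leq_addr addKn.
Qed.

Lemma gcZC n k x : gc n (k%:MP *: x) = k%:MP *: gc n x.
Proof. by rewrite (gcZ _ _ (homogC k)) subn0. Qed.

Lemma gcX n i x : gc n ('X_i *: x) = if (a i <= n)%N then 'X_i *: gc (n - a i) x else 0.
Proof. exact: gcZ (homogX i). Qed.

Lemma gc0 n : gc n 0 = 0.
Proof. by rewrite -(scale0r (0 : M)) -mpolyC0 gcZC mpolyC0 !scale0r. Qed.

Lemma gcB n x y : gc n (x - y) = gc n x - gc n y.
Proof. by rewrite gcD -[- y]scaleN1r -mpolyC1 -mpolyCN gcZC mpolyCN mpolyC1 scaleN1r. Qed.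

Lemma gc_sum n (I : Type) (s : seq I) (P : pred I) (F : I -> M) :
  gc n (\sum_(i <- s | P i) F i) = \sum_(i <- s | P i) gc n (F i).
Proof. exact: (big_morph _ (gcD n) (gc0 n)). Qed.

Lemma gc_hom n m x : grcomp m x -> gc n x = if n == m then x else 0.
Proof.
move=> Mx; apply: (@gcE (fun n => if n == m then x else 0) m.+1); split=> [k|k mk|].
- by case: eqP => [->|_] //; apply: grcomp0.
- by case: eqP mk => // ->; rewrite ltnn.
- rewrite (bigD1 ord_max) //= eqxx big1 ?addr0 // => i.
  by rewrite -val_eqE /= => /negPf->.
Qed.

Lemma gc_id n x : grcomp n x -> gc n x = x.
Proof. by move=> /(gc_hom n); rewrite eqxx. Qed.

Lemma eq_gc x y : (forall n, gc n x = gc n y) -> x = y.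
Proof.
move=> xy; have [N1 D1] := gc_decomposes x; have [N2 D2] := gc_decomposes y.
have [_ _ ->] := decomposes_le D1 (leq_maxl N1 N2).
have [_ _ ->] := decomposes_le D2 (leq_maxr N1 N2).
by apply: eq_bigr.
Qed.

Lemma gc_sh (m : nat) n x : sh m (grcomp (g := M)) n (if (m <= n)%N then gc (n - m) x else 0).
Proof. by rewrite /sh; case: leqP => // _; apply: gc_grcomp. Qed.

End OneModule.

Lemma gc_linear (M N : grModule K a) (f : {linear M -> N}) :
  (forall n x, grcomp n x -> grcomp n (f x)) -> forall n x, gc n (f x) = f (gc n x).
Proof.
move=> fM n x; have [m [Mm Zm Em]] := gc_decomposes x.
apply: (@gcE _ (fun n => f (gc n x)) m); split=> [k|k mk|].
- exact/fM/gc_grcomp.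
- by rewrite Zm ?raddf0.
- by rewrite {1}Em raddf_sum.
Qed.

(** * The degree-preserving part of a linear map *)

Section DegreeZeroPart.
Variables (M N : grModule K a) (f : {linear M -> N}).

(** Projectivity is a property of the ungraded modules, so the maps it yields ignore the grading.
    Keeping only their part of degree 0 makes them homogeneous without spoiling their commutation
    with maps of degree 0. *)
Definition deg0 (x : M) : N :=
  \sum_(n < sval (cid (gc_decomposes x)))
    gc n (f (gc n x)).

Lemma gc_deg0 n x : gc n (deg0 x) = gc n (f (gc n x)).
Proof.
rewrite /deg0; case: cid => m /= [Mm Zm Em].
apply: (@gcE _ (fun n => gc n (f (gc n x))) m); split=> // [k|k mk].
  exact: gc_grcomp.
by rewrite Zm // raddf0 gc0.
Qed.

Lemma deg0D x y : deg0 (x + y) = deg0 x + deg0 y.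
Proof.
by apply: eq_gc => n; rewrite !(gc_deg0, gcD) raddfD gcD.
Qed.

(** By additivity it is enough to scale by a single term of [s], which is homogeneous. *)
Lemma deg0_linear : linear deg0.
Proof.
move=> s x y; rewrite deg0D; congr (_ + _).
rewrite [s]mpolyE !scaler_suml.
elim/big_rec2: _ => [|m u v _ IH].
  by apply: eq_gc => n; rewrite gc_deg0 gc0 raddf0.
rewrite deg0D {}IH; congr (_ + _).
have h : s@_m *: 'X_[m] \is (wdeg a m).-homog for (wdeg a).
  by apply: dhomogZ; rewrite dhomogX.
apply: eq_gc => n; rewrite gc_deg0 !(gcZ _ _ h).
case: leqP => le; last by rewrite raddf0 gc0.
by rewrite gc_deg0 linearZ (gcZ _ _ h) le.
Qed.

HB.instance Definition _ := GRing.isLinear.Build S M N _ deg0 deg0_linear.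

Lemma deg0_grcomp n x : grcomp n x -> grcomp n (deg0 x).
Proof.
move=> Mx; have -> : deg0 x = gc n (f x); last exact: gc_grcomp.
apply: eq_gc => k; rewrite gc_deg0 (gc_hom k Mx) (gc_hom k (gc_grcomp n _)).
by case: eqP => [->|]; rewrite ?raddf0 ?gc0.
Qed.

End DegreeZeroPart.

(** * The submodules (x_1, ..., x_k) M *)

Definition in_ideal (k : nat) (M : lmodType S) (x : M) : Prop :=
  exists c : 'I_r -> M, x = \sum_(i < r | (i < k)%N) 'X_i *: c i.

Section Ideal.
Variable (k : nat).

Lemma in_ideal_D (M : lmodType S) (x y : M) : in_ideal k x -> in_ideal k y -> in_ideal k (x + y).
Proof.
move=> [c ->] [d ->]; exists (fun i => c i + d i); rewrite -big_split.
by apply: eq_bigr => i _; rewrite scalerDr.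
Qed.

Lemma in_ideal_Z (M : lmodType S) s (x : M) : in_ideal k x -> in_ideal k (s *: x).
Proof.
move=> [c ->]; exists (fun i => s *: c i); rewrite scaler_sumr.
by apply: eq_bigr => i _; rewrite !scalerA mulrC.
Qed.

Lemma in_ideal_0 (M : lmodType S) : in_ideal k (0 : M).
Proof. by exists (fun=> 0); rewrite big1 // => i _; rewrite scaler0. Qed.

Lemma in_ideal_X (M : lmodType S) (i : 'I_r) (x : M) : (i < k)%N -> in_ideal k ('X_i *: x).
Proof.
move=> ik; exists (fun j => if j == i then x else 0).
by rewrite (bigD1 i) //= eqxx big1 ?addr0 // => j /andP[_ /negPf->]; rewrite scaler0.
Qed.

Lemma in_ideal_subsp (M : lmodType S) : subsp (in_ideal k (M := M)).
Proof.
split=> [|l x y Ix Iy]; first exact: in_ideal_0.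
by apply: in_ideal_D => //; apply: in_ideal_Z.
Qed.

Lemma in_ideal_lin (M N : lmodType S) (f : {linear M -> N}) (x : M) :
  in_ideal k x -> in_ideal k (f x).
Proof.
move=> [c ->]; exists (f \o c); rewrite raddf_sum; apply: eq_bigr => i _.
exact: linearZ.
Qed.

Lemma in_ideal_gc (M : grModule K a) n (x : M) : in_ideal k x ->
  exists2 c : 'I_r -> M, forall i, sh (a i) (grcomp (g := M)) n (c i) &
  gc n x = \sum_(i < r | (i < k)%N) 'X_i *: c i.
Proof.
move=> [c ->]; exists (fun i => if (a i <= n)%N then gc (n - a i) (c i) else 0).
  by move=> i; apply: gc_sh.
rewrite gc_sum; apply: eq_bigr => i _; rewrite gcX.
by case: ifP => // _; rewrite scaler0.
Qed.

End Ideal.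

Lemma in_irrelE (M : lmodType S) (x : M) : in_irrel x <-> in_ideal r x.
Proof.
by split=> [] [c ->]; exists c; apply: eq_bigl => i; rewrite ltn_ord.
Qed.

Lemma in_idealS (k : nat) (kr : (k < r)%N) (M : lmodType S) (x : M) :
  in_ideal k.+1 x <-> exists2 y, in_ideal k y & exists u, x = 'X_(Ordinal kr) *: u + y.
Proof.
split=> [[c ->]|[y [c ->] [u ->]]].
  rewrite (sum_ltnS kr); exists (\sum_(i < r | (i < k)%N) 'X_i *: c i); first by exists c.
  by exists (c (Ordinal kr)).
exists (fun i => if i == Ordinal kr then u else c i).
rewrite (sum_ltnS kr) eqxx; congr (_ + _); apply: eq_bigr => i ik.
by rewrite -val_eqE /= ltn_eqF.
Qed.

Lemma in_ideal_le (k k' : nat) (M : lmodType S) (x : M) : (k <= k')%N ->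
  in_ideal k x -> in_ideal k' x.
Proof.
move=> kk [c ->]; apply: (subsp_sum (in_ideal_subsp k' M)) => i ik.
by apply: in_ideal_X; apply: leq_trans kk.
Qed.

(** Under the hypothesis every monomial of [q] is divisible by one of the first [k] variables. *)
Lemma in_ideal_scale (k : nat) (M : lmodType S) (q : S) (y : M) :
  (forall m : 'X_{1..r}, (forall i : 'I_r, (i < k)%N -> m i = 0%N) -> q@_m = 0) ->
  in_ideal k (q *: y).
Proof.
move=> qm; rewrite [q]mpolyE scaler_suml.
rewrite big_seq_cond; apply: (subsp_sum (in_ideal_subsp k _)) => m.
rewrite andbT => mq; have [i ik mi] : exists2 i : 'I_r, (i < k)%N & (0 < m i)%N.
  apply: contrapT => nex; move: mq; rewrite mcoeff_msupp qm ?eqxx // => i ik.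
  by apply/eqP; rewrite -leqn0 leqNgt; apply/negP => mi; apply: nex; exists i.
have -> : m = (U_(i) + (m - U_(i)))%MM.
  by rewrite addmC submK //; apply/mnm_lepP => j; rewrite mnm1E; case: eqP => // <-.
by rewrite mpolyXD scalerAr -scalerA; apply: in_ideal_X.
Qed.

(** ** Projective modules are direct summands of free modules *)

Section Free.
Import freeg.
Variable T : choiceType.
Local Notation F := {freeg T / S}.

Definition flift (M : lmodType S) (f : T -> M) : F -> M := fglift f.

Lemma flift_linear (M : lmodType S) (f : T -> M) : linear (flift f).
Proof.
have fB : {morph flift f : x y / x - y} by move=> x y; exact: (lift_is_additive f).
have f0 : flift f 0 = 0 by rewrite -(subrr 0) fB subrr.
have fN x : flift f (- x) = - flift f x by rewrite -sub0r fB f0 sub0r.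
have fD x y : flift f (x + y) = flift f x + flift f y.
  by rewrite -{1}[y]opprK fB fN opprK.
move=> s x y; rewrite fD; congr (_ + _).
rewrite -[in RHS](freeg_sumE x) /GRing.scale /= /fgscale.
rewrite !(big_morph _ fD f0) -[RHS]/(s *: _) scaler_sumr; apply: eq_bigr => z _.
by rewrite /flift !liftU scalerA.
Qed.

HB.instance Definition _ (M : lmodType S) (f : T -> M) :=
  GRing.isLinear.Build S F M _ (flift f) (flift_linear f).

Lemma fliftU (M : lmodType S) (f : T -> M) x : flift f << x >> = f x.
Proof. by rewrite /flift liftU scale1r. Qed.

Lemma freeg_ext (M : lmodType S) (f g : {linear F -> M}) :
  (forall x, f << x >> = g << x >>) -> f =1 g.
Proof.
move=> fg x; rewrite -(freeg_sumE x) !linear_sum; apply: eq_bigr => z _.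
have -> : << coeff z x *g z >> = coeff z x *: << z >> :> F.
  by apply/eqP/freeg_eqP => y; rewrite coeffZ !coeffU mul1r.
by rewrite !linearZ fg.
Qed.

(** Coefficientwise, membership in the ideal excludes monomials free of the first [k] variables, and
    multiplication by the next variable leaves the exponents of those [k] variables unchanged. *)
Lemma free_regular (k : nat) (kr : (k < r)%N) (x : F) :
  in_ideal k ('X_(Ordinal kr) *: x) -> in_ideal k x.
Proof.
pose nondiv (q : S) := forall m : 'X_{1..r}, (forall i : 'I_r, (i < k)%N -> m i = 0%N) -> q@_m = 0.
have nondivX (q : S) : nondiv ('X_(Ordinal kr) * q) -> nondiv q.
  move=> qm m mk; have := qm (U_(Ordinal kr) + m)%MM; rewrite mulrC mcoeffMX; apply.
  by move=> i ik; rewrite mnmDE mk // mnm1E -val_eqE /= gtn_eqF.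
move=> [c xE]; rewrite -(freeg_sumE x).
apply: (subsp_sum (in_ideal_subsp k _)) => z _.
have -> : << coeff z x *g z >> = coeff z x *: << z >> :> F.
  by apply/eqP/freeg_eqP => y; rewrite coeffZ !coeffU mul1r.
apply/in_ideal_scale/nondivX => m mk; rewrite -coeffZ xE raddf_sum raddf_sum big1 // => i ik /=.
rewrite coeffZ mulrC; apply/eqP; rewrite mcoeff_eq0 (perm_mem (msuppMX _ _)).
by apply/mapP => [[m' _ mE]]; move: (mk i ik); rewrite mE mnmDE mnm1E eqxx.
Qed.

End Free.

Section Summand.
Import freeg.

(** The free module on the set of all elements of [P] maps onto [P], and projectivity splits this
    map. *)
Lemma projective_section (P : lmodType S) : projective P ->
  exists h : {linear P -> {freeg P / S}}, forall x, flift id (h x) = x.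
Proof.
move=> Pp; have := Pp _ P (flift (M := P) id) idfun; apply.
by move=> y; exists << y >>; apply: fliftU.
Qed.

Lemma projective_regular (P : lmodType S) (k : nat) (kr : (k < r)%N) (x : P) :
  projective P -> in_ideal k ('X_(Ordinal kr) *: x) -> in_ideal k x.
Proof.
move=> /projective_section[h hK] Ix; rewrite -[x]hK; apply: in_ideal_lin.
by apply: (free_regular (kr := kr)); rewrite -linearZ; apply: in_ideal_lin.
Qed.

(** [projective] lifts through surjections only, whereas here [g] merely reaches the image of [f].
    On the free module above [P] preimages of the basis elements suffice, and this avoids the image
    of [g] as a module. *)
Lemma projective_lift (P A B : lmodType S) (g : {linear A -> B}) (f : {linear P -> B}) :
  projective P -> (forall x, exists y, g y = f x) ->
  exists h : {linear P -> A}, forall x, g (h x) = f x.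
Proof.
move=> /projective_section[s sK] ex.
pose c x := sval (cid (ex x)).
have cP x : g (c x) = f x by rewrite /c; case: cid.
exists (flift c \o s) => x /=.
have -> : f x = (f \o flift (M := P) id) (s x) by rewrite /= sK.
rewrite -[LHS]/((g \o flift c) (s x)); apply: freeg_ext => y /=.
rewrite !fliftU; exact: cP.
Qed.

End Summand.

End Graded.

(** * Independence of the resolution *)

(** Chain maps and homotopies are built with it: their next component exists only if the previous
    one satisfies the invariant. *)
Lemma dependent_choice (T : nat -> Type) (inv : forall i, T i -> Prop)
    (R : forall i, T i -> T i.+1 -> Prop) (t0 : T 0%N) :
  inv 0%N t0 ->
  (forall i t, inv i t -> exists t', inv i.+1 t' /\ R i t t') ->
  exists f : forall i, T i, f 0%N = t0 /\ forall i, inv i (f i) /\ R i (f i) (f i.+1).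
Proof.
move=> inv0 step.
pose next i (t : {t : T i | inv i t}) : {t : T i.+1 | inv i.+1 t} :=
  let w := cid (step i _ (proj2_sig t)) in
  exist _ (proj1_sig w) (proj1 (proj2_sig w)).
have nextP i t : R i (proj1_sig t) (proj1_sig (next i t)).
  by rewrite /next /=; case: cid => t' [].
pose f := fix f i : {t : T i | inv i t} :=
  match i with 0%N => exist _ t0 inv0 | i'.+1 => next i' (f i') end.
exists (fun i => proj1_sig (f i)); split=> // i; split; first exact: proj2_sig (f i).
exact: nextP.
Qed.

Section Comparison.

Local Open Scope ring_scope.
Import GRing.Theory.

Variables (K : fieldType) (r : nat).
Local Notation S := {mpoly K[r]}.

Section ChainMaps.
Variables (M : lmodType S) (P Q : nat -> lmodType S).
Variables (d : forall i, {linear P i.+1 -> P i}) (e : {linear P 0%N -> M}).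
Variables (d' : forall i, {linear Q i.+1 -> Q i}) (e' : {linear Q 0%N -> M}).
Hypotheses (PR : proj_resolution d e) (QR : proj_resolution d' e').

Lemma resolution_dd i x : d i (d i.+1 x) = 0.
Proof. by case: PR => _ _ _ ex; apply/ex; exists x. Qed.

Lemma resolution_ed x : e (d 0%N x) = 0.
Proof. by case: PR => _ _ ex _; apply/ex; exists x. Qed.

Definition chain_map (f : forall i, {linear P i -> Q i}) : Prop :=
  forall i x, d' i (f i.+1 x) = f i (d i x).

Lemma chain_map_ex : exists f : forall i, {linear P i -> Q i},
  chain_map f /\ forall x, e' (f 0%N x) = e x.
Proof.
have [Pp eS ek dk] := PR; have [_ eS' ek' dk'] := QR.
have [f0 f0P] := projective_lift (f := e) (Pp 0%N) (fun x => eS' (e x)).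
(* The invariant says that [f] maps cycles to cycles, so that [f] after [d] lands in the image of
   the next differential of [Q]. *)
pose inv i : {linear P i -> Q i} -> Prop :=
  match i with
  | 0%N => fun f => forall x, e x = 0 -> e' (f x) = 0
  | i'.+1 => fun f => forall x, d i' x = 0 -> d' i' (f x) = 0
  end.
pose R i (f : {linear P i -> Q i}) (f' : {linear P i.+1 -> Q i.+1}) :=
  forall x, d' i (f' x) = f (d i x).
have [|i f invf|f [f00 fP]] := @dependent_choice (fun i => {linear P i -> Q i}) inv R f0.
- by move=> x ex0; rewrite f0P.
- have [f' f'P] : exists f' : {linear P i.+1 -> Q i.+1}, forall x, d' i (f' x) = (f \o d i) x.
    apply: projective_lift => // x /=.
    case: i f invf x => [|i] f /= invf x; [apply/ek'|apply/dk']; apply: invf.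
      exact: resolution_ed.
    exact: resolution_dd.
  by exists f'; split=> // x dx0; rewrite f'P /= dx0 linear0.
by exists f; split; [move=> i x; case: (fP i) => _ ->|rewrite f00].
Qed.

Lemma null_homotopy (f : forall i, {linear P i -> Q i}) :
  chain_map f -> (forall x, e' (f 0%N x) = 0) ->
  exists h : forall i, {linear P i -> Q i.+1},
    (forall x, f 0%N x = d' 0%N (h 0%N x)) /\
    forall i x, f i.+1 x = d' i.+1 (h i.+1 x) + h i (d i x).
Proof.
move=> fC f0; have [Pp _ _ _] := PR; have [_ _ ek' dk'] := QR.
have [h0 h0P] : exists h0 : {linear P 0%N -> Q 1%N}, forall x, d' 0%N (h0 x) = f 0%N x.
  by apply: projective_lift => // x; apply/ek'.
(* The invariant puts the values of f - h d in the kernel of [d'], hence in the image of the next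
   differential. *)
pose inv i (h : {linear P i -> Q i.+1}) := forall x, d' i (h (d i x)) = f i (d i x).
pose R i (h : {linear P i -> Q i.+1}) (h' : {linear P i.+1 -> Q i.+2}) :=
  forall x, f i.+1 x = d' i.+1 (h' x) + h (d i x).
have [|i h invh|h [h00 hP]] := @dependent_choice (fun i => {linear P i -> Q i.+1}) inv R h0.
- by move=> x; rewrite h0P.
- have [h' h'P] : exists h' : {linear P i.+1 -> Q i.+2},
      forall x, d' i.+1 (h' x) = (f i.+1 \- (h \o d i)) x.
    apply: projective_lift => // x /=; apply/dk'.
    by rewrite linearB /= invh fC subrr.
  exists h'; split=> x; rewrite h'P /=; last by rewrite subrK.
  by rewrite resolution_dd linear0 subr0.
by exists h; split=> [x|i x]; [rewrite h00|case: (hP i) => _ ->].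
Qed.

End ChainMaps.

Variable a : 'I_r -> nat.

(** * Cycles and boundaries modulo x_1, ..., x_k *)

Section Tor.
Variables (P : nat -> grModule K a) (d : forall i, {linear P i.+1 -> P i}).
Hypothesis d_deg : forall i n (x : P i.+1), grcomp n x -> grcomp n (d i x).
Hypothesis dd0 : forall i x, d i (d i.+1 x) = 0.

(** Preimage in degree [j] of P_i of the cycles of P / (x_1, ..., x_k) P; [bnd] is that of the
    boundaries, so H_i^(k) is the quotient of the two. At k = 0 this is the homology of [P], at k =
    r it is Tor. *)
Definition cyc (k i j : nat) : P i -> Prop :=
  match i with
  | 0%N => fun x => grcomp j x
  | i'.+1 => fun x => grcomp j x /\ in_ideal k (d i' x)
  end.

Definition bnd (k i j : nat) (x : P i) : Prop :=
  grcomp j x /\ exists2 y : P i.+1, grcomp j y & in_ideal k (x - d i y).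

Lemma cyc_grcomp k i j x : cyc k j x -> grcomp j (x : P i).
Proof. by case: i x => [|i] x //= []. Qed.

Lemma cyc_gsub k i : gsub a r (fun j => @cyc k i j).
Proof.
case: i => [|i] /=; first exact: grcomp_gsub.
split=> [j|i0 _ j x [Px Ix]].
  apply: subsp_inter; first exact: grcomp_subsp.
  split=> [|l x y Ix Iy]; first by rewrite linear0; apply: in_ideal_0.
  by rewrite linearP; apply: (in_ideal_subsp _ _).2.
split; first exact: grcompZ (homogX K a i0) Px.
by rewrite linearZ; apply: in_ideal_Z.
Qed.

Lemma bnd_gsub k i : gsub a r (fun j => @bnd k i j).
Proof.
split=> [j|i0 _ j x [Px [y Py Iy]]].
  apply: subsp_inter; first exact: grcomp_subsp.
  split; first by exists 0; [exact: grcomp0|rewrite linear0 subr0; exact: in_ideal_0].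
  move=> l x x' [y Py Iy] [y' Py' Iy']; exists (l%:MP *: y + y').
    exact: (grcomp_subsp _ _).2.
  by rewrite linearP opprD addrACA -scalerBr; apply: (in_ideal_subsp _ _).2.
split; first exact: grcompZ (homogX K a i0) Px.
exists ('X_i0 *: y); first exact: grcompZ (homogX K a i0) Py.
by rewrite linearZ -scalerBr; apply: in_ideal_Z.
Qed.

Lemma bnd_cyc k i j x : bnd k j x -> cyc k j (x : P i).
Proof.
case: i x => [|i] x [Px [y Py Iy]] //=; split=> //.
by have := in_ideal_lin (d i) Iy; rewrite linearB dd0 subr0.
Qed.

Lemma in_ideal_hom k (M : grModule K a) n (x : M) : in_ideal k x -> in_ideal k (gc n x).
Proof. by move=> /(in_ideal_gc n)[c _ ->]; exists c. Qed.

(* Boundaries may be tested with an inhomogeneous [y]. *)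
Lemma bnd_gc k i j (x : P i) (y : P i.+1) :
  grcomp j x -> in_ideal k (x - d i y) -> bnd k j x.
Proof.
move=> Px Iy; split=> //; exists (gc j y); first exact: gc_grcomp.
have := in_ideal_hom j Iy.
by rewrite gcB gc_id // (gc_linear (f := d i)) //; apply: d_deg.
Qed.

(** [tor_boundary] differs from [bnd r] only by not asking for degree [j], which all cycles have;
    the two agree on cycles. *)
Lemma tor_quo_dimP i j b :
  quo_dim (tor_cycle d (i := i) j) (tor_boundary d (i := i) j) b <-> qdim (@cyc r i j) (@bnd r i j) b.
Proof.
have cE (x : P i) : tor_cycle d j x <-> cyc r j x.
  by case: i x => [|i] x; [split | split=> -[Px /in_irrelE Ix]].
have bE (x : P i) : cyc r j x -> tor_boundary d j x <-> bnd r j x.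
  move=> /cyc_grcomp Px; split=> [[y [Py Iy]]|[_ [y Py /in_irrelE Iy]]]; last by exists y.
  by split=> //; exists y => //; apply/in_irrelE.
have cs := (cyc_gsub r i).1 j; have bs := (bnd_gsub r i).1 j.
have ts : subsp (tor_cycle d (i := i) j).
  by split=> [|l x y]; rewrite !cE; [exact: cs.1|exact: cs.2].
have tbs : subsp (tor_boundary d (i := i) j).
  split; first by exists 0; split; [exact: grcomp0|exists (fun=> 0); rewrite linear0 subr0 big1 // => ? _; rewrite scaler0].
  move=> l x x' [y [Py /in_irrelE Iy]] [y' [Py' /in_irrelE Iy']].
  exists (l%:MP *: y + y'); split; first exact: (grcomp_subsp _ _).2.
  apply/in_irrelE; rewrite linearP opprD addrACA -scalerBr.
  exact: (in_ideal_subsp _ _).2.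
rewrite quo_dimP //; split.
  move=> H; apply: (qdim_trace cs bE); apply: qdim_ext H => //.
move=> H; apply: (qdim_ext (U := @cyc r i j) (W := tor_boundary d (i := i) j)) => //.
  by move=> x; rewrite cE.
by apply: (qdim_trace cs _ H) => x /bE ->.
Qed.

End Tor.

Definition degree0 (M N : grModule K a) (f : {linear M -> N}) : Prop :=
  forall n x, grcomp n x -> grcomp n (f x).

Definition graded_resolution (M : grModule K a) (P : nat -> grModule K a)
    (d : forall i, {linear P i.+1 -> P i}) (e : {linear P 0%N -> M}) : Prop :=
  [/\ proj_resolution (P := fun i => P i) d e, forall i, degree0 (d i) & degree0 e].

Section GradedMaps.
Variables (M : grModule K a) (P Q : nat -> grModule K a).
Variables (d : forall i, {linear P i.+1 -> P i}) (e : {linear P 0%N -> M}).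
Variables (d' : forall i, {linear Q i.+1 -> Q i}) (e' : {linear Q 0%N -> M}).
Hypotheses (PR : graded_resolution d e) (QR : graded_resolution d' e').

Lemma graded_chain_map_ex : exists f : forall i, {linear P i -> Q i},
  [/\ chain_map (P := P) (Q := Q) d d' f, forall x, e' (f 0%N x) = e x &
      forall i, degree0 (f i)].
Proof.
have [PR0 d_deg e_deg] := PR; have [QR0 d_deg' e_deg'] := QR.
have [f [fC f0]] := chain_map_ex PR0 QR0.
exists (fun i => deg0 (f i) : {linear P i -> Q i}); split=> [i x|x|i n x].
- apply: eq_gc => n; rewrite (gc_linear (d_deg' i)) !gc_deg0 (gc_linear (d_deg i)).
  by rewrite -(gc_linear (d_deg' i)) fC.
- apply: eq_gc => n; rewrite (gc_linear e_deg') gc_deg0 -(gc_linear e_deg') f0.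
  by rewrite !(gc_linear e_deg) (gc_id (gc_grcomp n x)).
- exact: deg0_grcomp.
Qed.

Lemma chain_map_cyc k (f : forall i, {linear P i -> Q i}) i j (x : P i) :
  chain_map (P := P) (Q := Q) d d' f -> (forall i, degree0 (f i)) ->
  cyc d k j x -> cyc d' k j (f i x).
Proof.
move=> fC f_deg; case: i x => [|i] x /=; first exact: f_deg.
by move=> [Px Ix]; split; [exact: f_deg|rewrite fC; apply: in_ideal_lin].
Qed.

Lemma chain_map_bnd k (f : forall i, {linear P i -> Q i}) i j (x : P i) :
  chain_map (P := P) (Q := Q) d d' f -> (forall i, degree0 (f i)) ->
  bnd d k j x -> bnd d' k j (f i x).
Proof.
move=> fC f_deg [Px [y Py Iy]]; split; first exact: f_deg.
exists (f i.+1 y); first exact: f_deg.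
by rewrite fC -linearB; apply: in_ideal_lin.
Qed.

(** A homotopy f = d' h + h d turns a cycle modulo the ideal into a boundary modulo the ideal. The
    map [h] is not homogeneous, which [bnd_gc] absorbs. *)
Lemma null_chain_map_bnd k (f : forall i, {linear P i -> Q i}) i j (x : P i) :
  chain_map (P := P) (Q := Q) d d' f -> (forall i, degree0 (f i)) ->
  (forall x, e' (f 0%N x) = 0) -> cyc d k j x -> bnd d' k j (f i x).
Proof.
move=> fC f_deg f0; have [PR0 _ _] := PR; have [QR0 d_deg' _] := QR.
have [h [h0 hP]] := null_homotopy PR0 QR0 fC f0.
case: i x => [|i] x /= => [Px|[Px Ix]].
  apply: (bnd_gc d_deg' (y := h 0%N x)); first exact: f_deg.
  by rewrite h0 subrr; apply: in_ideal_0.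
apply: (bnd_gc d_deg' (y := h i.+1 x)); first exact: f_deg.
by rewrite hP addrC addKr; apply: in_ideal_lin.
Qed.

End GradedMaps.

Section Invariance.
Variables (M : grModule K a) (P : nat -> grModule K a).
Variables (d : forall i, {linear P i.+1 -> P i}) (e : {linear P 0%N -> M}).
Hypothesis PR : graded_resolution d e.

Lemma graded_resolution_dd i x : d i (d i.+1 x) = 0.
Proof. by have [PR0 _ _] := PR; apply: (resolution_dd PR0). Qed.

(** Comparison maps in both directions are inverse to each other up to homotopy; the isomorphism on
    homology is the relation that y - f x is a boundary. *)
Lemma betti_qdim (Q : nat -> grModule K a)
    (d' : forall i, {linear Q i.+1 -> Q i}) (e' : {linear Q 0%N -> M}) k i j b :
  graded_resolution d' e' ->
  qdim (cyc d' k (i := i) j) (bnd d' k (i := i) j) b ->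
  qdim (cyc d k (i := i) j) (bnd d k (i := i) j) b.
Proof.
move=> QR.
have [f [fC fe f_deg]] := graded_chain_map_ex PR QR.
have [g [gC ge g_deg]] := graded_chain_map_ex QR PR.
have cs (x : P i) := (cyc_gsub d k i).1 j.
have bs := (bnd_gsub d k i).1 j; have bs' := (bnd_gsub d' k i).1 j.
have gf (x : P i) : cyc d k j x -> bnd d k j (g i (f i x) - x).
  apply: (null_chain_map_bnd (f := fun i => (g i \o f i) \- idfun) PR PR) => /=.
  - by move=> n y /=; rewrite linearB gC fC.
  - move=> n m y My /=; apply: (subspB (grcomp_subsp _ _)) => //.
    exact/g_deg/f_deg.
  - by move=> y; rewrite linearB ge fe subrr.
have fg (x : Q i) : cyc d' k j x -> bnd d' k j (f i (g i x) - x).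
  apply: (null_chain_map_bnd (f := fun i => (f i \o g i) \- idfun) QR QR) => /=.
  - by move=> n y /=; rewrite linearB fC gC.
  - move=> n m y My /=; apply: (subspB (grcomp_subsp _ _)) => //.
    exact/f_deg/g_deg.
  - by move=> y; rewrite linearB fe ge subrr.
apply: (qdim_transfer (rho := fun x y => bnd d' k j (y - f i x))).
- split; first by rewrite linear0 subr0; apply: bs'.1.
  move=> l x x' y y' H H'; rewrite linearP opprD addrACA -scalerBr.
  exact: bs'.2.
- exact: (cyc_gsub d k i).1.
- exact: (cyc_gsub d' k i).1.
- move=> x cx; exists (f i x); first exact: chain_map_cyc.
  by rewrite subrr; apply: bs'.1.
- move=> y cy; exists (g i y); first exact: chain_map_cyc.
  by apply: (subspC bs'); apply: fg.
move=> x y cx cy xy; split=> [bx|bY].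
  by rewrite -[y](subrK (f i x)); apply: (subspD bs') => //; apply: chain_map_bnd.
have bfx : bnd d' k j (f i x).
  by apply: (subspDl bs' (x := y - f i x)) => //; rewrite subrK.
have bgf : bnd d k j (g i (f i x)) by apply: chain_map_bnd.
apply: (subspDr bs (subspN bs bgf)); apply: (subspC bs); exact: gf.
Qed.

(** The short resolution [Q] carries no grading, so it is compared with [P] by ungraded maps. For i
    > n the map g f is zero on P_i, and the homotopy gives - x = d h x + h d x, where [d x] lies in
    the ideal. *)
Lemma proj_res_vanish n k i j (x : P i) :
  proj_res_of_length M n -> (n < i)%N -> cyc d k j x -> bnd d k j x.
Proof.
move=> [Q [d' [e' [QR Q0]]]] ni; have [PR0 d_deg _] := PR.
have [f [fC f0]] := chain_map_ex PR0 QR.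
have [g [gC g0]] := chain_map_ex QR PR0.
pose p i := (g i \o f i) \- idfun : {linear P i -> P i}.
have [||h [h0 hP]] := @null_homotopy M P P d e d e PR0 PR0 p.
- by move=> m y /=; rewrite linearB gC fC.
- by move=> y /=; rewrite linearB g0 f0 subrr.
case: i ni x => [//|i] ni x [Px Ix].
apply: (bnd_gc d_deg (y := - h i.+1 x)) => //.
have := hP i x; rewrite /p /= (Q0 _ ni (f i.+1 x)) linear0 sub0r.
have aux (u v w : P i.+1) : - u = v + w -> u + v = - w.
  by move=> E; rewrite -[u]opprK E opprD addrAC addNr add0r.
move=> /aux xE; rewrite linearN opprK xE.
by apply: (subspN (in_ideal_subsp _ _)); apply: in_ideal_lin.
Qed.

End Invariance.
End Comparison.

(** * The Euler characteristic of Tor *)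

Section EulerCharacteristic.

Local Open Scope ring_scope.
Import GRing.Theory.

Definition bdiff (A : zmodType) (m : nat) (f : nat -> A) (j : nat) : A :=
  f j - (if (m <= j)%N then f (j - m)%N else 0).

Variables (K : fieldType) (r : nat) (a : 'I_r -> nat).
Hypothesis a_gt0 : forall i, (0 < a i)%N.
Local Notation S := {mpoly K[r]}.
Variables (M : grModule K a) (P : nat -> grModule K a).
Variables (d : forall i, {linear P i.+1 -> P i}) (e : {linear P 0%N -> M}).
Hypothesis PR : graded_resolution d e.

Let dd0 i (x : P i.+2) : d i (d i.+1 x) = 0 := graded_resolution_dd PR x.
Let d_deg i : degree0 (d i).
Proof. by case: PR => _ + _; apply. Qed.

(** Applying [d] kills [d i x] and leaves x_(k+1) d y in the ideal; regularity cancels x_(k+1). *)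
Lemma cyc_bnd_lift k i m (x : P i.+1) (y : P i) (kr : (k < r)%N) :
  grcomp m y -> in_ideal k (d i x - 'X_(Ordinal kr) *: y) -> cyc d k m y.
Proof.
case: i x y => [|i] x y //= Py Iy; split=> //.
have [[Pp _ _ _] _ _] := PR.
apply: (projective_regular (kr := kr)); first exact: Pp.
have := in_ideal_lin (d i) Iy; rewrite linearB dd0 sub0r linearZ.
by move/(subspN (in_ideal_subsp _ _)); rewrite opprK.
Qed.

(** * Passing from k to k + 1 variables *)

Section Step.
Variables (k : nat) (kr : (k < r)%N).
Local Notation X := ('X_(Ordinal kr) : S).
Local Notation m := (a (Ordinal kr)).

Let regular i (x : P i) : in_ideal k (X *: x) -> in_ideal k x.
Proof. by have [[Pp _ _ _] _ _] := PR; apply: projective_regular; apply: Pp. Qed.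

Let cyc_s i j := (cyc_gsub d k i).1 j.
Let cyc_s1 i j := (cyc_gsub d k.+1 i).1 j.
Let bnd_s i j := (bnd_gsub d k i).1 j.
Let bnd_s1 i j := (bnd_gsub d k.+1 i).1 j.
Let ideal_s i := in_ideal_subsp k (P i).

(** The middle term between [bnd d k.+1] and [cyc d k.+1]. Modulo boundaries it is the image of
    H_i^(k) in H_i^(k+1), a cokernel of [X]; the cycles modulo it form the kernel of [X] on the
    twisted H_(i-1)^(k). *)
Definition midcyc i j (x : P i) : Prop :=
  exists2 z : P i, cyc d k j z & bnd d k.+1 j (x - z).

Lemma cycS i j (x : P i) : cyc d k j x -> cyc d k.+1 j x.
Proof. by case: i x => [|i] x //= [Px /in_ideal_le Ix]; split=> //; apply: Ix. Qed.

Lemma bndS i j (x : P i) : bnd d k j x -> bnd d k.+1 j x.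
Proof. by move=> [Px [y Py /in_ideal_le Iy]]; split=> //; exists y => //; apply: Iy. Qed.

Lemma midcyc_gsub i : gsub a r (@midcyc i).
Proof.
split=> [j|i0 i0r j x [z cz bz]]; first exact: subsp_add.
by exists ('X_i0 *: z); [apply: (cyc_gsub d k i).2|rewrite -scalerBr; apply: (bnd_gsub d k.+1 i).2].
Qed.

Let mid_s i j := (midcyc_gsub i).1 j.

Lemma bnd_midcyc i j (x : P i) : bnd d k.+1 j x -> midcyc j x.
Proof. by move=> bx; exists 0; [exact: (cyc_s i j).1|rewrite subr0]. Qed.

Lemma midcyc_cyc i j (x : P i) : midcyc j x -> cyc d k.+1 j x.
Proof.
move=> [z /cycS cz /(bnd_cyc dd0) cxz]; rewrite -[x](subrK z).
exact: (subspD (cyc_s1 i j)).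
Qed.

Lemma bnd_X i j (u : P i) : sh m (fun j x => grcomp j x) j u -> bnd d k.+1 j (X *: u).
Proof.
rewrite /sh; case: leqP => [mj Pu|_ ->]; last by rewrite scaler0; apply: (bnd_s1 i j).1.
split; first by rewrite -(subnKC mj); apply: grcompZ (homogX K a _) Pu.
by exists 0; [exact: grcomp0|rewrite linear0 subr0; apply: in_ideal_X].
Qed.

(** Exactness at H_i^(k): a class that dies in H_i^(k+1) is a multiple of [X]. From z = d v + X u
    modulo the ideal follows that X d u lies in the ideal, so [u] is a cycle by regularity. *)
Lemma cyc_inter_bndS i j (z : P i) :
  cyc d k j z -> bnd d k.+1 j z <->
  (exists2 u, sh m (fun j => @cyc _ _ _ P d k i j) j u & bnd d k j (z - X *: u)).
Proof.
move=> cz; have Pz := cyc_grcomp cz; split=> [[_ [v Pv Iv]]|[u cu bu]]; last first.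
  rewrite -[z](subrK (X *: u)); apply: (subspD (bnd_s1 i j)); first exact: bndS.
  by apply: bnd_X; apply: sh_sub cu => j' x /cyc_grcomp.
have Pzv : grcomp j (z - d i v) by apply: (subspB (grcomp_subsp _ _)) => //; apply: d_deg.
have [c cP] := in_ideal_gc j Iv; rewrite (gc_id Pzv) (sum_ltnS kr).
set t := \sum_(i0 < r | _) _ => E; pose u := c (Ordinal kr).
have It : in_ideal k (z - X *: u - d i v).
  by rewrite addrAC E addrAC subrr add0r; exists c.
have PXu : grcomp j (X *: u).
  have := cP (Ordinal kr); rewrite -/u /sh; case: leqP => [mj Pu|_ ->].
    by rewrite -(subnKC mj); apply: grcompZ (homogX K a _) Pu.
  by rewrite scaler0; apply: grcomp0.
exists u; last by split; [exact: (subspB (grcomp_subsp _ _))|exists v].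
have := cP (Ordinal kr); rewrite -/u /sh; case: leqP => // mj Pu.
case: i z cz Pz v Pv Iv Pzv c cP t E u It PXu Pu => [//|i] z [_ Iz] /= Pz v _ _ _ c _ t _ u It _ Pu.
split=> //; apply: regular; rewrite -linearZ.
have := in_ideal_lin (d i) It; rewrite 2!linearB dd0 subr0 => I2.
rewrite -[d i (X *: u)]opprK -[- d i _](addKr (d i z)).
by apply: (subspN (ideal_s _)); apply: (subspD (ideal_s _)) => //; apply: (subspN (ideal_s _)).
Qed.

Lemma midcyc_qdim i j b :
  qdim (cyc d k (i := i) j) (fun z => exists2 u,
    sh m (fun j => @cyc _ _ _ P d k i j) j u & bnd d k j (z - X *: u)) b ->
  qdim (midcyc (i := i) j) (bnd d k.+1 (i := i) j) b.
Proof.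
apply: (qdim_transfer (rho := fun x y => bnd d k.+1 j (x - y))) => //.
- split; first by rewrite subrr; apply: (bnd_s1 i j).1.
  move=> l x x' y y' H H'; rewrite opprD addrACA -scalerBr; exact: (bnd_s1 i j).2.
- move=> z cz; exists z; first by exists z; rewrite ?subrr //; apply: (bnd_s1 i j).1.
  by rewrite subrr; apply: (bnd_s1 i j).1.
move=> x y _ cy bxy; rewrite -cyc_inter_bndS //; split=> b1.
  by rewrite -[y](subKr x); apply: (subspB (bnd_s1 i j)).
by rewrite -[x](subrK y); apply: (subspD (bnd_s1 i j)).
Qed.

Lemma midcyc_noeth i :
  noeth a r (fun j => @cyc _ _ _ P d k i j) (fun j => @bnd _ _ _ P d k i j) ->
  noeth a r (@midcyc i) (fun j => @bnd _ _ _ P d k.+1 i j).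
Proof.
move=> nh; apply: (noeth_transfer (s := 0) (rho := fun j x y => bnd d k.+1 j (x - y))
  (U' := fun j => @cyc _ _ _ P d k i j) (W' := fun j x => cyc d k j x /\ bnd d k.+1 j x)).
- exact: cyc_gsub.
- split=> [j|i0 i0r j x [cx bx]]; first exact: subsp_inter.
  by split; [apply: (cyc_gsub d k i).2|apply: (bnd_gsub d k.+1 i).2].
- by move=> j x [].
- move=> j; split; first by rewrite subrr; apply: (bnd_s1 i j).1.
  move=> l x x' y y' H H'; rewrite opprD addrACA -scalerBr; exact: (bnd_s1 i j).2.
- move=> i0 j x y i0r bxy; rewrite -scalerBr; exact: (bnd_gsub d k.+1 i).2.
- by move=> j x; rewrite addn0 => [[z cz bz]]; exists z.
- move=> j x y _ bxy [_ bY]; rewrite addn0 -[x](subrK y).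
  exact: (subspD (bnd_s1 i j)).
apply: noeth_sub nh => // j x bx; split; last exact: bndS.
exact: bnd_cyc.
Qed.

(** The connecting homomorphism from H_(i+1)^(k+1) to the twisted H_i^(k), on representatives. *)
Definition liftrel i (x : P i.+1) (y : P i) : Prop := in_ideal k (d i x - X *: y).

Lemma liftrel_lin i : linrel (@liftrel i).
Proof.
split; first by rewrite /liftrel linear0 scaler0 subrr; apply: in_ideal_0.
move=> l x x' y y' H H'; rewrite /liftrel linearP scalerDr scalerA mulrC -scalerA.
by rewrite opprD addrACA -scalerBr; apply: (ideal_s i).2.
Qed.

Lemma liftrel_total i j (x : P i.+1) : cyc d k.+1 j x ->
  exists2 y, sh m (fun j => @cyc _ _ _ P d k i j) j y & liftrel x y.
Proof.
move=> [Px Ix]; have [c cP] := in_ideal_gc j Ix; rewrite (gc_id (d_deg Px)) (sum_ltnS kr) => E.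
have l : liftrel x (c (Ordinal kr)) by rewrite /liftrel E addrAC subrr add0r; exists c.
exists (c (Ordinal kr)) => //; have := cP (Ordinal kr); rewrite /sh; case: leqP => // mj Pc.
exact: cyc_bnd_lift l.
Qed.

Lemma liftrel_bnd i j (x : P i.+1) y : liftrel x y -> cyc d k.+1 j x ->
  sh m (fun j => @cyc _ _ _ P d k i j) j y -> bnd d k j (X *: y).
Proof.
move=> l [Px _] cy; split; last by exists x => //; apply: (subspC (ideal_s i)).
move: cy; rewrite /sh; case: leqP => [mj /cyc_grcomp Py|_ ->].
  by rewrite -(subnKC mj); apply: grcompZ (homogX K a _) Py.
by rewrite scaler0; apply: grcomp0.
Qed.

(** Exactness at H_(i+1)^(k+1). If y = d v modulo the ideal, then x - X v is a cycle for the first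
    [k] variables. Conversely, applying [d] to x = z + d v + X u + t and cancelling [X] gives y = d
    u modulo the ideal. *)
Lemma liftrel_midcyc i j (x : P i.+1) y : liftrel x y -> cyc d k.+1 j x ->
  sh m (fun j => @cyc _ _ _ P d k i j) j y ->
  midcyc j x <-> sh m (fun j => @bnd _ _ _ P d k i j) j y.
Proof.
move=> l cx cy; have [Px Ix] := cx; split=> [[z cz [_ [v Pv Iv]]]|bY].
  have Pw : grcomp j (x - z - d i.+1 v).
    apply: (subspB (grcomp_subsp _ _)); last exact: d_deg.
    by apply: (subspB (grcomp_subsp _ _)) => //; apply: cyc_grcomp cz.
  have [c cP] := in_ideal_gc j Iv; rewrite (gc_id Pw) (sum_ltnS kr).
  set t := \sum_(i0 < r | _) _ => E; pose u := c (Ordinal kr).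
  have It : in_ideal k t by exists c.
  have Iyu : in_ideal k (y - d i u).
    apply: regular; rewrite scalerBr.
    have dE : d i x = d i z + X *: d i u + d i t.
      move/(congr1 (d i)): E; rewrite !linearB dd0 subr0 linearD linearZ.
      by move=> /eqP; rewrite subr_eq addrC addrA => /eqP.
    have [_ Iz] := cz.
    have -> : X *: y - X *: d i u = (d i z + d i t) - (d i x - X *: y).
      have aux (A B C D : P i) : C - B = (A + D) - (A + B + D - C).
        by rewrite opprB [A + B + D]addrAC addrCA opprD addrA addrA addrK.
      by rewrite dE; apply: aux.
    apply: (subspB (ideal_s i)) => //; apply: (subspD (ideal_s i)) => //.
    exact: in_ideal_lin.
  move: cy (cP (Ordinal kr)); rewrite -/u /sh; case: leqP => // mj cy Pu.
  by split; [exact: cyc_grcomp cy|exists u].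
have [v Pv Iv] : exists2 v, sh m (fun j => @grcomp _ _ _ (P i.+1) j) j v & in_ideal k (y - d i v).
  move: bY; rewrite /sh; case: leqP => [mj [_ [v Pv Iv]]|_ ->]; first by exists v.
  by exists 0; rewrite // linear0 subr0; apply: in_ideal_0.
have bXv : bnd d k.+1 j (X *: v) by apply: bnd_X.
exists (x - X *: v); last by rewrite subKr.
split; first by apply: (subspB (grcomp_subsp _ _)) => //; case: bXv.
rewrite linearB linearZ.
apply: (subspBB (ideal_s i)) l _; rewrite -scalerBr; exact: in_ideal_Z.
Qed.

Lemma cyc_midcyc_qdim i j b :
  qdim (fun y => sh m (fun j => @cyc _ _ _ P d k i j) j y /\ bnd d k j (X *: y))
    (sh m (fun j => @bnd _ _ _ P d k i j) j) b ->
  qdim (cyc d k.+1 (i := i.+1) j) (midcyc (i := i.+1) j) b.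
Proof.
apply: (qdim_transfer (liftrel_lin i)).
- exact: cyc_s1.
- have shs := sh_subsp m j (cyc_s i).
  split; first by split; [exact: shs.1|rewrite scaler0; apply: (bnd_s i j).1].
  move=> l x y [cx bx] [cy bY]; split; first exact: shs.2.
  by rewrite scalerDr scalerA mulrC -scalerA; apply: (bnd_s i j).2.
- move=> x cx; have [y cy l] := liftrel_total cx; exists y => //; split=> //.
  exact: liftrel_bnd l cx cy.
- move=> y [cy [PXy [x Px Ix]]]; exists x; last exact: (subspC (ideal_s i)).
  split=> //; apply/(in_idealS kr); exists (d i x - X *: y); first exact: (subspC (ideal_s i)).
  by exists y; rewrite addrC subrK.
by move=> x y cx [cy _] l; apply: liftrel_midcyc.
Qed.

Lemma cyc_midcyc_noeth i :
  noeth a r (fun j => @cyc _ _ _ P d k i j) (fun j => @bnd _ _ _ P d k i j) ->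
  noeth a r (fun j => @cyc _ _ _ P d k.+1 i.+1 j) (@midcyc i.+1).
Proof.
move=> nh.
have shE' j (U : nat -> P i -> Prop) y : sh m U (j + m)%N y <-> U j y.
  by rewrite addnC shE.
apply: (noeth_transfer (s := m) (rho := fun _ => @liftrel i) _ _ _ _ _ _ _ nh).
- exact: cyc_gsub.
- exact: bnd_gsub.
- by move=> j x /bnd_cyc; apply.
- by move=> j; apply: liftrel_lin.
- move=> i0 j x y i0r l; rewrite /liftrel linearZ scalerA mulrC -scalerA -scalerBr.
  exact: in_ideal_Z.
- by move=> j x cx; have [y /shE' cy l] := liftrel_total cx; exists y.
move=> j x y cx l bY; apply/(liftrel_midcyc l cx); apply/shE' => //.
exact: bnd_cyc.
Qed.

End Step.


(** With [rho i j] the rank of x_(k+1) on H_i^(k) into degree [j] and [hs] the twist of [h], the new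
    dimension is (h_i - rho_i) + (hs_(i-1) - rho_(i-1)). The ranks cancel in the alternating sum,
    and the range of [i] grows by one. *)
Lemma betti_step (A : pzRingType) k (kr : (k < r)%N) (h : nat -> nat -> nat) :
  (forall i j, qdim (cyc d k (i := i) j) (bnd d k (i := i) j) (h i j)) ->
  (forall i j, (k < i)%N -> h i j = 0%N) ->
  exists h' : nat -> nat -> nat,
  [/\ forall i j, qdim (cyc d k.+1 (i := i) j) (bnd d k.+1 (i := i) j) (h' i j),
      forall i j, (k.+1 < i)%N -> h' i j = 0%N &
      forall j, \sum_(i < k.+2) (-1) ^+ i * (h' i j)%:R =
        bdiff (a (Ordinal kr)) (fun j => \sum_(i < k.+1) (-1) ^+ i * (h i j)%:R) j :> A].
Proof.
move=> hP h0; pose m := a (Ordinal kr).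
pose hs i j := if (m <= j)%N then h i (j - m)%N else 0%N.
have hsP i j : qdim (sh m (fun j => @cyc _ _ _ P d k i j) j)
    (sh m (fun j => @bnd _ _ _ P d k i j) j) (hs i j).
  rewrite /sh /hs; case: ifP => _; first exact: hP.
  by apply: qdim0.
have ex i j : exists rho : nat, [/\ (rho <= h i j)%N, (rho <= hs i j)%N,
    qdim (midcyc k (i := i) j) (bnd d k.+1 (i := i) j) (h i j - rho)%N &
    qdim (cyc d k.+1 (i := i.+1) j) (midcyc k (i := i.+1) j) (hs i j - rho)%N].
  have cs j' := (cyc_gsub d k i).1 j'; have bs j' := (bnd_gsub d k i).1 j'.
  have shX (Q : nat -> nat -> P i -> Prop) (Qg : gsub a r (Q k)) y :
      sh m (Q k) j y -> Q k j ('X_(Ordinal kr) *: y).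
    rewrite /sh; case: leqP => [mj Qy|_ ->]; last by rewrite scaler0; apply: (Qg.1 j).1.
    by rewrite -(subnKC mj); apply: Qg.2.
  have [|||||||||rho [rho1 rho2 q1 q2]] := @qdim_map _ _ _ _ _ _ _ _
    (fun y : P i => 'X_(Ordinal kr) *: y) _ _ _ _ _ _ _ _ _ _ _ (hP i j) (hsP i j).
  - by move=> l x y; rewrite scalerDr !scalerA mulrC.
  - exact: cs.
  - exact: bs.
  - exact: sh_subsp.
  - by move=> x; apply: bnd_cyc.
  - exact: (shX (fun k j => @cyc _ _ _ P d k i j) (cyc_gsub d k i)).
  - exact: (shX (fun k j => @bnd _ _ _ P d k i j) (bnd_gsub d k i)).
  - by move=> y; apply: sh_sub => j' x; apply: bnd_cyc.
  - exact: sh_subsp.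
  by exists rho; split=> //; [apply: midcyc_qdim q1|apply: cyc_midcyc_qdim q2].
pose rho i j := sval (cid (ex i j)).
have rhoP i j : [/\ (rho i j <= h i j)%N, (rho i j <= hs i j)%N,
    qdim (midcyc k (i := i) j) (bnd d k.+1 (i := i) j) (h i j - rho i j)%N &
    qdim (cyc d k.+1 (i := i.+1) j) (midcyc k (i := i.+1) j) (hs i j - rho i j)%N].
  by rewrite /rho; case: cid.
pose q i j := if i is i'.+1 then (hs i' j - rho i' j)%N else 0%N.
exists (fun i j => q i j + (h i j - rho i j))%N; split=> [i j|i j|j].
- have [_ _ q1 _] := rhoP i j.
  apply: (qdim_ext_add (L := midcyc k (i := i) j)) q1.
  + exact: (midcyc_gsub k i).1.
  + exact: (bnd_gsub d k.+1 i).1.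
  + by move=> x; apply: midcyc_cyc.
  + by move=> x; apply: bnd_midcyc.
  case: i => [|i] /=; last by case: (rhoP i j).
  apply: qdim0 => x Px; exists x => //; rewrite subrr.
  exact: ((bnd_gsub d k.+1 0).1 j).1.
- case: i => // i ki; rewrite /q /hs !h0 ?sub0n //; last exact: ltnW.
  by rewrite if_same.
rewrite /bdiff -/m.
have -> : (if (m <= j)%N then \sum_(i < k.+1) (-1) ^+ i * (h i (j - m)%N)%:R else 0)
    = \sum_(i < k.+1) (-1) ^+ i * (hs i j)%:R :> A.
  by rewrite /hs; case: ifP => // _; rewrite big1 // => i _; rewrite mulr0.
under eq_bigr do rewrite natrD mulrDr; rewrite big_split /=.
rewrite big_ord_recl /= mulr0 add0r.
rewrite [X in _ + X]big_ord_recr /= h0 // sub0n mulr0 addr0 -big_split -sumrB /=.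
apply: eq_bigr => i _; have [r1 r2 _ _] := rhoP i j.
rewrite !natrB // exprS mulN1r mulNr addrC -mulrBr opprB addrA subrK.
by rewrite mulrBr.
Qed.

Lemma noeth_step k (kr : (k < r)%N) :
  (forall i, noeth a r (fun j => @cyc _ _ _ P d k i j) (fun j => @bnd _ _ _ P d k i j)) ->
  forall i, noeth a r (fun j => @cyc _ _ _ P d k.+1 i j) (fun j => @bnd _ _ _ P d k.+1 i j).
Proof.
move=> nh i; apply: (noeth_ext (L := @midcyc k i)).
- exact: midcyc_gsub.
- exact: (cyc_gsub d k.+1 i).1.
- exact: (bnd_gsub d k.+1 i).1.
- by move=> j x; apply: midcyc_cyc.
- by move=> j x; apply: bnd_midcyc.
- case: i => [|i]; last exact: cyc_midcyc_noeth.
  apply: noeth_sub (@noeth_triv _ _ _ _ r (@midcyc k 0) (@midcyc k 0) _) => // j x Px.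
  by exists x => //; rewrite subrr; apply: ((bnd_gsub d k.+1 0).1 j).1.
- exact: midcyc_noeth.
Qed.

Lemma cyc0E i j (x : P i.+1) : cyc d 0 j x <-> grcomp j x /\ d i x = 0.
Proof.
split=> [[Px [c dx]]|[Px dx]]; split=> //; first by rewrite dx big_pred0.
by rewrite dx; apply: in_ideal_0.
Qed.

Lemma bnd0_exact i j (x : P i.+1) : cyc d 0 j x -> bnd d 0 j x.
Proof.
move=> /cyc0E[Px /eqP dx]; have [[_ _ _ ex] _ _] := PR.
have /ex[y yx] : d i x = 0 by apply/eqP.
by apply: (bnd_gc d_deg (y := y)) => //; rewrite yx subrr; apply: in_ideal_0.
Qed.

Lemma augment_bnd j (x : P 0%N) : grcomp j x -> e x = 0 <-> bnd d 0 j x.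
Proof.
move=> Px; have [[_ _ ex _] _ _] := PR; split=> [/ex[y yx]|[_ [y _ [c]]]].
  by apply: (bnd_gc d_deg (y := y)) => //; rewrite yx subrr; apply: in_ideal_0.
rewrite big_pred0 // => /eqP; rewrite subr_eq0 => /eqP ->; apply/ex; by exists y.
Qed.

Variable H : nat -> nat.
Hypothesis H_dim : forall n, has_dim (grcomp (g := M) n) (H n).
Hypothesis M_fg : finitely_generated M.

Let zero_subsp (V : lmodType S) : subsp (fun x : V => x = 0).
Proof. by split=> // l x y -> ->; rewrite scaler0 addr0. Qed.

Let H_qdim n : qdim (grcomp (g := M) n) (fun x => x = 0) (H n).
Proof. exact: (proj1 (quo_dimP _ (grcomp_subsp M n) (zero_subsp M)) (H_dim n)). Qed.

Let e_deg : degree0 e. Proof. by case: PR. Qed.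

Let e_lin : linrel (fun x y => y = e x).
Proof. by split=> [|l x x' y y' -> ->]; rewrite ?linear0 ?linearP. Qed.

Lemma betti_base0 j : qdim (cyc d 0 (i := 0) j) (bnd d 0 (i := 0) j) (H j).
Proof.
have [[_ eS _ _] _ _] := PR.
apply: (qdim_transfer e_lin) (H_qdim j).
- exact: (cyc_gsub d 0 0).1.
- exact: grcomp_subsp.
- by move=> x Px; exists (e x) => //; apply: e_deg.
- move=> y My; have [x xy] := eS y; exists (gc j x); first exact: gc_grcomp.
  by rewrite -(gc_linear e_deg) xy gc_id.
- by move=> x y Px _ ->; rewrite -augment_bnd.
Qed.

(** Modulo (x_1, ..., x_r) M an element is a K-combination of the generators. Its part of degree [j]
    then vanishes for [j] beyond the degrees of all homogeneous components of the generators. *)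
Lemma noeth_fg : noeth a r (grcomp (g := M)) (fun _ x => x = 0).
Proof.
apply: noeth_of_fg => //.
- exact: grcomp_gsub.
- by split=> // i _ j x ->; rewrite scaler0.
- by move=> j x ->; apply: grcomp0.
- by move=> j; apply: qdim_spanned (H_qdim j).
have [n [g gP]] := M_fg.
have bound i : exists N, forall j, (N <= j)%N -> gc j (g i) = 0.
  by have [N [_ gN _]] := gc_decomposes (g i); exists N.
pose N i := sval (cid (bound i)).
have NP i j : (N i <= j)%N -> gc j (g i) = 0.
  by rewrite /N; case: cid => N0 /=; apply.
exists (\max_i N i)%N => j Nj x Mx; have [c xE] := gP x.
have : in_ideal r (x - \sum_i ((c i)@_0%MM)%:MP *: g i).
  rewrite {1}xE -sumrB; apply: (subsp_sum (in_ideal_subsp r M)) => i _.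
  rewrite -scalerBl; apply: in_ideal_scale => m m0.
  have -> : m = 0%MM by apply/mnmP => i'; rewrite mnm0E m0 ?ltn_ord.
  by rewrite mcoeffB mcoeffC eqxx mulr1 subrr.
move=> /(in_ideal_gc j)[c' c'P]; rewrite gcB gc_id // gc_sum big1 ?subr0 => [xE'|i _].
  by exists c' => [i _|]; [exact: c'P|rewrite -xE' subrr].
rewrite gcZC NP ?scaler0 //; apply: leq_trans (ltnW Nj); exact: leq_bigmax.
Qed.

Lemma noeth_base i :
  noeth a r (fun j => @cyc _ _ _ P d 0 i j) (fun j => @bnd _ _ _ P d 0 i j).
Proof.
case: i => [|i]; last by apply: noeth_triv => j x; apply: bnd0_exact.
apply: (noeth_transfer (s := 0) (rho := fun j x y => y = e x) _ _ _ _ _ _ _ noeth_fg).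
- exact: grcomp_gsub.
- by split=> // i _ j x ->; rewrite scaler0.
- by move=> j x ->; apply: grcomp0.
- by [].
- by move=> i m x y _ ->; rewrite linearZ.
- by move=> j x; rewrite addn0 => Px; exists (e x) => //; apply: e_deg.
by move=> j x y; rewrite addn0 => Px -> /augment_bnd; apply.
Qed.

Lemma betti_induction (A : pzRingType) k : (k <= r)%N ->
  (forall i, noeth a r (fun j => @cyc _ _ _ P d k i j) (fun j => @bnd _ _ _ P d k i j)) /\
  exists h : nat -> nat -> nat,
  [/\ forall i j, qdim (cyc d k (i := i) j) (bnd d k (i := i) j) (h i j),
      forall i j, (k < i)%N -> h i j = 0%N &
      forall j, \sum_(i < k.+1) (-1) ^+ i * (h i j)%:R =
        foldl (fun f i => bdiff (a i) f) (fun j => (H j)%:R) (take k (enum 'I_r)) j :> A].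
Proof.
elim: k => [_|k IHk kr].
  split; first exact: noeth_base.
  exists (fun i j => if i is 0%N then H j else 0%N); split=> [[|i] j|[|i] j|j] //.
  - exact: betti_base0.
  - by apply: qdim0 => x; apply: bnd0_exact.
  - by rewrite take0 /= big_ord_recl big_ord0 addr0 mul1r.
have [nh [h [hP h0 hE]]] := IHk (ltnW kr); split; first exact: noeth_step.
have [h' [hP' h0' hE']] := betti_step A kr hP h0; exists h'; split=> // j.
rewrite hE' (take_nth (Ordinal kr)) ?size_enum_ord // foldl_rcons.
have -> : nth (Ordinal kr) (enum 'I_r) k = Ordinal kr by exact: (nth_ord_enum _ (Ordinal kr)).
by rewrite /bdiff !hE.
Qed.

End EulerCharacteristic.

(** * Finiteness and Euler characteristic of the Betti numbers *)

Section Betti.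
Local Open Scope ring_scope.
Import GRing.Theory.

Variables (K : fieldType) (r : nat) (a : 'I_r -> nat) (M : grModule K a).
Hypothesis a_gt0 : forall i, (0 < a i)%N.
Hypothesis M_fg : finitely_generated M.
Variables (H : nat -> nat) (p : nat) (beta : nat -> nat -> nat).
Hypothesis H_dim : forall n, has_dim (grcomp (g := M) n) (H n).
Hypothesis p_pd : proj_dim M p.
Hypothesis beta_tor : forall i j, betti_number M i j (beta i j).

Lemma betti_resolution (A : pzRingType) : exists h : nat -> nat -> nat,
  [/\ beta =2 h, forall i j, (r < i)%N -> h i j = 0%N,
      forall i j, (p < i)%N -> h i j = 0%N,
      forall i, exists J, forall j, (J < j)%N -> h i j = 0%N &
      forall j, \sum_(i < r.+1) (-1) ^+ i * (h i j)%:R =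
        foldl (fun f i => bdiff (a i) f) (fun j => (H j)%:R) (enum 'I_r) j :> A].
Proof.
(* Every [betti_number] comes with its own resolution; the one behind [beta 0 0] is fixed and the
   others are compared with it. *)
have [P [d [e [PR0 d_deg e_deg _]]]] := beta_tor 0 0.
have PR : graded_resolution d e by [].
have dd := graded_resolution_dd PR.
have [nh [h [hP h0 hE]]] := betti_induction a_gt0 PR H_dim M_fg A (leqnn r).
have bs i j := (bnd_gsub d r i).1 j.
have beta_h i j b : qdim (cyc d r (i := i) j) (bnd d r (i := i) j) b -> h i j = b.
  by apply: qdim_uniq.
exists h; split=> // [i j|i j pi|i|j].
- have [Q [d' [e' [QR0 d_deg' e_deg' /tor_quo_dimP q]]]] := beta_tor i j.
  have QR : graded_resolution d' e' by [].
  by apply/esym/beta_h/(betti_qdim PR QR)/q.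
- apply: beta_h; apply: qdim0 => x; apply: (proj_res_vanish PR) pi.
  by case: p_pd.
(* Taking all cycles for [T]: beyond [J] each one is a boundary plus an element of (x_1, ..., x_r)
   P_i, which at k = r is a boundary too. *)
- have [||J JP] := nh i (fun j => @cyc _ _ _ P d r i j) (cyc_gsub d r i) _ _ => //.
    by move=> j x; apply: bnd_cyc.
  exists J => j Jj; apply: beta_h; apply: qdim0 => x cx.
  have [c cc bx] := JP j Jj x cx.
  rewrite -[x](subrK (\sum_(i0 < r | (i0 < r)%N) 'X_i0 *: c i0)).
  apply: (subspD (bs i j)) => //; split.
    by apply: (gsub_sum (grcomp_gsub (P i) r)) => i0 i0r; apply: sh_sub (cc i0 i0r) => j' y /cyc_grcomp.
  exists 0; [exact: grcomp0|rewrite linear0 subr0; by exists c].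
by rewrite hE take_oversize // size_enum_ord.
Qed.

Theorem betti_finite i : exists J, forall j, (J < j)%N -> beta i j = 0%N.
Proof.
have [h [hE _ _ fin _]] := betti_resolution int.
by have [J JP] := fin i; exists J => j /JP <-.
Qed.

(* Both sums run over all [i], as the Betti numbers vanish for [i > min(p, r)]. *)
Theorem betti_euler (A : pzRingType) j :
  \sum_(i < p.+1) (-1) ^+ i * (beta i j)%:R =
  foldl (fun f i => bdiff (a i) f) (fun j => (H j)%:R) (enum 'I_r) j :> A.
Proof.
have [h [hE hr hp _ <-]] := betti_resolution A.
have ext q n : (q <= n)%N -> (forall i, (q < i)%N -> h i j = 0%N) ->
    \sum_(i < n.+1) (-1) ^+ i * (h i j)%:R
    = \sum_(i < q.+1) (-1) ^+ i * (h i j)%:R :> A.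
  move=> qn h0; rewrite -(subnKC (qn : (q < n.+1)%N)) big_split_ord /=.
  by rewrite [X in _ + X]big1 ?addr0 // => i _; rewrite h0 ?mulr0 // leq_addr.
under eq_bigr do rewrite hE.
case: (leqP p r) => [pr|/ltnW rp]; first by rewrite (ext p r) // => i /hp.
by rewrite (ext r p) // => i /hr.
Qed.

End Betti.

(** * Complex series *)

Local Open Scope R_scope.

Notation cseries := (@is_series C_AbsRing C_NormedModule).
Notation csum := (@sum_n C_AbelianMonoid).

Section RealSeries.

Lemma sum_n_le_Series (a : nat -> R) n : (forall n, 0 <= a n) -> ex_series a ->
  sum_n a n <= Series a.
Proof.
move=> a0 exa; apply: (is_lim_seq_incr_compare (sum_n a)); first exact: Series_correct.
by move=> k; rewrite sum_Sn /plus /=; have := a0 k.+1; lra.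
Qed.

Lemma ex_series_bounded (a : nat -> R) B : (forall n, 0 <= a n) ->
  (forall n, sum_n a n <= B) -> ex_series a /\ Series a <= B.
Proof.
move=> a0 aB.
have [l al] : ex_finite_lim_seq (sum_n a).
  apply: (ex_finite_lim_seq_incr _ B) => // k.
  by rewrite sum_Sn /plus /=; have := a0 k.+1; lra.
split; first by exists l.
rewrite (is_series_unique _ _ al).
have /= := is_lim_seq_le _ _ _ _ aB al (is_lim_seq_const B); exact.
Qed.

Lemma is_series_sum_n (K : AbsRing) (V : NormedModule K) (f : nat -> nat -> V) (g : nat -> V) N :
  (forall k, is_series (fun n => f n k) (g k)) ->
  is_series (fun n => sum_n (f n) N) (sum_n g N).
Proof.
move=> fg; elim: N => [|N IHN].
  by rewrite sum_O; apply: is_series_ext (fg 0%N) => n; rewrite sum_O.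
rewrite sum_Sn; apply: is_series_ext (is_series_plus _ _ _ _ IHN (fg N.+1)) => n.
by rewrite sum_Sn.
Qed.

Lemma term_le_Series (a : nat -> R) n : (forall n, 0 <= a n) -> ex_series a -> a n <= Series a.
Proof.
move=> a0 exa; apply: Rle_trans (sum_n_le_Series n a0 exa).
case: n => [|n]; first by rewrite sum_O; lra.
rewrite sum_Sn /plus /=; suff : 0 <= sum_n a n by lra.
elim: n => [|n IHn]; first by rewrite sum_O.
by rewrite sum_Sn /plus /=; have := a0 n.+1; lra.
Qed.

(** For nonnegative terms each iterated sum bounds the partial sums of the other. *)
Lemma tonelli (u : nat -> nat -> R) (U : nat -> R) :
  (forall n k, 0 <= u n k) -> (forall n, is_series (u n) (U n)) -> ex_series U ->
  exists W, (forall k, is_series (fun n => u n k) (W k)) /\ is_series W (Series U).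
Proof.
move=> u0 uU exU.
have U0 n : 0 <= U n.
  rewrite -(is_series_unique _ _ (uU n)).
  apply: Rle_trans (term_le_Series 0 (u0 n) _); [exact: u0|by exists (U n)].
have uleU n k : u n k <= U n.
  rewrite -(is_series_unique _ _ (uU n)); apply: term_le_Series => //; by exists (U n).
have exk k : ex_series (fun n => u n k).
  apply: (@ex_series_le R_AbsRing R_CompleteNormedModule _ U) => // n.
  by rewrite /norm /= /abs /= Rabs_pos_eq.
pose W k := Series (fun n => u n k); exists W.
have WP k : is_series (fun n => u n k) (W k) by apply: Series_correct.
split=> //.
have W0 k : 0 <= W k by apply: Rle_trans (term_le_Series 0 _ (exk k)).
have [|exW WU] := @ex_series_bounded W (Series U) W0.
  move=> N; have H := @is_series_sum_n _ _ _ _ N WP.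
  rewrite -(is_series_unique _ _ H); apply: Series_le => // n; split.
    by elim: N {H} => [|N IHN]; rewrite ?sum_O // sum_Sn /plus /=; have := u0 n N.+1; lra.
  rewrite -(is_series_unique _ _ (uU n)); apply: sum_n_le_Series => //; by exists (U n).
suff UW : Series U <= Series W.
  by rewrite (_ : Series U = Series W); [exact: Series_correct|lra].
have [|//] := @ex_series_bounded U (Series W) U0.
move=> N; have H := @is_series_sum_n _ _ (fun k n => u n k) U N uU.
rewrite -(is_series_unique _ _ H); apply: Series_le => // k; split.
  by elim: N {H} => [|N IHN]; rewrite ?sum_O // sum_Sn /plus /=; have := u0 N.+1 k; lra.
by apply: (sum_n_le_Series N (fun n => u0 n k)).
Qed.

End RealSeries.

Section ComplexSeries.

Lemma cseries_unique (u : nat -> C) l l' : cseries u l -> cseries u l' -> l = l'.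
Proof. exact: (@filterlim_locally_unique nat C_AbsRing C_NormedModule eventually _ (csum u) l l'). Qed.

Lemma Cmod_sum_n (u : nat -> C) n : Cmod (csum u n) <= sum_n (fun k => Cmod (u k)) n.
Proof. exact: (@norm_sum_n_m C_AbsRing C_NormedModule). Qed.

Lemma cseries_abs (u : nat -> C) : ex_series (fun n => Cmod (u n)) ->
  exists l, cseries u l /\ Cmod l <= Series (fun n => Cmod (u n)).
Proof.
move=> exu.
have [l ul] : ex_series (V := C_NormedModule) u.
  apply: (@ex_series_le C_AbsRing C_CompleteNormedModule _ (fun n => Cmod (u n))) => // n.
  exact: Rle_refl.
exists l; split=> //.
have lim : is_lim_seq (fun n => Cmod (csum u n)) (Cmod l).
  exact: filterlim_comp ul (@filterlim_norm C_AbsRing C_NormedModule l).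
have lim' : is_lim_seq (sum_n (fun n => Cmod (u n))) (Series (fun n => Cmod (u n))).
  exact: Series_correct.
have /= := is_lim_seq_le _ _ _ _ (fun n => Cmod_sum_n u n) lim lim'; exact.
Qed.

Lemma cseries_abs_le (u : nat -> C) l : ex_series (fun n => Cmod (u n)) ->
  cseries u l -> Cmod l <= Series (fun n => Cmod (u n)).
Proof. by move=> /cseries_abs[l' [ul' le]] /(cseries_unique ul') <-. Qed.

Lemma cseries_eps (u : nat -> C) l :
  is_lim_seq (fun n => Cmod (csum u n - l)%C) 0 -> cseries u l.
Proof.
move=> H; apply/filterlim_locally_ball_norm => eps.
have /filterlim_locally/(_ eps) := H; apply: filter_imp => n.
rewrite /ball /= /AbsRing_ball /abs /minus /plus /opp /= /ball_norm /=.
change (Rabs (Cmod (csum u n - l)%C + - 0) < eps -> Cmod (csum u n - l)%C < eps).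
rewrite Ropp_0 Rplus_0_r Rabs_pos_eq //; exact: Cmod_ge_0.
Qed.

Lemma fubini (u : nat -> nat -> C) (U : nat -> R) (S : nat -> C) :
  (forall n, is_series (fun k => Cmod (u n k)) (U n)) -> ex_series U ->
  (forall n, cseries (u n) (S n)) ->
  exists v T, [/\ forall k, cseries (fun n => u n k) (v k),
    ex_series (fun k => Cmod (v k)), Series (fun k => Cmod (v k)) <= Series U,
    cseries S T & cseries v T].
Proof.
move=> uU exU uS.
have u0 n k := Cmod_ge_0 (u n k).
have [W [WP WU]] := tonelli u0 uU exU.
have exv k : exists l, cseries (fun n => u n k) l /\ Cmod l <= W k.
  have [|l [ul le]] := @cseries_abs (fun n => u n k); first by exists (W k).
  by exists l; rewrite -(is_series_unique _ _ (WP k)).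
pose v k := sval (cid (exv k)).
have vP k : cseries (fun n => u n k) (v k) /\ Cmod (v k) <= W k.
  by rewrite /v; case: cid.
have SU n : Cmod (S n) <= U n.
  rewrite -(is_series_unique _ _ (uU n)); apply: cseries_abs_le => //; by exists (U n).
have exS : ex_series (fun n => Cmod (S n)).
  apply: (@ex_series_le R_AbsRing R_CompleteNormedModule _ U) => // n.
  by rewrite /norm /= /abs /= Rabs_pos_eq //; apply: Cmod_ge_0.
have [T [ST _]] := cseries_abs exS.
have exW : ex_series W by exists (Series U).
have exV : ex_series (fun k => Cmod (v k)).
  apply: (@ex_series_le R_AbsRing R_CompleteNormedModule _ W) => // k.
  by rewrite /norm /= /abs /= Rabs_pos_eq; [case: (vP k)|apply: Cmod_ge_0].
exists v, T; split=> //.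
- by move=> k; case: (vP k).
- rewrite -(is_series_unique _ _ WU); apply: Series_le => // k.
  by split; [apply: Cmod_ge_0|case: (vP k)].
apply: cseries_eps.
(* The difference between [T] and a partial sum of [v] is the sum over [n] of the tails of the rows,
   which this bound dominates. *)
apply: (is_lim_seq_le_le (fun=> 0) _ (fun N => Series U - sum_n W N)).
- move=> N; split; first exact: Cmod_ge_0.
  have H1 : cseries (fun n => csum (u n) N) (csum v N).
    by apply: (@is_series_sum_n C_AbsRing C_NormedModule) => k; case: (vP k).
  have H2 := is_series_minus _ _ _ _ H1 ST.
  have H3 : is_series (fun n => U n - sum_n (fun k => Cmod (u n k)) N) (Series U - sum_n W N).
    apply: (@is_series_minus R_AbsRing R_NormedModule); first exact: Series_correct.
    exact: is_series_sum_n.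
  have le n : Cmod (csum (u n) N - S n)%C <= U n - sum_n (fun k => Cmod (u n k)) N.
    have exu : ex_series (fun k => Cmod (u n k)) by exists (U n).
    have tail : cseries (fun k => u n (N.+1 + k)%coq_nat) (S n - csum (u n) N)%C.
      apply: (@is_series_incr_n C_AbsRing C_NormedModule (u n) N.+1); first by lia.
      by rewrite /plus /= /Cminus -Cplus_assoc (Cplus_comm (- _)) Cplus_opp_r Cplus_0_r.
    have -> : (csum (u n) N - S n = - (S n - csum (u n) N))%C by ring.
    rewrite Cmod_opp.
    have ext := proj1 (ex_series_incr_n (fun k => Cmod (u n k)) N.+1) exu.
    have := cseries_abs_le ext tail; rewrite -(is_series_unique _ _ (uU n)).
    have := Series_incr_n (fun k => Cmod (u n k)) N.+1 ltac:(lia) exu.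
    rewrite /= -sum_n_Reals => ->; lra.
  have exd : ex_series (fun n => Cmod (csum (u n) N - S n)%C).
    apply: (@ex_series_le R_AbsRing R_CompleteNormedModule _
      (fun n => U n - sum_n (fun k => Cmod (u n k)) N)); last by eexists; apply: H3.
    by move=> n; rewrite /norm /= /abs /= Rabs_pos_eq; [apply: le|apply: Cmod_ge_0].
  rewrite -(is_series_unique _ _ H3).
  apply: Rle_trans (@cseries_abs_le (fun n => csum (u n) N - S n)%C (csum v N - T)%C exd H2) _.
  apply: Series_le; last by exists (Series U - sum_n W N).
  by move=> n; split; [apply: Cmod_ge_0|apply: le].
- exact: is_lim_seq_const.
rewrite -(Rminus_diag_eq (Series U) (Series U) erefl).
apply: is_lim_seq_minus' => //; exact: is_lim_seq_const.
Qed.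

End ComplexSeries.

(** Total, so that a series of functions is again a function; where the series diverges the value is
    unspecified. *)
Definition csval (u : nat -> C) : C := epsilon (inhabits (RtoC 0)) (fun l => cseries u l).

Lemma csval_correct (u : nat -> C) l : cseries u l -> cseries u (csval u).
Proof. by move=> ul; apply: (epsilon_spec (inhabits (RtoC 0))); exists l. Qed.

Lemma csvalE (u : nat -> C) l : cseries u l -> csval u = l.
Proof. by move=> ul; apply: cseries_unique (csval_correct ul) ul. Qed.

Lemma csval_abs (u : nat -> C) : ex_series (fun n => Cmod (u n)) -> cseries u (csval u).
Proof. by move=> /cseries_abs[l [ul _]]; apply: csval_correct ul. Qed.

Lemma csval_ext (u v : nat -> C) : (forall n, u n = v n) -> csval u = csval v.
Proof. by move=> uv; congr csval; apply: FunctionalExtensionality.functional_extensionality. Qed.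

Lemma cseries_ext (u v : nat -> C) (l : C) : (forall n, u n = v n :> C) -> cseries u l -> cseries v l.
Proof. exact: is_series_ext. Qed.

Lemma rseries_ext (u v : nat -> R) (l : R) : (forall n, u n = v n :> R) -> is_series u l -> is_series v l.
Proof. exact: is_series_ext. Qed.

Lemma cseries_scal (c : C) (u : nat -> C) (l : C) : cseries u l -> cseries (fun n => c * u n)%C (c * l)%C.
Proof. exact: (@is_series_scal C_AbsRing C_NormedModule). Qed.

Lemma cseries_plus (u v : nat -> C) (l m : C) : cseries u l -> cseries v m ->
  cseries (fun n => u n + v n)%C (l + m)%C.
Proof. exact: (@is_series_plus C_AbsRing C_NormedModule). Qed.

Lemma rex_series_ext (u v : nat -> R) : (forall n, u n = v n :> R) -> ex_series u -> ex_series v.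
Proof. exact: ex_series_ext. Qed.

Section Generic.
Variables (K : AbsRing) (V : NormedModule K).

Lemma is_series_finite (u : nat -> V) N :
  (forall k, (N < k)%N -> u k = zero) -> is_series u (sum_n u N).
Proof.
move=> u0; apply: (filterlim_ext_loc (fun=> sum_n u N)); last exact: filterlim_const.
exists N => n /leP; move=> /subnKC <-; elim: (n - N)%N => [|m IHm]; first by rewrite addn0.
by rewrite addnS sum_Sn -IHm u0 ?plus_zero_r //; lia.
Qed.

Lemma is_series_delay (u : nat -> V) l n :
  is_series u l -> is_series (fun k => if (n <= k)%N then u (k - n)%N else zero) l.
Proof.
move=> ul; elim: n => [|n IHn].
  by apply: is_series_ext ul => k; rewrite subn0.
apply: is_series_decr_1; rewrite /= opp_zero plus_zero_r.
by apply: is_series_ext IHn => k; rewrite ltnS subSS.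
Qed.

End Generic.

Lemma ex_series_le_pos (a b : nat -> R) :
  (forall n, 0 <= a n <= b n) -> ex_series b -> ex_series a.
Proof.
move=> ab; apply: (@ex_series_le R_AbsRing R_CompleteNormedModule) => n.
by rewrite /norm /= /abs /= Rabs_pos_eq; case: (ab n).
Qed.

(** Fubini for the array a_n b_(k-n), set to zero for k < n. *)
Lemma cauchy_product (a b : nat -> C) la lb :
  ex_series (fun n => Cmod (a n)) -> ex_series (fun n => Cmod (b n)) ->
  cseries a la -> cseries b lb ->
  cseries (fun k => csum (fun i => a i * b (k - i)%N)%C k) (la * lb)%C.
Proof.
move=> exa exb al bl.
pose u n k : C := if (n <= k)%N then (a n * b (k - n)%N)%C else RtoC 0.
have uU n : is_series (fun k => Cmod (u n k)) (Cmod (a n) * Series (fun k => Cmod (b k))).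
  have H := @is_series_scal R_AbsRing R_NormedModule (Cmod (a n)) _ _ (Series_correct _ exb).
  apply: is_series_ext (is_series_delay n H) => k; rewrite /u.
  by case: ifP => _; rewrite ?Cmod_mult ?Cmod_0.
have uS n : cseries (u n) (a n * lb)%C.
  have H := @is_series_scal C_AbsRing C_NormedModule (a n) _ _ bl.
  by apply: is_series_ext (is_series_delay n H) => k; rewrite /u; case: ifP.
have [|v [T [uv _ _ ST vT]]] := fubini uU _ uS.
  exact: ex_series_scal_r.
have -> : (la * lb = T)%C.
  apply: (cseries_unique _ ST).
  have H := @is_series_scal C_AbsRing C_NormedModule lb _ _ al.
  rewrite Cmult_comm; apply: is_series_ext H => n; exact: Cmult_comm.
apply: is_series_ext vT => k; apply: (cseries_unique (uv k)).
have -> : csum (fun i => a i * b (k - i)%N)%C k = csum (fun i => u i k) k.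
  by apply: sum_n_ext_loc => i /leP ik; rewrite /u ik.
by apply: (@is_series_finite C_AbsRing C_NormedModule) => i ki; rewrite /u leqNgt ki.
Qed.

Lemma sum_n_scal_R (c : R) (u : nat -> R) n : sum_n (fun k => c * u k) n = c * sum_n u n.
Proof. exact: (@sum_n_mult_l R_Ring). Qed.

Lemma csum_mult_r (c : C) (u : nat -> C) n : csum (fun k => u k * c)%C n = (csum u n * c)%C.
Proof. exact: (@sum_n_mult_r C_Ring). Qed.

(* [f] is the sum of a power series around [p] whose coefficients satisfy
   [\sum_k |c k| rho^k <= B].  This weighted l^1 norm is submultiplicative, and
   unlike the supremum norm it allows sums of power series to be rearranged
   without Cauchy's estimates. *)
Definition ana (f : C -> C) (p : C) (rho B : R) : Prop :=
  exists c : nat -> C, [/\ ex_series (fun k => Cmod (c k) * rho ^ k),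
    Series (fun k => Cmod (c k) * rho ^ k) <= B &
    forall z, Cmod (z - p) <= rho -> cseries (fun k => c k * Cpow (z - p) k)%C (f z)].

(** * Operations on functions given by a power series on a disc *)

Section Ana.
Variables (p : C) (rho : R).
Hypothesis rho_gt0 : 0 < rho.

Let rhok k : 0 < rho ^ k. Proof. exact: pow_lt. Qed.

Lemma ana_coef_bound (c : nat -> C) z k : Cmod (z - p) <= rho ->
  0 <= Cmod (c k * Cpow (z - p) k)%C <= Cmod (c k) * rho ^ k.
Proof.
move=> zp; split; first exact: Cmod_ge_0.
rewrite Cmod_mult Cmod_pow; apply: Rmult_le_compat_l; first exact: Cmod_ge_0.
by apply: pow_incr; split=> //; apply: Cmod_ge_0.
Qed.

Lemma ana_ext f g B : (forall z, Cmod (z - p) <= rho -> f z = g z) ->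
  ana f p rho B -> ana g p rho B.
Proof. by move=> fg [c [ex le S]]; exists c; split=> // z zp; rewrite -fg //; apply: S. Qed.

Lemma ana_le f B B' : B <= B' -> ana f p rho B -> ana f p rho B'.
Proof. by move=> BB [c [ex le S]]; exists c; split=> //; lra. Qed.

Lemma ana_bound f B z : ana f p rho B -> Cmod (z - p) <= rho -> Cmod (f z) <= B.
Proof.
move=> [c [ex le S]] zp; have b k := @ana_coef_bound c z k zp.
have exz := ex_series_le_pos b ex.
apply: Rle_trans (cseries_abs_le exz (S z zp)) _.
apply: Rle_trans le; exact: Series_le.
Qed.

Lemma ana_finite (c : nat -> C) N : (forall k, (N < k)%N -> c k = RtoC 0) ->
  ana (fun z => csum (fun k => c k * Cpow (z - p) k)%C N) p rho
    (sum_n (fun k => Cmod (c k) * rho ^ k) N).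
Proof.
move=> c0.
have H : is_series (fun k => Cmod (c k) * rho ^ k) (sum_n (fun k => Cmod (c k) * rho ^ k) N).
  by apply: (@is_series_finite R_AbsRing R_NormedModule) => k /c0 ->; rewrite Cmod_0 Rmult_0_l.
exists c; split; first by eexists; apply: H.
  by rewrite (is_series_unique _ _ H); lra.
by move=> z _; apply: (@is_series_finite C_AbsRing C_NormedModule) => k /c0 ->; rewrite Cmult_0_l.
Qed.

Lemma ana_const c : ana (fun=> c) p rho (Cmod c).
Proof.
have := @ana_finite (fun k => if k == 0%N then c else RtoC 0) 0; rewrite sum_O /= Rmult_1_r => H.
apply: ana_ext (H _) => [z _|k]; first by rewrite sum_O /= Cmult_1_r.
by case: eqP => // ->.
Qed.

Lemma ana_id : ana id p rho (Cmod p + rho).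
Proof.
have := @ana_finite (fun k => match k with 0%N => p | 1%N => RtoC 1 | _ => RtoC 0 end) 1.
rewrite sum_Sn sum_O /plus /= Cmod_1 !Rmult_1_r Rmult_1_l => H.
apply: ana_ext (H _) => [z _|[|[]]//]; rewrite sum_Sn sum_O /plus /=.
by ring.
Qed.

Lemma ana_plus f g B B' : ana f p rho B -> ana g p rho B' ->
  ana (fun z => f z + g z)%C p rho (B + B').
Proof.
move=> [c [ex le S]] [c' [ex' le' S']]; exists (fun k => c k + c' k)%C.
have b k : 0 <= Cmod (c k + c' k)%C * rho ^ k <= Cmod (c k) * rho ^ k + Cmod (c' k) * rho ^ k.
  have := rhok k; have := Cmod_ge_0 (c k + c' k)%C; have := Cmod_triangle (c k) (c' k).
  by nra.
have exs := ex_series_plus _ _ ex ex'.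
split; first exact: ex_series_le_pos b exs.
  apply: Rle_trans (Series_le _ _ b exs) _; rewrite Series_plus //; lra.
move=> z zp; apply: is_series_ext (is_series_plus _ _ _ _ (S z zp) (S' z zp)) => k.
by rewrite /plus /=; ring.
Qed.

Lemma ana_mult f g B B' : ana f p rho B -> ana g p rho B' ->
  ana (fun z => f z * g z)%C p rho (B * B').
Proof.
move=> [c [ex le S]] [c' [ex' le' S']].
exists (fun k => csum (fun i => c i * c' (k - i)%N)%C k).
have H := is_series_mult_pos _ _ _ _ (Series_correct _ ex) (Series_correct _ ex').
have {H} := H _ _.
have pos (d : nat -> C) n : 0 <= Cmod (d n) * rho ^ n.
  by have := rhok n; have := Cmod_ge_0 (d n); nra.
move=> /(_ (pos c) (pos c')) H.
have b k : 0 <= Cmod (csum (fun i => c i * c' (k - i)%N)%C k) * rho ^ k <=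
    sum_f_R0 (fun i => Cmod (c i) * rho ^ i * (Cmod (c' (k - i)%coq_nat) * rho ^ (k - i)%coq_nat)) k.
  split; first by have := rhok k; have := Cmod_ge_0 (csum (fun i => c i * c' (k - i)%N)%C k); nra.
  have E i : (i <= k)%N -> Cmod (c i) * rho ^ i * (Cmod (c' (k - i)%coq_nat) * rho ^ (k - i)%coq_nat)
      = rho ^ k * Cmod (c i * c' (k - i)%N)%C.
    move=> ik; rewrite Cmod_mult (_ : rho ^ k = rho ^ i * rho ^ (k - i)%coq_nat); first by rewrite minusE; ring.
    by rewrite -pow_add; congr (_ ^ _); lia.
  rewrite -sum_n_Reals (@sum_n_ext_loc R_AbelianMonoid _
    (fun i => rho ^ k * Cmod (c i * c' (k - i)%N)%C)) => [|i /leP /E //].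
  rewrite sum_n_scal_R Rmult_comm; apply: Rmult_le_compat_l; first exact: Rlt_le.
  exact: Cmod_sum_n.
split.
- by apply: ex_series_le_pos b _; eexists; apply: H.
- apply: Rle_trans (Series_le _ _ b _) _; first by eexists; apply: H.
  rewrite (is_series_unique _ _ H); apply: Rmult_le_compat => //.
    by apply: Rle_trans (term_le_Series 0 (pos c) ex).
  by apply: Rle_trans (term_le_Series 0 (pos c') ex').
move=> z zp.
have exz (d : nat -> C) : ex_series (fun k => Cmod (d k) * rho ^ k) ->
    ex_series (fun k => Cmod (d k * Cpow (z - p) k)%C).
  by apply: ex_series_le_pos => k; apply: ana_coef_bound.
have := cauchy_product (exz _ ex) (exz _ ex') (S z zp) (S' z zp).
apply: is_series_ext => k; rewrite -csum_mult_r; apply: sum_n_ext_loc => i /leP ik.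
have E : (c i * Cpow (z - p) i * (c' (k - i)%N * Cpow (z - p) (k - i)) =
    c i * c' (k - i)%N * Cpow (z - p) k)%C.
  rewrite (_ : Cpow (z - p) k = (Cpow (z - p) i * Cpow (z - p) (k - i))%C); first by ring.
  by rewrite -Cpow_add_r; congr Cpow; lia.
exact: E.
Qed.

(** Summable norms make the double array of terms absolutely summable, so Fubini collects the
    coefficients of each power; this replaces the theorem on uniform limits of analytic
    functions. *)
Lemma ana_infsum (f : nat -> C -> C) (B : nat -> R) :
  (forall n, ana (f n) p rho (B n)) -> ex_series B ->
  ana (fun z => csval (fun n => f n z)) p rho (Series B).
Proof.
move=> fB exB.
pose c n := sval (cid (fB n)).
have cP n : [/\ ex_series (fun k => Cmod (c n k) * rho ^ k),
    Series (fun k => Cmod (c n k) * rho ^ k) <= B n &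
    forall z, Cmod (z - p) <= rho -> cseries (fun k => c n k * Cpow (z - p) k)%C (f n z)].
  by rewrite /c; case: cid.
pose U n := Series (fun k => Cmod (c n k) * rho ^ k).
have pos n k : 0 <= Cmod (c n k) * rho ^ k.
  by have := rhok k; have := Cmod_ge_0 (c n k); nra.
have UP n : is_series (fun k => Cmod (c n k) * rho ^ k) (U n).
  by apply: Series_correct; case: (cP n).
have U0 n : 0 <= U n.
  by apply: Rle_trans (term_le_Series 0 (pos n) _); [apply: pos|case: (cP n)].
have exU : ex_series U.
  by apply: ex_series_le_pos exB => n; split=> //; case: (cP n).
have exd k : ex_series (fun n => Cmod (c n k)).
  apply: (@ex_series_le_pos _ (fun n => U n * / rho ^ k)); last exact: ex_series_scal_r.
  move=> n; split; first exact: Cmod_ge_0.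
  apply: (Rmult_le_reg_r (rho ^ k)) => //; rewrite Rmult_assoc Rinv_l; last exact: Rgt_not_eq.
  rewrite Rmult_1_r -(is_series_unique _ _ (UP n)).
  by apply: (term_le_Series k (pos n)); exists (U n).
pose d k := csval (fun n => c n k).
have dP k : cseries (fun n => c n k) (d k) by apply: csval_abs.
have [W [WP WU]] := tonelli pos UP exU.
have b k : 0 <= Cmod (d k) * rho ^ k <= W k.
  split; first by have := rhok k; have := Cmod_ge_0 (d k); nra.
  rewrite -(is_series_unique _ _ (WP k)).
  rewrite (Series_ext _ (fun n => rho ^ k * Cmod (c n k))) => [|n]; last by rewrite Rmult_comm.
  rewrite Series_scal_l Rmult_comm; apply: Rmult_le_compat_l; first exact: Rlt_le.
  exact: cseries_abs_le.
exists d; split.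
- by apply: ex_series_le_pos b _; eexists; apply: WU.
- apply: Rle_trans (Series_le _ _ b _) _; first by eexists; apply: WU.
  rewrite (is_series_unique _ _ WU); apply: Series_le => // n; split=> //.
  by case: (cP n).
move=> z zp.
have exz n : ex_series (fun k => Cmod (c n k * Cpow (z - p) k)%C).
  by apply: ex_series_le_pos (ex_intro _ _ (UP n)) => k; apply: ana_coef_bound.
have exzU : ex_series (fun n => Series (fun k => Cmod (c n k * Cpow (z - p) k)%C)).
  apply: ex_series_le_pos exU => n; split.
    by apply: Rle_trans (term_le_Series 0 _ (exz n)); first exact: Cmod_ge_0; move=> k; apply: Cmod_ge_0.
  by apply: Series_le; [move=> k; apply: ana_coef_bound|exists (U n)].
have fz n : cseries (fun k => c n k * Cpow (z - p) k)%C (f n z) by case: (cP n) => _ _; apply.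
have [v [T [uv _ _ ST vT]]] := fubini (fun n => Series_correct _ (exz n)) exzU fz.
rewrite (csvalE ST); apply: is_series_ext vT => k; apply: (cseries_unique (uv k)).
rewrite Cmult_comm; apply: is_series_ext (@is_series_scal C_AbsRing C_NormedModule (Cpow (z - p) k) _ _ (dP k)) => n.
exact: Cmult_comm.
Qed.

Lemma ana_abs (f : nat -> C -> C) (B : nat -> R) z :
  (forall n, ana (f n) p rho (B n)) -> ex_series B -> Cmod (z - p) <= rho ->
  ex_series (fun n => Cmod (f n z)).
Proof.
move=> fB exB zp; apply: ex_series_le_pos exB => n; split; first exact: Cmod_ge_0.
exact: ana_bound (fB n) zp.
Qed.

Lemma ana_shift f s B : ana f (p + s) rho B -> ana (fun z => f (z + s)%C) p rho B.
Proof.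
move=> [c [ex le S]]; exists c; split=> // z zp.
have E : ((z + s) - (p + s) = z - p)%C by ring.
by rewrite -E; apply: S; rewrite E.
Qed.

End Ana.

Lemma ana_shrink f p rho rho' B : 0 < rho' <= rho -> ana f p rho B -> ana f p rho' B.
Proof.
move=> [r0 rr] [c [ex le S]].
have b k : 0 <= Cmod (c k) * rho' ^ k <= Cmod (c k) * rho ^ k.
  have := Cmod_ge_0 (c k); have := pow_lt _ k r0; have : rho' ^ k <= rho ^ k by apply: pow_incr; lra.
  by nra.
exists c; split; first exact: ex_series_le_pos b ex.
  by apply: Rle_trans (Series_le _ _ b ex) le.
by move=> z zp; apply: S; lra.
Qed.

(** * Complex powers *)

(** With f = A + i B and s = a + i b the hypotheses read f' = lam' s f. Then U + i V = exp(- s lam)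
    f has derivative zero along the real segment. *)
Lemma exp_ode (a b T : R) (A B lam dlam : R -> R) : 0 <= T ->
  (forall t, 0 <= t <= T -> is_derive lam t (dlam t)) ->
  (forall t, 0 <= t <= T -> is_derive A t (dlam t * (a * A t - b * B t))) ->
  (forall t, 0 <= t <= T -> is_derive B t (dlam t * (b * A t + a * B t))) ->
  lam 0 = 0 -> A 0 = 1 -> B 0 = 0 ->
  A T = exp (a * lam T) * cos (b * lam T) /\ B T = exp (a * lam T) * sin (b * lam T).
Proof.
move=> T0 dl dA dB l0 A0 B0.
pose U t := exp (- a * lam t) * (A t * cos (b * lam t) + B t * sin (b * lam t)).
pose V t := exp (- a * lam t) * (B t * cos (b * lam t) - A t * sin (b * lam t)).
have dU t : 0 <= t <= T -> is_derive U t 0.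
  move=> tT; have dlt := dl t tT; have dAt := dA t tT; have dBt := dB t tT.
  rewrite /U; auto_derive.
    by repeat apply: conj => //; first [exact: (ex_intro _ _ dlt)|exact: (ex_intro _ _ dAt)|exact: (ex_intro _ _ dBt)].
  by rewrite (is_derive_unique _ _ _ dlt) (is_derive_unique _ _ _ dAt) (is_derive_unique _ _ _ dBt); ring.
have dV t : 0 <= t <= T -> is_derive V t 0.
  move=> tT; have dlt := dl t tT; have dAt := dA t tT; have dBt := dB t tT.
  rewrite /V; auto_derive.
    by repeat apply: conj => //; first [exact: (ex_intro _ _ dlt)|exact: (ex_intro _ _ dAt)|exact: (ex_intro _ _ dBt)].
  by rewrite (is_derive_unique _ _ _ dlt) (is_derive_unique _ _ _ dAt) (is_derive_unique _ _ _ dBt); ring.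
have UT : U T = 1.
  have <- : U 0 = 1 by rewrite /U l0 A0 B0 !Rmult_0_r exp_0 cos_0 sin_0; ring.
  case: (Req_dec 0 T) => [<-//|T1]; symmetry.
  by apply: (@eq_is_derive R_NormedModule) => //; lra.
have VT : V T = 0.
  have <- : V 0 = 0 by rewrite /V l0 A0 B0 !Rmult_0_r exp_0 cos_0 sin_0; ring.
  case: (Req_dec 0 T) => [<-//|T1]; symmetry.
  by apply: (@eq_is_derive R_NormedModule) => //; lra.
move: UT VT; rewrite /U /V.
set c := cos _; set s := sin _; set E := exp (- a * lam T); set E' := exp (a * lam T).
have EE : E' * E = 1 by rewrite /E /E' -exp_plus -exp_0; congr exp; ring.
have cs : s * s + c * c = 1 by have := sin2_cos2 (b * lam T); rewrite /Rsqr.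
move=> HU HV.
have AE : E' * 1 = A T * c + B T * s by rewrite -HU -Rmult_assoc EE; ring.
have BE : E' * 0 = B T * c - A T * s by rewrite -HV -Rmult_assoc EE; ring.
split.
  have -> : A T = (A T * c + B T * s) * c - (B T * c - A T * s) * s by rewrite -[LHS]Rmult_1_r -cs; ring.
  by rewrite -AE -BE; ring.
have -> : B T = (A T * c + B T * s) * s + (B T * c - A T * s) * c by rewrite -[LHS]Rmult_1_r -cs; ring.
by rewrite -AE -BE; ring.
Qed.

Lemma cseries_pair (u : nat -> C) (x y : R) :
  is_series (fun n => Re (u n)) x -> is_series (fun n => Im (u n)) y -> cseries u (x, y).
Proof.
move=> ux uy; apply: cseries_eps.
have reE n : csum u n = (sum_n (fun k => Re (u k)) n, sum_n (fun k => Im (u k)) n).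
  elim: n => [|n IHn]; first by rewrite !sum_O; case: (u 0%N).
  by rewrite !sum_Sn IHn; case: (u n.+1).
apply: (is_lim_seq_le_le (fun=> 0) _ (fun n => Rabs (sum_n (fun k => Re (u k)) n - x)
   + Rabs (sum_n (fun k => Im (u k)) n - y))).
- move=> n; split; first exact: Cmod_ge_0.
  rewrite reE; move: (sum_n (fun k => Re (u k)) n : R) (sum_n (fun k => Im (u k)) n : R) => p q.
  have -> : ((p, q) - (x, y) = RtoC (Rminus p x) + (R0, Rminus q y))%C.
    by rewrite /Cminus /Cplus /Copp /RtoC /=; congr pair; ring.
  apply: Rle_trans (Cmod_triangle _ _) _; rewrite Cmod_R /Cmod /=.
  by rewrite Rmult_0_l Rplus_0_l Rmult_1_r -/(Rsqr (q - y)) sqrt_Rsqr_abs; lra.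
- exact: is_lim_seq_const.
have H v l : is_series v l -> is_lim_seq (fun n => Rabs (sum_n v n - l)) 0.
  move=> vl; apply: (is_lim_seq_abs_0 _).1; rewrite -(Rminus_diag_eq l l erefl).
  by apply: is_lim_seq_minus' => //; exact: is_lim_seq_const.
by rewrite -(Rplus_0_r 0); apply: is_lim_seq_plus'; apply: H.
Qed.

Lemma Re_le_Cmod z : Rabs (Re z) <= Cmod z. Proof. by apply: Rle_trans (Rmax_Cmod z); apply: Rmax_l. Qed.
Lemma Im_le_Cmod z : Rabs (Im z) <= Cmod z. Proof. by apply: Rle_trans (Rmax_Cmod z); apply: Rmax_r. Qed.

(* The power series ODE [lam'(t)^-1 f'(t) = s f(t)], stated on coefficients. *)
Lemma exp_ode_series (c : nat -> C) (s : C) (T r : R) (lam dlam mu : R -> R) (th : R) :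
  0 <= T < r -> ex_series (fun k => Cmod (c k) * r ^ k) ->
  (forall t, 0 <= t <= T -> is_derive lam t (dlam t)) ->
  (forall t, 0 <= t <= T -> dlam t * (1 + th * t) = 1) ->
  lam 0 = 0 -> c 0%N = RtoC 1 ->
  (forall k, (RtoC (INR k.+1) * c k.+1 + RtoC (th * INR k) * c k = s * c k)%C) ->
  cseries (fun k => c k * RtoC (T ^ k))%C (Cexp (s * RtoC (lam T))%C).
Proof.
move=> [T0 Tr] exc dl dlE l0 c0 crec.
pose a k := Re (c k); pose b k := Im (c k).
have rad (d : nat -> R) : (forall k, Rabs (d k) <= Cmod (c k)) -> forall t, 0 <= t <= T ->
    Rbar_lt (Rabs t) (CV_radius d).
  move=> dc t tT; have [ub _] := CV_radius_bounded d.
  apply: (Rbar_lt_le_trans _ r); first by rewrite /= Rabs_pos_eq; lra.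
  apply: ub; exists (Series (fun k => Cmod (c k) * r ^ k)) => k.
  have rk : 0 < r ^ k by apply: pow_lt; lra.
  apply: Rle_trans (term_le_Series k _ exc).
    by rewrite Rabs_mult [X in _ * X]Rabs_pos_eq; [apply: Rmult_le_compat_r; [lra|]|lra].
  by move=> n; apply: Rmult_le_pos; [apply: Cmod_ge_0|apply: pow_le; lra].
have ra := rad a (fun k => Re_le_Cmod _); have rb := rad b (fun k => Im_le_Cmod _).
have arec k : INR k.+1 * a k.+1 + th * (INR k * a k) = Re s * a k - Im s * b k.
  move: (crec k); rewrite /a /b; move: (c k) (c k.+1) => [u v] [u' v']; case: (s) => x y.
  by move/(f_equal Re); rewrite /Re /Im /= => <-; ring.
have brec k : INR k.+1 * b k.+1 + th * (INR k * b k) = Im s * a k + Re s * b k.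
  move: (crec k); rewrite /a /b; move: (c k) (c k.+1) => [u v] [u' v']; case: (s) => x y.
  by move/(f_equal Im); rewrite /Re /Im /= => H; rewrite Rplus_comm [_ * u + _]Rplus_comm -H; ring.
have exP (d : nat -> R) t : Rbar_lt (Rabs t) (CV_radius d) -> ex_pseries d t.
  by move=> H; apply: CV_radius_inside.
have der (d d1 d2 : nat -> R) (x y : R) t : 0 <= t <= T ->
    (forall t, 0 <= t <= T -> Rbar_lt (Rabs t) (CV_radius d)) ->
    (forall t, 0 <= t <= T -> Rbar_lt (Rabs t) (CV_radius d1)) ->
    (forall t, 0 <= t <= T -> Rbar_lt (Rabs t) (CV_radius d2)) ->
    (forall k, INR k.+1 * d k.+1 + th * (INR k * d k) = x * d1 k + y * d2 k) ->
    is_derive (PSeries d) t (dlam t * (x * PSeries d1 t + y * PSeries d2 t)).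
  move=> tT rd rd1 rd2 drec.
  have := is_derive_PSeries d t (rd t tT).
  suff -> : PSeries (PS_derive d) t = dlam t * (x * PSeries d1 t + y * PSeries d2 t) by [].
  have exd : ex_pseries (PS_derive d) t by apply: exP; rewrite CV_radius_derive; apply: rd.
  have E : (1 + th * t) * PSeries (PS_derive d) t = x * PSeries d1 t + y * PSeries d2 t.
    rewrite -(PSeries_scal x d1) -(PSeries_scal y d2) -PSeries_plus; first last.
    - apply: ex_pseries_scal; [exact: Rmult_comm|exact/exP/rd2].
    - apply: ex_pseries_scal; [exact: Rmult_comm|exact/exP/rd1].
    rewrite Rmult_plus_distr_r Rmult_1_l Rmult_assoc -PSeries_incr_1 -(PSeries_scal th) -PSeries_plus //.
      apply: PSeries_ext => k; rewrite /PS_plus /PS_scal /PS_derive /plus /scal /= /mult /= -drec.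
      congr (_ + _); congr (_ * _); case: k => [|k] //=; by rewrite Rmult_0_l.
    apply: ex_pseries_scal; [exact: Rmult_comm|exact: ex_pseries_incr_1].
  by rewrite -E -Rmult_assoc dlE // Rmult_1_l.
have T1 : 0 <= T <= T by lra.
have [||||ET1 ET2] := @exp_ode (Re s) (Im s) T (PSeries a) (PSeries b) lam dlam T0 dl _ _ l0.
- move=> t tT; have := der a a b (Re s) (- Im s) t tT ra ra rb.
  rewrite Ropp_mult_distr_l_reverse; apply => k; rewrite arec; ring.
- move=> t tT; exact: (der _ _ _ _ _ _ tT rb ra rb brec).
- by rewrite PSeries_0 /a c0.
- by rewrite PSeries_0 /b c0.
have -> : Cexp (s * RtoC (lam T)) = (PSeries a T, PSeries b T).
  rewrite ET1 ET2 /Cexp; case: (s) => x y /=.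
  by rewrite !Rmult_0_r Rminus_0_r Rplus_0_l [y * _]Rmult_comm [lam T * y]Rmult_comm.
apply: cseries_pair.
  have /is_pseries_R H := PSeries_correct _ _ (exP _ _ (ra T T1)).
  apply: is_series_ext H => k; rewrite /a; case: (c k) => x y /=; ring.
have /is_pseries_R H := PSeries_correct _ _ (exP _ _ (rb T T1)).
apply: is_series_ext H => k; rewrite /b; case: (c k) => x y /=; ring.
Qed.

Lemma Cexp_plus u v : Cexp (u + v)%C = (Cexp u * Cexp v)%C.
Proof.
case: u v => [a b] [c d]; rewrite /Cexp /Cmult /= exp_plus cos_plus sin_plus.
by congr pair; ring.
Qed.

Lemma Cexp_0 : Cexp 0 = RtoC 1.
Proof. by rewrite /Cexp /= exp_0 cos_0 sin_0; congr pair; ring. Qed.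

Lemma Cmod_Cexp u : Cmod (Cexp u) = exp (Re u).
Proof.
rewrite /Cmod /Cexp /=; set c := cos _; set s := sin _; set E := exp _.
have E0 : 0 < E by apply: exp_pos.
have cs : s * s + c * c = 1 by have := sin2_cos2 (Im u); rewrite /Rsqr.
rewrite (_ : _ + _ = E ^ 2).
  by rewrite sqrt_pow2 //; lra.
by transitivity (E ^ 2 * (s * s + c * c)); [ring|rewrite cs; ring].
Qed.

Lemma Cexp_neq0 u : Cexp u <> 0%C.
Proof. by move=> H; have := exp_pos (Re u); rewrite -Cmod_Cexp H Cmod_0; lra. Qed.

Lemma Cexp_RtoC (x : R) : Cexp x = RtoC (exp x).
Proof. by rewrite /Cexp /= cos_0 sin_0 Rmult_1_r Rmult_0_r. Qed.

Lemma Cexp_opp u : Cexp (- u)%C = (/ Cexp u)%C.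
Proof.
have := Cexp_plus u (- u)%C; rewrite Cplus_opp_r Cexp_0 => E.
have u0 := @Cexp_neq0 u.
rewrite -[LHS]Cmult_1_l -(Cinv_l _ u0) -Cmult_assoc -E; ring.
Qed.

Lemma INR_S_neq0 k : RtoC (INR k.+1) <> 0%C.
Proof. by move=> /RtoC_inj; apply: not_0_INR. Qed.

Lemma INR_fact_neq0 k : RtoC (INR (fact k)) <> 0%C.
Proof. by move=> /RtoC_inj; apply: INR_fact_neq_0. Qed.

Lemma Cmod_INR k : Cmod (RtoC (INR k)) = INR k.
Proof. by rewrite Cmod_R Rabs_pos_eq //; apply: pos_INR. Qed.

Lemma ex_series_exp x : ex_series (fun k => / INR (fact k) * x ^ k).
Proof. by have /is_pseries_R H := is_exp_Reals x; eexists; apply: H. Qed.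

Lemma Cmod_exp_coef u k : Cmod (Cpow u k / RtoC (INR (fact k)))%C = / INR (fact k) * Cmod u ^ k.
Proof.
rewrite Cmod_div; last exact: INR_fact_neq0.
by rewrite Cmod_pow Cmod_INR Rmult_comm.
Qed.

Lemma Cexp_series u : cseries (fun k => Cpow u k / RtoC (INR (fact k)))%C (Cexp u).
Proof.
have := @exp_ode_series (fun k => Cpow u k / RtoC (INR (fact k)))%C u 1 2 id (fun=> 1) id 0.
rewrite Cmult_1_r => H.
apply: cseries_ext (H _ _ _ _ _ _ _); first 1 last.
- by lra.
- apply: (rex_series_ext (u := fun k => / INR (fact k) * (Cmod u * 2) ^ k)); last exact: ex_series_exp.
  by move=> k; rewrite Cmod_exp_coef Rpow_mult_distr; ring.
- by move=> t _; apply: is_derive_id.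
- by move=> t _; ring.
- by [].
- by rewrite /= /Cdiv Cmult_1_l; field; exact: (@INR_fact_neq0 0).
- move=> k; rewrite fact_simpl mult_INR RtoC_mult Rmult_0_l Cmult_0_l Cplus_0_r /=.
  field; split; [exact: INR_fact_neq0|exact: INR_S_neq0].
by move=> k; rewrite pow1 Cmult_1_r.
Qed.

Arguments Cexp_series : clear implicits.

Lemma ana_exp p rho (L : R) : 0 < rho ->
  ana (fun z => Cexp (z * L)%C) p rho (exp (Re p * L + rho * Rabs L)).
Proof.
move=> rho0; exists (fun k => Cexp (p * L) * (Cpow L k / RtoC (INR (fact k))))%C.
have E k : Cmod (Cexp (p * L) * (Cpow L k / RtoC (INR (fact k))))%C * rho ^ k
    = exp (Re p * L) * (/ INR (fact k) * (rho * Rabs L) ^ k).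
  rewrite Cmod_mult Cmod_exp_coef Cmod_Cexp Cmod_R Rpow_mult_distr.
  by rewrite (_ : Re (p * L)%C = Re p * L); [ring|case: (p) => x y /=; ring].
have H : is_series (fun k => Cmod (Cexp (p * L) * (Cpow L k / RtoC (INR (fact k))))%C * rho ^ k)
    (exp (Re p * L + rho * Rabs L)).
  rewrite exp_plus; have /is_pseries_R H := is_exp_Reals (rho * Rabs L).
  have := @is_series_scal R_AbsRing R_NormedModule (exp (Re p * L)) _ _ H.
  by apply: rseries_ext => k; rewrite E.
split; first by eexists; apply: H.
  by rewrite (is_series_unique _ _ H); lra.
move=> z _; have := @cseries_scal (Cexp (p * L)%C) _ _ (Cexp_series ((z - p) * L)%C).
rewrite -Cexp_plus (_ : p * L + (z - p) * L = z * L)%C; last by ring.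
apply: cseries_ext => k; rewrite Cpow_mult_l /Cdiv; ring.
Qed.

(* [rpow x z] is [x^(-z)]. *)
Definition rpow (x : R) (z : C) : C := Cexp (- z * RtoC (ln x))%C.

Lemma rpowE x z : rpow x z = (/ Rcpow x z)%C.
Proof. by rewrite /rpow /Rcpow -Cexp_opp; congr Cexp; ring. Qed.

Lemma Cmod_rpow x z : Cmod (rpow x z) = Rpower x (- Re z).
Proof.
rewrite /rpow Cmod_Cexp /Rpower; congr exp.
by case: z => a b /=; ring.
Qed.

Lemma rpowD x z s : rpow x (z + s)%C = (rpow x z * rpow x s)%C.
Proof. by rewrite /rpow -Cexp_plus; congr Cexp; ring. Qed.

Lemma rpow_mult x y z : 0 < x -> 0 < y -> rpow (x * y) z = (rpow x z * rpow y z)%C.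
Proof. by move=> x0 y0; rewrite /rpow ln_mult // RtoC_plus -Cexp_plus; congr Cexp; ring. Qed.

Lemma rpow_nat x n : 0 < x -> rpow x (- RtoC (INR n))%C = RtoC (x ^ n).
Proof.
move=> x0; rewrite /rpow (_ : (- - RtoC (INR n) * ln x)%C = RtoC (INR n * ln x)); last first.
  by rewrite RtoC_mult; ring.
by rewrite Cexp_RtoC -/(Rpower x (INR n)) Rpower_pow.
Qed.

Lemma ana_rpow_ex p rho x : 0 < rho ->
  ana (rpow x) p rho (exp (Re p * - ln x + rho * Rabs (- ln x))).
Proof.
move=> rho0; apply: ana_ext (ana_exp p (- ln x) rho0) => z _.
by rewrite /rpow RtoC_opp; congr Cexp; ring.
Qed.

Lemma ana_rpow p rho x : 0 < rho -> 1 <= x -> ana (rpow x) p rho (Rpower x (rho - Re p)).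
Proof.
move=> rho0 x1; apply: ana_le (ana_rpow_ex p x rho0).
rewrite Rabs_Ropp /Rpower; apply: Req_le; congr exp.
have : 0 <= ln x by rewrite -ln_1; case: (Req_dec x 1) => [->|?]; [lra|apply/Rlt_le/ln_increasing; lra].
by move=> l0; rewrite Rabs_pos_eq //; ring.
Qed.

(** * Binomial coefficients and the binomial series *)

Fixpoint cbin (s : C) (k : nat) : C :=
  match k with
  | 0%N => RtoC 1
  | k'.+1 => (cbin s k' * ((s - RtoC (INR k')) / RtoC (INR k'.+1)))%C
  end.

(** The rising factorial q (q + 1) ... (q + k - 1) / k!, a majorant of [cbin s k] on the disc of
    radius [q]. *)
Fixpoint rbin (q : R) (k : nat) : R :=
  match k with
  | 0%N => 1
  | k'.+1 => rbin q k' * ((q + INR k') / INR k'.+1)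
  end.

Lemma cbinS s k : cbin s k.+1 = (cbin s k * ((s - RtoC (INR k)) / RtoC (INR k.+1)))%C.
Proof. by []. Qed.

Lemma rbinS q k : rbin q k.+1 = rbin q k * ((q + INR k) / INR k.+1).
Proof. by []. Qed.

Lemma INR_S_gt0 k : 0 < INR k.+1. Proof. by apply: lt_0_INR; lia. Qed.

Lemma rbin_gt0 q k : 0 < q -> 0 < rbin q k.
Proof.
move=> q0; elim: k => [|k IHk]; first by rewrite /=; lra.
apply: Rmult_lt_0_compat => //; apply: Rdiv_lt_0_compat; last exact: INR_S_gt0.
by have := pos_INR k; lra.
Qed.

Lemma Cmod_cbin s q k : Cmod s <= q -> Cmod (cbin s k) <= rbin q k.
Proof.
move=> sq; elim: k => [|k IHk]; first by rewrite /= Cmod_1; lra.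
rewrite cbinS rbinS Cmod_mult; apply: Rmult_le_compat => //; try exact: Cmod_ge_0.
rewrite Cmod_div; last exact: INR_S_neq0.
rewrite Cmod_INR; apply: Rmult_le_compat_r; first exact/Rlt_le/Rinv_0_lt_compat/INR_S_gt0.
apply: Rle_trans (Cmod_triangle _ _) _; rewrite Cmod_opp Cmod_INR; lra.
Qed.

Lemma ex_series_rbin q t : 0 < q -> 0 < t < 1 -> ex_series (fun k => rbin q k * t ^ k).
Proof.
move=> q0 [t0 t1].
have pos k : 0 < rbin q k * t ^ k by apply: Rmult_lt_0_compat; [exact: rbin_gt0|exact: pow_lt].
apply: (rex_series_ext (u := fun k => Rabs (rbin q k * t ^ k))).
  by move=> k; rewrite Rabs_pos_eq //; apply: Rlt_le.
apply: (ex_series_DAlembert _ t) => // [k|]; first exact: Rgt_not_eq.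
apply: (is_lim_seq_ext (fun k => t * (1 + (q - 1) * / INR k.+1))).
  move=> k; rewrite Rabs_pos_eq; last by apply/Rlt_le/Rdiv_lt_0_compat.
  have := INR_S_gt0 k; rewrite rbinS [t ^ k.+1]/= S_INR => k0.
  have := rbin_gt0 k q0; have := pow_lt t k t0 => ? ?.
  by field; lra.
suff : is_lim_seq (fun k => t * (1 + (q - 1) * / INR k.+1)) (t * (1 + (q - 1) * 0)).
  by rewrite Rmult_0_r Rplus_0_r Rmult_1_r.
apply: is_lim_seq_mult'; first exact: is_lim_seq_const.
apply: is_lim_seq_plus'; first exact: is_lim_seq_const.
apply: is_lim_seq_mult'; first exact: is_lim_seq_const.
apply/(is_lim_seq_incr_1 (fun k => / INR k)).
exact: (is_lim_seq_inv _ p_infty is_lim_seq_INR).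
Qed.

Lemma ana_cbin p rho k : 0 < rho ->
  ana (fun z => cbin (1 - z)%C k) p rho (rbin (Cmod p + rho + 1) k).
Proof.
move=> rho0; elim: k => [|k IHk].
  by have := ana_const p rho (RtoC 1); rewrite Cmod_1.
rewrite rbinS.
apply: (ana_mult rho0) IHk _.
have H := ana_mult rho0 (ana_plus rho0 (ana_const p rho (RtoC 1 - RtoC (INR k))%C)
   (ana_mult rho0 (ana_const p rho (- RtoC 1)%C) (ana_id p rho))) (ana_const p rho (/ RtoC (INR k.+1))%C).
have H2 := ana_ext _ H.
apply: ana_le (H2 _ _); last by move=> z _; rewrite /id /Cdiv; ring.
rewrite Cmod_opp Cmod_1 Cmod_inv ?Cmod_INR; last exact: INR_S_neq0.
apply: Rmult_le_compat_r; first exact/Rlt_le/Rinv_0_lt_compat/INR_S_gt0.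
have := Cmod_triangle (RtoC 1) (- RtoC (INR k))%C; rewrite Cmod_opp Cmod_1 Cmod_INR /Cminus; lra.
Qed.

Lemma binomial_series s t : 0 < t < 1 ->
  cseries (fun k => cbin s k * RtoC (t ^ k))%C (Cexp (s * RtoC (ln (1 + t)))%C).
Proof.
move=> [t0 t1].
(* The equation is (1 + t) f' = s f, hence [th = 1]; the radius is a point between [t] and 1. *)
have := @exp_ode_series (cbin s) s t ((1 + t) / 2) (fun t => ln (1 + t)) (fun t => / (1 + t)) id 1.
apply.
- by lra.
- have q0 : 0 < Cmod s + 1 by have := Cmod_ge_0 s; lra.
  have r01 : 0 < (1 + t) / 2 < 1 by lra.
  apply: (ex_series_le_pos _ (ex_series_rbin q0 r01)) => k; split.
    by apply: Rmult_le_pos; [apply: Cmod_ge_0|apply: pow_le; lra].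
  apply: Rmult_le_compat_r; first by apply: pow_le; lra.
  by apply: Cmod_cbin; lra.
- by move=> u ut; auto_derive; [lra|field; lra].
- by move=> u ut; field; lra.
- by rewrite Rplus_0_r ln_1.
- by [].
by move=> k; rewrite cbinS Rmult_1_l /id; field; apply: INR_S_neq0.
Qed.

(** * The Hurwitz zeta function *)

(* [f] extends analytically to [p] with value [v]; [f p] itself is ignored. *)
Definition reg (f : C -> C) (p v : C) : Prop :=
  exists rho B g, [/\ 0 < rho, ana g p rho B, g p = v &
    forall z, 0 < Cmod (z - p) <= rho -> f z = g z].

Lemma Cminus_diag z : (z - z = 0)%C. Proof. ring. Qed.

Lemma reg_of_ana f p rho B : 0 < rho -> ana f p rho B -> reg f p (f p).
Proof. by move=> r0 fa; exists rho, B, f. Qed.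

Lemma reg_ext f g p v rho : 0 < rho -> (forall z, 0 < Cmod (z - p) <= rho -> f z = g z) ->
  reg f p v -> reg g p v.
Proof.
move=> r0 fg [rho' [B [h [r0' ha hp fh]]]].
exists (Rmin rho rho'), B, h; split=> //; first exact: Rmin_pos.
  by apply: ana_shrink ha; split; [exact: Rmin_pos|exact: Rmin_r].
move=> z [z0 zr]; rewrite -fg; first by apply: fh; split=> //; apply: Rle_trans zr _; apply: Rmin_r.
by split=> //; apply: Rle_trans zr _; apply: Rmin_l.
Qed.

Lemma reg_common f g p v w : reg f p v -> reg g p w ->
  exists rho B B' f' g', [/\ 0 < rho, ana f' p rho B /\ f' p = v, ana g' p rho B' /\ g' p = w &
    forall z, 0 < Cmod (z - p) <= rho -> f z = f' z /\ g z = g' z].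
Proof.
move=> [r1 [B1 [f' [r10 fa fp ff]]]] [r2 [B2 [g' [r20 ga gp gg]]]].
have r0 := Rmin_pos _ _ r10 r20.
exists (Rmin r1 r2), B1, B2, f', g'; split=> //.
- by split=> //; apply: ana_shrink fa; split=> //; apply: Rmin_l.
- by split=> //; apply: ana_shrink ga; split=> //; apply: Rmin_r.
move=> z [z0 zr]; split; [apply: ff|apply: gg]; split=> //; apply: Rle_trans zr _.
  exact: Rmin_l.
exact: Rmin_r.
Qed.

Lemma reg_plus f g p v w : reg f p v -> reg g p w -> reg (fun z => f z + g z)%C p (v + w)%C.
Proof.
move=> rf rg; have [rho [B [B' [f' [g' [r0 [fa <-] [ga <-] E]]]]]] := reg_common rf rg.
exists rho, (B + B'), (fun z => f' z + g' z)%C; split=> //; first exact: ana_plus.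
by move=> z /E[-> ->].
Qed.

Lemma reg_mult f g p v w : reg f p v -> reg g p w -> reg (fun z => f z * g z)%C p (v * w)%C.
Proof.
move=> rf rg; have [rho [B [B' [f' [g' [r0 [fa <-] [ga <-] E]]]]]] := reg_common rf rg.
exists rho, (B * B'), (fun z => f' z * g' z)%C; split=> //; first exact: ana_mult.
by move=> z /E[-> ->].
Qed.

Lemma reg_const c p : reg (fun=> c) p c.
Proof. by exists 1, (Cmod c), (fun=> c); split=> //; [lra|exact: ana_const]. Qed.

Lemma reg_id p : reg (fun z => z) p p.
Proof. by exists 1, (Cmod p + 1), id; split=> //; [lra|exact: ana_id]. Qed.

Lemma reg_shift f p s v : reg f (p + s)%C v -> reg (fun z => f (z + s)%C) p v.
Proof.
move=> [rho [B [g [r0 ga gp fg]]]]; exists rho, B, (fun z => g (z + s)%C); split=> //.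
  exact: ana_shift.
by move=> z zp; apply: fg; rewrite (_ : z + s - (p + s) = z - p)%C //; ring.
Qed.

Lemma reg_rpow x p : reg (rpow x) p (rpow x p).
Proof. exact: reg_of_ana Rlt_0_1 (ana_rpow_ex p x Rlt_0_1). Qed.

Lemma reg_csum (f : nat -> C -> C) (v : nat -> C) p N :
  (forall k, (k <= N)%N -> reg (f k) p (v k)) -> reg (fun z => csum (fun k => f k z) N) p (csum v N).
Proof.
elim: N => [|N IHN] H.
  rewrite sum_O; apply: reg_ext Rlt_0_1 _ (H 0%N _) => // z _; by rewrite sum_O.
rewrite sum_Sn; apply: reg_ext Rlt_0_1 _ (reg_plus (IHN _) (H N.+1 _)) => //.
  by move=> z _; rewrite sum_Sn.
by move=> k kN; apply: H; apply: leq_trans kN _.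
Qed.

Lemma cseries_coef0 (c : nat -> C) l : cseries (fun k => c k * Cpow 0 k)%C l -> l = c 0%N.
Proof.
move=> H; apply: (cseries_unique H).
rewrite (_ : c 0%N = csum (fun k => c k * Cpow 0 k)%C 0); last by rewrite sum_O /= Cmult_1_r.
apply: (@is_series_finite C_AbsRing C_NormedModule) => -[//|k] _.
by rewrite /= Cmult_0_l Cmult_0_r.
Qed.

Lemma reg_div f p : reg f p 0 -> exists v, reg (fun z => f z / (z - p))%C p v.
Proof.
move=> [rho [B [g [r0 [c [exc cB gc]] gp fg]]]].
have c0 : c 0%N = 0%C.
  rewrite -gp; apply/esym/cseries_coef0.
  by rewrite -(Cminus_diag p); apply: gc; rewrite Cminus_diag Cmod_0; lra.
have exc1 : ex_series (fun k => Cmod (c k.+1) * rho ^ k).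
  apply: (rex_series_ext (u := fun k => / rho * (Cmod (c k.+1) * rho ^ k.+1))).
    by move=> k /=; field; lra.
  apply: ex_series_scal_l; exact: (proj1 (ex_series_incr_1 (fun k => Cmod (c k) * rho ^ k)) exc).
pose h z := csval (fun k => c k.+1 * Cpow (z - p) k)%C.
have hP z : Cmod (z - p) <= rho -> cseries (fun k => c k.+1 * Cpow (z - p) k)%C (h z).
  move=> zp; apply: csval_abs; apply: ex_series_le_pos exc1 => k.
  exact: (@ana_coef_bound p rho (fun k => c k.+1)).
exists (h p), rho, (Series (fun k => Cmod (c k.+1) * rho ^ k)), h; split=> //.
  by exists (fun k => c k.+1); split=> //; exact: Rle_refl.
move=> z zp; rewrite fg //.
have zp0 : (z - p)%C <> 0%C by move=> E; move: zp; rewrite E Cmod_0; lra.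
have H := @cseries_scal (z - p)%C _ _ (hP z (proj2 zp)).
have H1 : cseries (fun k => c k * Cpow (z - p) k)%C ((z - p) * h z)%C.
  apply: is_series_decr_1; rewrite c0 Cmult_0_l opp_zero plus_zero_r.
  by apply: cseries_ext H => k /=; ring.
rewrite (cseries_unique (gc z (proj2 zp)) H1); by field.
Qed.

(** The geometric series around [p], on a disc of half the distance to [q]. *)
Lemma reg_inv p q : p <> q -> exists v, reg (fun z => / (z - q))%C p v.
Proof.
move=> pq.
have pq0 : (p - q)%C <> 0%C by move=> E; apply: pq; transitivity ((p - q) + q)%C; [ring|rewrite E; ring].
have d0 : 0 < Cmod (p - q)%C by apply/Cmod_gt_0.
have HG := is_series_geom (/ 2) ltac:(rewrite Rabs_pos_eq; lra).
pose d := Cmod (p - q); pose e := (- / (p - q))%C.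
have Ce : Cmod e = / d by rewrite /e Cmod_opp Cmod_inv.
exists (/ (p - q))%C, (d / 2), (Series (fun k => / d * (/ 2) ^ k)), (fun z => / (z - q))%C.
have E k : Cmod (/ (p - q) * Cpow e k)%C * (d / 2) ^ k = / d * (/ 2) ^ k.
  rewrite Cmod_mult Cmod_pow Ce Cmod_inv // Rmult_assoc -Rpow_mult_distr -/d.
  by congr (_ * _ ^ _); field; rewrite /d; lra.
have exE : ex_series (fun k => / d * (/ 2) ^ k).
  by apply: ex_series_scal_l; eexists; apply: HG.
split=> //; first by rewrite /d; lra.
exists (fun k => / (p - q) * Cpow e k)%C; split.
- by apply: rex_series_ext exE => k; rewrite E.
- by apply: Req_le; apply: Series_ext.
move=> z zp.
have exz : ex_series (fun k => Cmod (/ (p - q) * Cpow e k * Cpow (z - p) k)%C).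
  apply: ex_series_le_pos exE => k; rewrite -E.
  exact: (@ana_coef_bound p (d / 2) (fun k => / (p - q) * Cpow e k)%C).
have [l [lP _]] := cseries_abs exz.
suff -> : (/ (z - q))%C = l by [].
have l1 : (l = / (p - q) + e * (z - p) * l)%C.
  apply: (cseries_unique lP); apply: is_series_decr_1.
  rewrite /= !Cmult_1_r /plus /opp /= (_ : (/ (p - q) + e * (z - p) * l + - / (p - q) = e * (z - p) * l)%C); last by ring.
  by apply: cseries_ext (@cseries_scal (e * (z - p))%C _ _ lP) => k /=; ring.
have zq : (z - q)%C <> 0%C.
  move=> E0; have E1 : (p - q = - (z - p))%C by rewrite -[RHS]Cplus_0_r -E0; ring.
  by move: zp; rewrite -Cmod_opp -E1 -/d; move: d0; rewrite -/d; lra.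
have : ((z - q) * l = 1)%C.
  transitivity ((p - q) * (l - e * (z - p) * l))%C; first by rewrite /e; field.
  rewrite {1}l1; transitivity ((p - q) * / (p - q))%C; [ring|exact: Cinv_r].
by move=> H; rewrite -[LHS]Cmult_1_r -H; field.
Qed.

Definition simple_pole (f : C -> C) (p A : C) : Prop := reg (fun z => (z - p) * f z)%C p A.

(** * The Hurwitz series to the right of Re z = 2 *)

Section Hurwitz.
Variable x : R.
Hypothesis x_ge2 : 2 <= x.

Let y_ge2 m : 2 <= INR m + x. Proof. by have := pos_INR m; lra. Qed.

(** 1/y^2 is at most 1/(y - 1) - 1/y, which telescopes. Comparison with this one series explains the
    bound 2 on the real part; the strip between 1 and 2 is covered by the continuation. *)
Lemma ex_series_inv_sq : ex_series (fun m => Rpower (INR m + x) (Ropp 2)).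
Proof.
apply: (@ex_series_le_pos _ (fun m => / (INR m + x - 1) - / (INR m.+1 + x - 1))).
  move=> m; have := y_ge2 m; rewrite S_INR; set y := INR m + x => y2.
  split; first exact/Rlt_le/exp_pos.
  rewrite Rpower_Ropp (_ : 2 = INR 2) // Rpower_pow; last by lra.
  rewrite (_ : INR m + 1 + x - 1 = y); last by rewrite /y; ring.
  have -> : / (y - 1) - / y = / ((y - 1) * y) by field; lra.
  by apply: Rinv_le_contravar; nra.
apply: (@ex_intro _ _ (/ (x - 1))); apply/is_series_Reals/is_lim_seq_Reals.
apply: (is_lim_seq_ext (fun n => / (x - 1) - / (INR n.+1 + x - 1))).
  elim=> [|n IHn]; first by rewrite /= Rplus_0_l.
  by rewrite tech5 -IHn; ring.
suff : is_lim_seq (fun n => / (x - 1) - / (INR n.+1 + x - 1)) (/ (x - 1) - 0) by rewrite Rminus_0_r.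
apply: is_lim_seq_minus'; first exact: is_lim_seq_const.
apply: (is_lim_seq_inv _ p_infty) => //.
apply: (is_lim_seq_ext (fun n => INR n.+1 + (x - 1))); first by move=> n; ring.
apply: (is_lim_seq_plus _ _ p_infty (x - 1)) => //; last exact: is_lim_seq_const.
exact/(is_lim_seq_incr_1 INR)/is_lim_seq_INR.
Qed.

Definition hsum (z : C) : C := csval (fun m => rpow (INR m + x) z).

Let S2 := Series (fun m => Rpower (INR m + x) (Ropp 2)).

(** The factor x^(2 - s) records how [hsum] decays to the right, which is what makes the tail in
    [hstep_tail] converge. *)
Lemma Rpower_decr m s : 2 <= s ->
  0 <= Rpower (INR m + x) (- s) <= Rpower x (2 - s) * Rpower (INR m + x) (Ropp 2).
Proof.
move=> s2; split; first exact/Rlt_le/exp_pos.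
rewrite (_ : - s = (2 - s) + - 2); last by ring.
rewrite Rpower_plus; apply: Rmult_le_compat_r; first exact/Rlt_le/exp_pos.
have -> : 2 - s = - (s - 2) by ring.
rewrite !Rpower_Ropp; apply: Rinv_le_contravar; first exact: exp_pos.
by apply: Rle_Rpower_l; [lra|have := pos_INR m; lra].
Qed.

Lemma ana_hsum p rho : 0 < rho -> 2 <= Re p - rho ->
  ana hsum p rho (Rpower x (2 - (Re p - rho)) * S2).
Proof.
move=> r0 pr.
have ex : ex_series (fun m => Rpower (INR m + x) (rho - Re p)).
  apply: (@ex_series_le_pos _ (fun m => Rpower x (2 - (Re p - rho)) * Rpower (INR m + x) (Ropp 2))).
    by move=> m; have := Rpower_decr m pr; rewrite (_ : - (Re p - rho) = rho - Re p); last by ring.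
  exact/ex_series_scal_l/ex_series_inv_sq.
have := @ana_infsum p rho r0 (fun m => rpow (INR m + x)) (fun m => Rpower (INR m + x) (rho - Re p)).
move=> /(_ _ ex) H; apply: ana_le (H _).
  rewrite -Series_scal_l; apply: Series_le; last exact/ex_series_scal_l/ex_series_inv_sq.
  by move=> m; have := Rpower_decr m pr; rewrite (_ : - (Re p - rho) = rho - Re p); last by ring.
by move=> m; apply: ana_rpow => //; have := y_ge2 m; lra.
Qed.

Lemma hsum_abs z : 2 <= Re z -> ex_series (fun m => Cmod (rpow (INR m + x) z)).
Proof.
move=> z2; apply: (@ex_series_le_pos _ (fun m => Rpower x (2 - Re z) * Rpower (INR m + x) (Ropp 2))).
  by move=> m; rewrite Cmod_rpow; apply: Rpower_decr.
exact/ex_series_scal_l/ex_series_inv_sq.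
Qed.

Lemma hsum_series z : 2 <= Re z -> cseries (fun m => rpow (INR m + x) z) (hsum z).
Proof. by move=> /hsum_abs; apply: csval_abs. Qed.

Lemma Re_plus_nat z k : Re (z + RtoC (INR k))%C = Re z + INR k.
Proof. by case: z. Qed.

Lemma Re_minus_1 z : Re (z - 1)%C = Re z - 1.
Proof. by case: z. Qed.

(** The binomial series of y^(1-z) ((1 + 1/y)^(1-z) - 1); the subtracted 1 is its term of index
    0. *)
Lemma rpow_binomial z y : 2 <= y ->
  cseries (fun k => cbin (1 - z) k.+1 * rpow y (z + RtoC (INR k)))%C
    (rpow (y + 1) (z - 1) - rpow y (z - 1))%C.
Proof.
move=> y2; have y0 : 0 < y by lra.
have t01 : 0 < / y < 1 by split; [exact: Rinv_0_lt_compat|rewrite -Rinv_1; apply: Rinv_lt_contravar; lra].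
have H := @cseries_scal (rpow y (z - 1)%C) _ _ (binomial_series (s := (1 - z)%C) t01).
have E1 : (rpow y (z - 1) * Cexp ((1 - z) * ln (1 + / y)) = rpow (y + 1) (z - 1))%C.
  have -> : y + 1 = y * (1 + / y) by field; lra.
  rewrite rpow_mult //; last by lra.
  by congr (_ * _)%C; rewrite /rpow; congr Cexp; ring.
rewrite E1 in H.
apply: (@is_series_incr_1 C_AbsRing C_NormedModule
  (fun k => match k with 0%N => rpow y (z - 1) | k'.+1 => cbin (1 - z) k'.+1 * rpow y (z + RtoC (INR k')) end)%C).
rewrite /plus /= (_ : (rpow (y + 1) (z - 1) - rpow y (z - 1) + rpow y (z - 1) = rpow (y + 1) (z - 1))%C); last by ring.
apply: cseries_ext H => -[|k]; first by rewrite /= !Cmult_1_r.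
have -> : rpow y (z + RtoC (INR k))%C = (rpow y (z - 1) * RtoC ((/ y) ^ k.+1))%C.
  rewrite (_ : (z + RtoC (INR k) = (z - 1) + RtoC (INR k.+1))%C); last by rewrite S_INR RtoC_plus; ring.
  rewrite rpowD; congr (_ * _)%C.
  have := rpow_nat k.+1 y0 => E.
  have : (rpow y (RtoC (INR k.+1)) * rpow y (- RtoC (INR k.+1)) = 1)%C.
    by rewrite -rpowD Cplus_opp_r /rpow (_ : (- 0 * ln y = 0)%C) ?Cexp_0 //; ring.
  have yk' : y ^ k.+1 <> 0 by apply: pow_nonzero; lra.
  have yk : RtoC (y ^ k.+1) <> 0%C by move/RtoC_inj.
  rewrite E pow_inv (RtoC_inv _ yk') => E2.
  by rewrite -[LHS]Cmult_1_r -(Cinv_r _ yk) Cmult_assoc E2 Cmult_1_l.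
change (rpow y (z - 1) * (cbin (1 - z) k.+1 * RtoC ((/ y) ^ k.+1)) =
  cbin (1 - z) k.+1 * (rpow y (z - 1) * RtoC ((/ y) ^ k.+1)))%C.
ring.
Qed.

(** [rpow_binomial] summed over y = m + x: the differences telescope, and Fubini gathers the sums
    over [m] on the other side. *)
Lemma hsum_recurrence z : 2 < Re z ->
  ex_series (fun k => Cmod (cbin (1 - z) k.+1 * hsum (z + RtoC (INR k)))%C) /\
  cseries (fun k => cbin (1 - z) k.+1 * hsum (z + RtoC (INR k)))%C (- rpow x (z - 1))%C.
Proof.
move=> z2.
have q0 : 0 < Cmod (1 - z) + 1 by have := Cmod_ge_0 (1 - z)%C; lra.
pose q := Cmod (1 - z) + 1.
pose u m k := (cbin (1 - z) k.+1 * rpow (INR m + x) (z + RtoC (INR k)))%C.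
have exq : ex_series (fun k => rbin q k.+1 * (/ 2) ^ k).
  apply: (rex_series_ext (u := fun k => 2 * (rbin q k.+1 * (/ 2) ^ k.+1))).
    by move=> k; rewrite [(/ 2) ^ k.+1]/=; field.
  apply: ex_series_scal_l; apply: (proj1 (ex_series_incr_1 (fun k => rbin q k * (/ 2) ^ k))).
  by apply: ex_series_rbin => //; lra.
(* Here [x >= 2] enters: 1 / (m + x) is at most 1/2, which gives geometric decay in [k] uniformly in
   [m]. *)
have ub m k : 0 <= Cmod (u m k) <= Rpower (INR m + x) (- Re z) * (rbin q k.+1 * (/ 2) ^ k).
  split; first exact: Cmod_ge_0.
  rewrite Cmod_mult Cmod_rpow Re_plus_nat Ropp_plus_distr Rpower_plus.
  have H1 : Cmod (cbin (1 - z) k.+1) <= rbin q k.+1 by apply: Cmod_cbin; rewrite /q; lra.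
  have H2 : Rpower (INR m + x) (- INR k) <= (/ 2) ^ k.
    rewrite Rpower_Ropp Rpower_pow; last by have := y_ge2 m; lra.
    rewrite pow_inv; apply: Rinv_le_contravar; first by apply: pow_lt; lra.
    by apply: pow_incr; have := y_ge2 m; lra.
  have H3 := exp_pos (- Re z * ln (INR m + x)); rewrite -/(Rpower (INR m + x) (- Re z)) in H3.
  have H4 := exp_pos (- INR k * ln (INR m + x)); rewrite -/(Rpower (INR m + x) (- INR k)) in H4.
  have H5 := Cmod_ge_0 (cbin (1 - z) k.+1).
  have H6 : Cmod (cbin (1 - z) k.+1) * Rpower (INR m + x) (- INR k) <= rbin q k.+1 * (/ 2) ^ k.
    by apply: Rmult_le_compat => //; lra.
  by nra.
have exu m : ex_series (fun k => Cmod (u m k)).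
  by apply: (ex_series_le_pos (ub m)); apply: ex_series_scal_l.
have exU : ex_series (fun m => Series (fun k => Cmod (u m k))).
  apply: (@ex_series_le_pos _ (fun m => Rpower (INR m + x) (- Re z) * Series (fun k => rbin q k.+1 * (/ 2) ^ k))).
    move=> m; split.
      by apply: Rle_trans (term_le_Series 0 _ (exu m)); [exact: Cmod_ge_0|move=> k; exact: Cmod_ge_0].
    rewrite -Series_scal_l; apply: (Series_le _ _ (ub m)); exact: ex_series_scal_l.
  apply: ex_series_scal_r; have := hsum_abs (Rlt_le _ _ z2).
  by apply: rex_series_ext => m; rewrite Cmod_rpow.
have [v [T [uv exv _ ST vT]]] := fubini (fun m => Series_correct _ (exu m)) exU
  (fun m => @rpow_binomial z _ (y_ge2 m)).
have vE k : v k = (cbin (1 - z) k.+1 * hsum (z + RtoC (INR k)))%C.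
  apply: (cseries_unique (uv k)); apply: cseries_scal; apply: hsum_series.
  by rewrite Re_plus_nat; have := pos_INR k; lra.
split; first by apply: rex_series_ext exv => k; rewrite vE.
suff <- : T = (- rpow x (z - 1))%C by apply: cseries_ext vT => k; rewrite vE.
apply: (cseries_unique ST); apply: cseries_eps.
apply: (is_lim_seq_ext (fun n => Rpower (INR n.+1 + x) (- (Re z - 1)))).
  move=> n; rewrite -Re_minus_1 -Cmod_rpow; congr Cmod.
  elim: n => [|n IHn].
    by rewrite sum_O [INR 1]/= [INR 0]/= Rplus_0_l [1 + x]Rplus_comm; ring.
  rewrite sum_Sn /plus /=; rewrite (_ : match n with O => 1 | S _ => INR n + 1 end = INR n.+1) //.
  have -> : INR n.+1 + x + 1 = INR n.+2 + x by rewrite !S_INR; ring.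
  transitivity (rpow (INR n.+1 + x) (z - 1) + (rpow (INR n.+2 + x) (z - 1) - rpow (INR n.+1 + x) (z - 1)))%C; first by rewrite -!S_INR; ring.
  by rewrite IHn; ring.
have s0 : 0 < Re z - 1 by lra.
apply: (is_lim_seq_le_le (fun=> 0) _ (fun n => / (INR n.+1 + x))).
- move=> n; split; first exact/Rlt_le/exp_pos.
  rewrite Rpower_Ropp; apply: Rinv_le_contravar; first by have := y_ge2 n.+1; lra.
  rewrite -{1}(Rpower_1 (INR n.+1 + x)); last by have := y_ge2 n.+1; lra.
  by apply: Rle_Rpower; have := y_ge2 n.+1; lra.
- exact: is_lim_seq_const.
apply: (is_lim_seq_inv _ p_infty) => //.
apply: (is_lim_seq_plus _ _ p_infty x) => //; last exact: is_lim_seq_const.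
exact/(is_lim_seq_incr_1 INR)/is_lim_seq_INR.
Qed.

End Hurwitz.

(** * Continuation to the plane and the pole at 1 *)

Section HurwitzContinuation.
Variable x : R.
Hypothesis x_ge2 : 2 <= x.

Definition hstep (f : C -> C) (z : C) : C :=
  (rpow x (z - 1) + csval (fun k => cbin (1 - z) k.+2 * f (z + RtoC (INR k.+1))))%C.

(* The continuation is extended to the left one unit strip at a time by solving
   [hsum_recurrence] for its first term [(1 - z) * hsum z]. *)
Fixpoint hcont (n : nat) (z : C) : C :=
  match n with
  | 0%N => hsum x z
  | n'.+1 => if Rlt_dec 2 (Re z) then hsum x z else (hstep (hcont n') z / (z - 1))%C
  end.

(** On Re z > 2 - n the function [hcont n] has reached its final value; [up] supplies such an [n]
    for each [z]. *)
Definition hzeta (z : C) : C := hcont (Z.to_nat (up (2 - Re z))) z.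

Lemma hcont_right n z : 2 < Re z -> hcont n z = hsum x z.
Proof. by case: n => [//|n] z2 /=; case: Rlt_dec. Qed.

Lemma hcont_left n z : ~ 2 < Re z -> hcont n.+1 z = (hstep (hcont n) z / (z - 1))%C.
Proof. by move=> z2; rewrite [LHS]/=; case: Rlt_dec. Qed.

Lemma hcontS n z : 2 - INR n < Re z -> hcont n.+1 z = hcont n z.
Proof.
elim: n z => [|n IHn] z nz.
  by apply: hcont_right; move: nz; rewrite /= ; lra.
rewrite [LHS]/= [RHS]/=; case: Rlt_dec => // z2.
congr (_ / _)%C; congr (_ + _)%C; apply: csval_ext => k; congr (_ * _)%C.
change ((if Rlt_dec 2 (Re (z + RtoC (INR k.+1))%C) then hsum x (z + RtoC (INR k.+1))
  else hstep (hcont n) (z + RtoC (INR k.+1)) / (z + RtoC (INR k.+1) - 1))%C = hcont n (z + RtoC (INR k.+1))%C).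
apply: IHn; rewrite Re_plus_nat; move: nz; rewrite !S_INR; have := pos_INR k; lra.
Qed.

Lemma hcont_stable n m z : 2 - INR n < Re z -> (n <= m)%N -> hcont m z = hcont n z.
Proof.
move=> nz /subnKC <-; elim: (m - n)%N => [|d IHd]; first by rewrite addn0.
rewrite addnS hcontS // plus_INR; have := pos_INR d; lra.
Qed.

Lemma hzetaE n z : 2 - INR n < Re z -> hzeta z = hcont n z.
Proof.
move=> nz; rewrite /hzeta; set N := Z.to_nat _.
have Nz : 2 - INR N < Re z.
  have [up1 _] := archimed (2 - Re z).
  case: (Z_lt_le_dec (up (2 - Re z)) 0) => [neg|pos].
    by have := pos_INR N; have := IZR_lt _ _ neg; lra.
  by rewrite /N INR_IZR_INZ Znat.Z2Nat.id //; lra.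
case: (leqP n N) => [|/ltnW] le; first exact: hcont_stable.
exact/esym/hcont_stable.
Qed.

Lemma hzeta_right z : 2 < Re z -> hzeta z = hsum x z.
Proof. by move=> z2; rewrite (@hzetaE 0) //=; lra. Qed.

Lemma hzeta_step z : z <> RtoC 1 -> ((z - 1) * hzeta z = hstep hzeta z)%C.
Proof.
move=> z1; have z10 : (z - 1)%C <> 0%C.
  by move=> E; apply: z1; transitivity (z - 1 + 1)%C; [ring|rewrite E; ring].
case: (Rlt_dec 2 (Re z)) => z2.
  rewrite hzeta_right //; have [ex H] := hsum_recurrence x_ge2 z2.
  rewrite /hstep (csvalE (l := - rpow x (z - 1) + (z - 1) * hsum x z)%C); first by ring.
  apply: (@is_series_incr_1 C_AbsRing C_NormedModule (fun k => cbin (1 - z) k.+1 * hzeta (z + RtoC (INR k)))%C).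
  rewrite /plus /= (_ : (- rpow x (z - 1) + (z - 1) * hsum x z + 1 * ((1 - z - 0) / 1) * hzeta (z + 0) = - rpow x (z - 1))%C).
    apply: cseries_ext H => k; rewrite hzeta_right //.
    by rewrite Re_plus_nat; have := pos_INR k; lra.
  by rewrite Cplus_0_r hzeta_right //; field.
have [n nz] : exists n, 2 - INR n < Re z.
  have [n nP] := INR_unbounded (2 - Re z); exists n; lra.
rewrite (@hzetaE n.+1); last by rewrite S_INR; lra.
rewrite hcont_left //; transitivity (hstep (hcont n) z); first by field.
congr (_ + _)%C; apply: csval_ext => k; congr (_ * _)%C.
apply/esym/hzetaE; rewrite -/(INR k.+1) Re_plus_nat; have := pos_INR k.+1; lra.
Qed.

Lemma cbin_vanish n k : (n < k)%N -> cbin (RtoC (INR n)) k = 0%C.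
Proof.
elim: k => // k IHk; rewrite ltnS leq_eqVlt cbinS => /orP[/eqP<-|/IHk ->].
  by rewrite Cminus_diag /Cdiv Cmult_0_l Cmult_0_r.
by rewrite Cmult_0_l.
Qed.

Lemma reg_cbin k p : reg (fun z => cbin (1 - z)%C k) p (cbin (1 - p)%C k).
Proof. exact: (@reg_of_ana (fun z => cbin (1 - z)%C k) _ _ _ Rlt_0_1 (ana_cbin p k Rlt_0_1)). Qed.

Lemma cseries_split (u : nat -> C) N l :
  cseries (fun k => u (N.+1 + k)%N) l -> cseries u (csum u N + l)%C.
Proof.
move=> H; apply: (@is_series_decr_n C_AbsRing C_NormedModule u N.+1); first by lia.
by rewrite /plus /opp /= (_ : (csum u N + l + - csum u N = l)%C) //; ring.
Qed.

Section Tail.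
Variables (p : C) (N : nat).
Hypothesis pN : 2 < Re p + INR N - / 2.

Let tail (z : C) : C := csval (fun k => cbin (1 - z) (N.+1 + k).+2 * hsum x (z + RtoC (INR (N.+1 + k).+1)))%C.

Let q := Cmod p + / 2 + 1.
Let S2 := Series (fun m => Rpower (INR m + x) (Ropp 2)).
Let B k := rbin q (N.+1 + k).+2 * (Rpower x (2 - (Re p + INR (N.+1 + k).+1 - / 2)) * S2).

Let f k z := (cbin (1 - z) (N.+1 + k).+2 * hsum x (z + RtoC (INR (N.+1 + k).+1)))%C.

Let f_ana k : ana (f k) p (/ 2) (B k).
Proof.
have h : 0 < / 2 by lra.
apply: ana_mult => //; first exact: ana_cbin.
apply: ana_shift; rewrite -Re_plus_nat; apply: ana_hsum => //.
rewrite Re_plus_nat S_INR plus_INR S_INR; have := pos_INR k; lra.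
Qed.

Let B_ex : ex_series B.
Proof.
pose c := rbin q; pose E := Rpower x (2 - (Re p - / 2) + 1) * S2.
apply: (rex_series_ext (u := fun k => E * (c (N.+3 + k)%coq_nat * (/ x) ^ (N.+3 + k)%coq_nat))).
  move=> k; rewrite /B /E /c (_ : (N.+3 + k)%coq_nat = (N.+1 + k).+2); last by lia.
  set M := (N.+1 + k)%N.
  have -> : 2 - (Re p + INR M.+1 - / 2) = (2 - (Re p - / 2) + 1) + - INR M.+2 by rewrite !S_INR; ring.
  rewrite (Rpower_plus _ (- INR M.+2)) Rpower_Ropp Rpower_pow; last by lra.
  by rewrite pow_inv; ring.
apply: ex_series_scal_l; apply: (proj1 (ex_series_incr_n (fun k => c k * (/ x) ^ k) N.+3)).
apply: ex_series_rbin; first by rewrite /q; have := Cmod_ge_0 p; lra.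
split; first by apply: Rinv_0_lt_compat; lra.
by rewrite -Rinv_1; apply: Rinv_lt_contravar; lra.
Qed.

(** By the choice of [N], all arguments of [hzeta] in the tail have real part above 2 near [p], so
    the tail is an analytic sum of [hsum] terms. At p = 1 every coefficient is a binomial of 0 and
    vanishes. *)
Lemma hstep_tail : exists g, [/\ reg g p (g p),
  p = RtoC 1 -> g p = 0%C &
  forall z, Cmod (z - p) <= / 2 ->
    cseries (fun k => cbin (1 - z) (N.+1 + k).+2 * hzeta (z + RtoC (INR (N.+1 + k).+1)))%C (g z)].
Proof.
have h : 0 < / 2 by lra.
exists tail; split.
- exact: reg_of_ana h (ana_infsum h f_ana B_ex).
- move=> ->; apply: csvalE; rewrite (_ : (1 - 1)%C = RtoC (INR 0)); last exact: Cminus_diag.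
  apply: (cseries_ext (u := fun=> 0%C)); first by move=> k; rewrite cbin_vanish // Cmult_0_l.
  have := @is_series_finite C_AbsRing C_NormedModule (fun=> RtoC 0) 0 (fun _ _ => erefl).
  by rewrite sum_O.
move=> z zp; have := csval_abs (ana_abs f_ana B_ex zp).
apply: cseries_ext => k; rewrite /f hzeta_right // Re_plus_nat.
have : Rabs (Re (z - p)%C) <= / 2 by apply: Rle_trans (Re_le_Cmod _) zp.
rewrite (_ : Re (z - p)%C = Re z - Re p); last by case: (z) (p) => ? ? [].
move=> /Rabs_le_between; rewrite S_INR plus_INR S_INR; have := pos_INR k; lra.
Qed.

End Tail.

Lemma punctured z p : 0 < Cmod (z - p)%C -> (z - p)%C <> 0%C.
Proof. by move=> H E; move: H; rewrite E Cmod_0; lra. Qed.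

Lemma Cminus_neq0 z p : z <> p -> (z - p)%C <> 0%C.
Proof. by move=> zp E; apply: zp; transitivity (z - p + p)%C; [ring|rewrite E; ring]. Qed.

(** The only danger is the pole of [hzeta (z + k + 1)] at z = - k, where the binomial of 1 - z = k +
    1 over k + 2 has a zero that cancels it. At p = 1 all binomials vanish, and x^0 = 1 remains:
    this is the residue of [hzeta]. *)
Lemma hstep_reg n p :
  (forall p, 2 - INR n < Re p ->
    (p <> RtoC 1 -> exists v, reg hzeta p v) /\ (p = RtoC 1 -> simple_pole hzeta p 1)) ->
  2 - INR n.+1 < Re p ->
  exists v, reg (hstep hzeta) p v /\ (p = RtoC 1 -> v = RtoC 1).
Proof.
move=> IH np.
have [N pN] : exists N, 2 < Re p + INR N - / 2.
  by have [N NP] := INR_unbounded (2 - Re p + / 2); exists N; lra.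
have [g [rg g1 gP]] := hstep_tail pN.
have term k : exists v, reg (fun z => cbin (1 - z) k.+2 * hzeta (z + RtoC (INR k.+1)))%C p v /\
    (p = RtoC 1 -> v = 0%C).
  have [IH1 IH2] : (p + RtoC (INR k.+1) <> RtoC 1 -> exists v, reg hzeta (p + RtoC (INR k.+1)) v)%C /\
      (p + RtoC (INR k.+1) = RtoC 1 -> simple_pole hzeta (p + RtoC (INR k.+1)) 1)%C.
    by apply: IH; rewrite Re_plus_nat; move: np; rewrite !S_INR; have := pos_INR k; lra.
  case: (pselect (p + RtoC (INR k.+1) = RtoC 1)%C) => [pk|/IH1[v rv]]; last first.
    exists (cbin (1 - p) k.+2 * v)%C; split; first exact: reg_mult (reg_cbin _ _) (reg_shift rv).
    move=> ->; rewrite (_ : (1 - 1)%C = RtoC (INR 0)); last exact: Cminus_diag.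
    by rewrite cbin_vanish // Cmult_0_l.
  have cb0 : cbin (1 - p) k.+2 = 0%C.
    by rewrite (_ : (1 - p)%C = RtoC (INR k.+1)) ?cbin_vanish // -pk; ring.
  have := reg_cbin k.+2 p; rewrite cb0 => /reg_div[v rv].
  exists (v * 1)%C; split; last first.
    move=> p1; move: pk; rewrite p1 => E.
    have /RtoC_inj : RtoC (INR k.+1) = 0%C.
      by transitivity (1 + RtoC (INR k.+1) - 1)%C; [ring|rewrite E; ring].
    by rewrite S_INR; have := pos_INR k; lra.
  have := reg_mult rv (reg_shift (IH2 pk)).
  apply: reg_ext Rlt_0_1 _ => z [/punctured zp _].
  rewrite (_ : z + RtoC (INR k.+1) - (p + RtoC (INR k.+1)) = z - p)%C; last by ring.
  by field.
pose v k := sval (cid (term k)).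
have vP k : reg (fun z => cbin (1 - z) k.+2 * hzeta (z + RtoC (INR k.+1)))%C p (v k) /\
    (p = RtoC 1 -> v k = 0%C).
  by rewrite /v; case: cid.
exists (rpow x (p - 1) + (csum v N + g p))%C; split.
  have r1 : reg (fun z => rpow x (z - 1)) p (rpow x (p - 1)%C).
    exact: (@reg_shift (rpow x) p (- (1))%C _ (reg_rpow x _)).
  have r2 := reg_csum (fun k (_ : (k <= N)%N) => proj1 (vP k)).
  apply: (@reg_ext _ _ _ _ (/ 2) _ _ (reg_plus r1 (reg_plus r2 rg))); first by lra.
  move=> z [_ zp]; rewrite /hstep; congr (_ + _)%C; apply/esym/csvalE.
  exact: cseries_split (gP z zp).
move=> p1; rewrite g1 // p1 Cminus_diag Cplus_0_r.
rewrite (_ : csum v N = RtoC 0); last first.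
  elim: N {pN g rg g1 gP} => [|N IHN]; first by rewrite sum_O; apply: (proj2 (vP _)).
  by rewrite sum_Sn IHN (proj2 (vP _) p1) /plus /= Cplus_0_r.
by rewrite Cplus_0_r /rpow (_ : (- 0 * ln x = 0)%C) ?Cexp_0 //; ring.
Qed.

Theorem hzeta_pole p :
  (p <> RtoC 1 -> exists v, reg hzeta p v) /\ (p = RtoC 1 -> simple_pole hzeta p 1).
Proof.
have [n np] : exists n, 2 - INR n < Re p.
  by have [n nP] := INR_unbounded (2 - Re p); exists n; lra.
elim: n p np => [|n IHn] p np.
  have p2 : 2 < Re p by move: np; rewrite /=; lra.
  split; last by move=> E; move: p2; rewrite E /=; lra.
  move=> _; pose rho := (Re p - 2) / 2.
  have r0 : 0 < rho by rewrite /rho; lra.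
  have H : 2 <= Re p - rho by rewrite /rho; lra.
  exists (hsum x p); apply: reg_ext r0 _ (reg_of_ana r0 (ana_hsum x_ge2 r0 H)) => z [_ zp].
  rewrite hzeta_right //.
  have : Rabs (Re (z - p)%C) <= rho by apply: Rle_trans (Re_le_Cmod _) zp.
  rewrite (_ : Re (z - p)%C = Re z - Re p); last by case: (z) (p) => ? ? [].
  by move=> /Rabs_le_between; rewrite /rho; lra.
have [v [rv v1]] := hstep_reg IHn np; split=> [p1|p1].
  have [w rw] := reg_inv p1; exists (v * w)%C.
  have d0 : 0 < Cmod (p - 1)%C by apply/Cmod_gt_0/Cminus_neq0.
  apply: (@reg_ext _ _ _ _ (Cmod (p - 1) / 2) _ _ (reg_mult rv rw)); first by lra.
  move=> z [_ zp]; have z1 : z <> RtoC 1.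
    move=> E; move: zp; rewrite E -Cmod_opp (_ : (- (1 - p) = p - 1)%C); [lra|ring].
  by rewrite -hzeta_step //; field; apply: Cminus_neq0.
rewrite (v1 p1) in rv; apply: reg_ext Rlt_0_1 _ rv => z [zp _].
rewrite p1 hzeta_step // => E; move: zp; rewrite p1 E Cminus_diag Cmod_0; lra.
Qed.

Lemma hzeta_series z : 2 < Re z ->
  ex_series (fun m => Cmod (rpow (INR m + x) z)) /\ cseries (fun m => rpow (INR m + x) z) (hzeta z).
Proof.
move=> z2; split; first by apply: hsum_abs => //; lra.
by rewrite hzeta_right //; apply: hsum_series => //; lra.
Qed.

End HurwitzContinuation.

(** * Residues of a meromorphic continuation *)

Lemma is_pseriesC (c : nat -> C) (w l : C) :
  is_pseries (K := C_AbsRing) (V := C_NormedModule) c w l <->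
  cseries (fun k => c k * Cpow w k)%C l.
Proof.
have pE : forall k, pow_n (K := C_AbsRing) w k = Cpow w k.
  by elim=> [|k IHk] //=; rewrite /mult /= IHk.
have E k : scal (pow_n (K := C_AbsRing) w k) (c k) = (c k * Cpow w k)%C.
  by rewrite pE /scal /= /mult /= Cmult_comm.
by split; apply: is_series_ext => k; rewrite E.
Qed.

Lemma simple_pole_laurent f p A : simple_pole f p A ->
  exists2 c, laurent_expansion f p 1 c & c 0%N = A.
Proof.
move=> [rho [B [g [r0 [c [_ _ gc]] gp fg]]]]; exists c.
  exists rho; split=> // z [z0 zr]; apply/is_pseriesC.
  by rewrite /= Cmult_1_r fg; [apply: gc|]; lra.
rewrite -gp; apply/esym/cseries_coef0.
by rewrite -(Cminus_diag p); apply: gc; rewrite Cminus_diag Cmod_0; lra.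
Qed.

Lemma simple_pole_meromorphic f : (forall p, exists A, simple_pole f p A) -> meromorphic f.
Proof.
by move=> H p; have [A /simple_pole_laurent[c cP _]] := H p; exists 1%N, c.
Qed.

Lemma simple_pole_residue f p A : simple_pole f p A -> is_residue f p A.
Proof. by move=> /simple_pole_laurent[c cP cA]; exists 0%N, c. Qed.

Lemma reg_simple_pole f p v : reg f p v -> simple_pole f p 0.
Proof.
move=> rf; have r1 := reg_plus (reg_id p) (reg_const (- p) p)%C.
have := reg_mult r1 rf; rewrite Cplus_opp_r Cmult_0_l.
by apply: reg_ext Rlt_0_1 _ => z _.
Qed.

Lemma simple_pole_plus f g p A B : simple_pole f p A -> simple_pole g p B ->
  simple_pole (fun z => f z + g z)%C p (A + B)%C.
Proof.
move=> rf rg; apply: reg_ext Rlt_0_1 _ (reg_plus rf rg) => z _ /=; ring.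
Qed.

Lemma simple_pole_mult f g p v A : reg f p v -> simple_pole g p A ->
  simple_pole (fun z => f z * g z)%C p (v * A)%C.
Proof.
move=> rf rg; apply: reg_ext Rlt_0_1 _ (reg_mult rf rg) => z _ /=; ring.
Qed.

Lemma simple_pole_shift f p s A : simple_pole f (p + s)%C A ->
  simple_pole (fun z => f (z + s)%C) p A.
Proof.
move=> /reg_shift; apply: reg_ext Rlt_0_1 _ => z _.
by rewrite (_ : z + s - (p + s) = z - p)%C //; ring.
Qed.

(** * The identity theorem *)

Lemma pseries_lipschitz (d : nat -> C) (u l : C) rho : 0 < rho ->
  ex_series (fun j => Cmod (d j) * rho ^ j) -> Cmod u <= rho ->
  cseries (fun j => d j * Cpow u j)%C l ->
  Cmod (l - d 0%N)%C <= Cmod u * (/ rho * Series (fun j => Cmod (d j) * rho ^ j)).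
Proof.
move=> r0 exd ur H.
have pos j : 0 <= Cmod (d j) * rho ^ j by apply: Rmult_le_pos; [exact: Cmod_ge_0|apply: pow_le; lra].
have H1 : cseries (fun j => d j.+1 * Cpow u j.+1)%C (l - d 0%N)%C.
  apply: (@is_series_incr_1 C_AbsRing C_NormedModule (fun j => d j * Cpow u j)%C).
  by rewrite /plus /= Cmult_1_r (_ : (l - d 0%N + d 0%N = l)%C) //; ring.
have b j : 0 <= Cmod (d j.+1 * Cpow u j.+1)%C <= Cmod u * (/ rho * (Cmod (d j.+1) * rho ^ j.+1)).
  split; first exact: Cmod_ge_0.
  rewrite Cmod_mult Cmod_pow -!tech_pow_Rmult.
  have -> : Cmod u * (/ rho * (Cmod (d j.+1) * (rho * rho ^ j))) = Cmod (d j.+1) * (Cmod u * rho ^ j).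
    by field; lra.
  apply: Rmult_le_compat_l; first exact: Cmod_ge_0.
  apply: Rmult_le_compat_l; first exact: Cmod_ge_0.
  by apply: pow_incr; split=> //; apply: Cmod_ge_0.
have exd1 : ex_series (fun j => Cmod (d j.+1) * rho ^ j.+1).
  exact: (proj1 (ex_series_incr_1 (fun j => Cmod (d j) * rho ^ j))).
have exb : ex_series (fun j => Cmod u * (/ rho * (Cmod (d j.+1) * rho ^ j.+1))).
  by do 2! apply: ex_series_scal_l.
apply: Rle_trans (cseries_abs_le (ex_series_le_pos b exb) H1) _.
apply: Rle_trans (Series_le _ _ b exb) _; rewrite !Series_scal_l.
apply: Rmult_le_compat_l; first exact: Cmod_ge_0.
apply: Rmult_le_compat_l; first by apply/Rlt_le/Rinv_0_lt_compat.
by rewrite (Series_incr_1 _ exd); have := pos 0%N; lra.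
Qed.

Lemma pseries_abs (c : nat -> C) (w l : C) : w <> 0%C ->
  cseries (fun k => c k * Cpow w k)%C l ->
  ex_series (fun k => Cmod (c k) * (Cmod w / 2) ^ k).
Proof.
move=> w0 H; have d0 : 0 < Cmod w by apply/Cmod_gt_0.
have [M MP] : exists M, forall k, Cmod (c k * Cpow w k)%C <= M.
  have [M MP] := @filterlim_bounded C_AbsRing C_NormedModule _ (ex_intro _ l H).
  exists (M + M) => k.
  have M0 n : Cmod (csum (fun k => c k * Cpow w k)%C n) <= M by exact: MP.
  case: k => [|k]; first by have := M0 0%N; rewrite sum_O; have := Cmod_ge_0 (c 0%N * Cpow w 0)%C; lra.
  have -> : (c k.+1 * Cpow w k.+1 = csum (fun k => c k * Cpow w k) k.+1 - csum (fun k => c k * Cpow w k) k)%C.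
    by rewrite sum_Sn /plus /=; ring.
  apply: Rle_trans (Cmod_triangle _ _) _; rewrite Cmod_opp.
  by have := M0 k; have := M0 k.+1; lra.
have geo := is_series_geom (/ 2) ltac:(rewrite Rabs_pos_eq; lra).
apply: (@ex_series_le_pos _ (fun k => M * (/ 2) ^ k)); last first.
  by apply: ex_series_scal_l; eexists; apply: geo.
move=> k; have h : 0 <= (/ 2) ^ k by apply: pow_le; lra.
rewrite Rpow_mult_distr -Rmult_assoc -Cmod_pow -Cmod_mult; split.
  by apply: Rmult_le_pos => //; apply: Cmod_ge_0.
exact: Rmult_le_compat_r.
Qed.

(** Once the lower coefficients vanish, u^k splits off, and at a small zero [u] the remaining series
    shows that |c_k| is at most a constant times |u|. *)
Lemma pseries_isolated_zeros (c : nat -> C) (F : C -> C) eps : 0 < eps ->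
  (forall u, 0 < Cmod u < eps -> cseries (fun k => c k * Cpow u k)%C (F u)) ->
  (forall delta, 0 < delta -> exists2 u, 0 < Cmod u < delta & F u = 0%C) ->
  forall k, c k = 0%C.
Proof.
move=> e0 cF zeros.
have exc : ex_series (fun k => Cmod (c k) * (eps / 4) ^ k).
  have e2 : Cmod (RtoC (eps / 2)) = eps / 2 by rewrite Cmod_R Rabs_pos_eq; lra.
  have := @pseries_abs c (RtoC (eps / 2)) _ _ (cF _ _).
  rewrite e2 (_ : eps / 2 / 2 = eps / 4); last by field.
  by apply; [move/RtoC_inj; lra|lra].
pose rho := eps / 4; have r0 : 0 < rho by rewrite /rho; lra.
elim/ltn_ind => k IHk.
have exck : ex_series (fun j => Cmod (c (k + j)%N) * rho ^ j).
  apply: (rex_series_ext (u := fun j => / rho ^ k * (Cmod (c (k + j)%N) * rho ^ (k + j)%N))).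
    move=> j; rewrite pow_add; field; apply: pow_nonzero; lra.
  apply: ex_series_scal_l.
  exact: (proj1 (ex_series_incr_n (fun j => Cmod (c j) * rho ^ j) k) exc).
pose B := / rho * Series (fun j => Cmod (c (k + j)%N) * rho ^ j).
have B0 : 0 <= B.
  apply: Rmult_le_pos; first by apply/Rlt_le/Rinv_0_lt_compat.
  apply: Rle_trans (term_le_Series 0 _ exck).
    by apply: Rmult_le_pos; [exact: Cmod_ge_0|apply: pow_le; lra].
  by move=> j; apply: Rmult_le_pos; [exact: Cmod_ge_0|apply: pow_le; lra].
suff small delta : 0 < delta -> Cmod (c k) <= delta.
  apply: Cmod_eq_0; apply: Rle_antisym; last exact: Cmod_ge_0.
  by apply: Rnot_lt_le => H; have := small (Cmod (c k) / 2) ltac:(lra); lra.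
move=> dl0; have [|u [u0 ud] Fu] := zeros (Rmin rho (delta / (B + 1))).
  by apply: Rmin_pos => //; apply: Rdiv_lt_0_compat; lra.
have ur : Cmod u < rho by apply: Rlt_le_trans ud (Rmin_l _ _).
have uB : Cmod u * (B + 1) < delta.
  have := Rlt_le_trans _ _ _ ud (Rmin_r _ _) => H.
  apply: Rlt_le_trans (Rmult_lt_compat_r (B + 1) _ _ _ H) _; first lra.
  by apply: Req_le; field; lra.
have uk : Cpow u k <> 0%C by apply: Cpow_nz; apply/Cmod_gt_0.
have H0 : cseries (fun j => c (k + j)%N * Cpow u j)%C (RtoC 0).
  have H : cseries (fun j => c j * Cpow u j)%C (RtoC 0) by rewrite -Fu; apply: cF; rewrite /rho in ur; lra.
  have H1 : cseries (fun j => c (k + j)%N * Cpow u (k + j)%N)%C (RtoC 0).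
    case: k IHk {exck B B0 uB uk ud} => [|k] IHk; first by [].
    apply: (@is_series_incr_n C_AbsRing C_NormedModule (fun j => c j * Cpow u j)%C k.+1); first by lia.
    rewrite (_ : plus _ _ = RtoC 0) // (_ : sum_n _ _ = RtoC 0); first by rewrite /plus /= Cplus_0_r.
    elim: k IHk => [|k IHk'] IHk; first by rewrite sum_O IHk // Cmult_0_l.
    rewrite sum_Sn IHk'; last by move=> m mk; apply: IHk; lia.
    by rewrite IHk // Cmult_0_l /plus /= Cplus_0_r.
  rewrite -(Cmult_0_r (/ Cpow u k)); apply: cseries_ext (@cseries_scal (/ Cpow u k)%C _ _ H1) => j.
  by rewrite -plusE Cpow_add_r plusE; field.
have := pseries_lipschitz r0 exck (Rlt_le _ _ ur) H0.
rewrite addn0 -Cmod_opp (_ : (- (0 - c k) = c k)%C); last by ring.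
by rewrite -/B; have := Cmod_ge_0 u; nra.
Qed.

Lemma cseries_shift (c : nat -> C) (u l : C) m : cseries (fun k => c k * Cpow u k)%C l ->
  cseries (fun k => (if (m <= k)%N then c (k - m)%N else RtoC 0) * Cpow u k)%C (Cpow u m * l)%C.
Proof.
move=> H; have := @is_series_delay C_AbsRing C_NormedModule _ _ m (@cseries_scal (Cpow u m) _ _ H).
apply: cseries_ext => k; case: ifP => mk; last by rewrite Cmult_0_l.
have -> : Cpow u k = (Cpow u m * Cpow u (k - m)%N)%C by rewrite -Cpow_add_r plusE subnKC.
ring.
Qed.

Definition punctured_zero (D : C -> C) (p : C) : Prop :=
  exists2 eps, 0 < eps & forall z, 0 < Cmod (z - p)%C < eps -> D z = 0%C.

Lemma laurent_isolated_zeros (D : C -> C) p m c : laurent_expansion D p m c ->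
  (forall delta, 0 < delta -> exists2 z, 0 < Cmod (z - p)%C < delta & D z = 0%C) ->
  punctured_zero D p.
Proof.
move=> [eps [e0 cP]] zeros; exists eps => // z zp.
have c0 : forall k, c k = 0%C.
  apply: (@pseries_isolated_zeros c (fun u => Cpow u m * D (p + u))%C eps e0).
    move=> u ue; apply/is_pseriesC; have E : (p + u - p = u)%C by ring.
    by have := cP (p + u)%C; rewrite E; apply.
  move=> delta /zeros[z' zp' Dz']; exists (z' - p)%C => //.
  by rewrite (_ : (p + (z' - p) = z')%C) ?Dz' ?Cmult_0_r //; ring.
have /is_pseriesC H := cP z zp.
have E : (Cpow (z - p) m * D z = 0)%C.
  apply: (cseries_unique H); apply: (cseries_ext (u := fun=> RtoC 0)).
    by move=> k; rewrite c0 Cmult_0_l.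
  have := @is_series_finite C_AbsRing C_NormedModule (fun=> RtoC 0) 0 (fun _ _ => erefl).
  by rewrite sum_O.
have zm : Cpow (z - p) m <> 0%C by apply: Cpow_nz; apply/Cmod_gt_0; case: zp.
by rewrite -[LHS]Cmult_1_l -(Cinv_l _ zm) -Cmult_assoc E Cmult_0_r.
Qed.

(* Analytic continuation along the real axis. *)
Lemma meromorphic_zero (D : C -> C) sigma : meromorphic D ->
  (forall z, sigma < Re z -> D z = 0%C) -> forall t : R, punctured_zero D t.
Proof.
move=> mD D0.
have dist (z : C) (t : R) : Rabs (Re z - t) <= Cmod (z - t)%C.
  by apply: Rle_trans (Re_le_Cmod _); apply: Req_le; congr Rabs; case: z.
have right t : sigma < t -> punctured_zero D t.
  move=> st; exists (t - sigma); first lra.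
  move=> z [_ zt]; apply: D0; have := dist z t; move=> H.
  by have := Rle_lt_trans _ _ _ H zt => /Rabs_def2; lra.
move=> t0; apply: contrapT => nG.
pose E (t : R) := ~ punctured_zero D t.
(* [s] is the supremum of the bad real points. Zeros just to its right accumulate at [s], so [D]
   vanishes on a punctured disc around [s], and the points slightly to the left of [s] are good as
   well. *)
have [s [ub lub]] : {s | is_lub E s}.
  apply: completeness; last by exists t0.
  by exists sigma => t Et; apply: Rnot_lt_le => st; apply: Et; apply: right.
have above t : s < t -> punctured_zero D t.
  by move=> st; apply: contrapT => Et; have := ub t Et; lra.
have [m [c cP]] := mD s.
have [e e0 eP] : punctured_zero D s.
  apply: laurent_isolated_zeros cP _ => delta d0.
  have [|e e0 eP] := above (s + delta / 2); first lra.
  pose t := Rmin e delta / 4.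
  have m0 : 0 < Rmin e delta by apply: Rmin_pos.
  have me := Rmin_l e delta; have md := Rmin_r e delta.
  have dR (a b : R) : Cmod (a - b)%C = Rabs (a - b) by rewrite -RtoC_minus Cmod_R.
  exists (RtoC (s + delta / 2 + t)).
    by rewrite dR Rabs_pos_eq /t; lra.
  by apply: eP; rewrite dR Rabs_pos_eq /t; lra.
have [t [Et st]] : exists t, E t /\ s - e < t.
  apply: contrapT => H; have := lub (s - e); move=> /(_ _) H2; suff : s <= s - e by lra.
  by apply: H2 => t Et; apply: Rnot_lt_le => lt; apply: H; exists t.
case: (Req_dec t s) => [ts|ts]; first by apply: Et; rewrite ts; exists e.
have tls := ub t Et.
apply: Et; exists (Rmin (s - t) (t - (s - e))); first by apply: Rmin_pos; lra.
move=> z [z0 zt]; apply: eP.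
have m1 := Rmin_l (s - t) (t - (s - e)); have m2 := Rmin_r (s - t) (t - (s - e)).
split.
  have H1 := dist z t; have H2 := dist z s.
  apply: Rlt_le_trans H2; have := Rle_lt_trans _ _ _ H1 (Rlt_le_trans _ _ _ zt m1).
  by move=> /Rabs_def2 H3; apply: Rabs_pos_lt; lra.
have -> : (z - s = (z - t) + RtoC (t - s))%C by rewrite RtoC_minus; ring.
have ts' : Cmod (RtoC (t - s)) = s - t by rewrite Cmod_R Rabs_left1; lra.
apply: Rle_lt_trans (Cmod_triangle _ _) _; rewrite ts'.
have := Rlt_le_trans _ _ _ zt m2; lra.
Qed.

Lemma meromorphic_minus_simple (Z F : C -> C) : meromorphic Z ->
  (forall p, exists A, simple_pole F p A) -> meromorphic (fun z => Z z - F z)%C.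
Proof.
move=> mZ sF p; have [m [c [e [e0 cP]]]] := mZ p.
have [A /simple_pole_laurent[c' [e' [e0' cP']] _]] := sF p.
exists m.+1, (fun k => (if (1 <= k)%N then c (k - 1)%N else RtoC 0)
  + - RtoC 1 * (if (m <= k)%N then c' (k - m)%N else RtoC 0))%C.
exists (Rmin e e'); split; first exact: Rmin_pos.
move=> z [z0 zr]; apply/is_pseriesC.
have /is_pseriesC/(@cseries_shift _ _ _ 1) H1 := cP z (conj z0 (Rlt_le_trans _ _ _ zr (Rmin_l _ _))).
have /is_pseriesC/(@cseries_shift _ _ _ m) H2 := cP' z (conj z0 (Rlt_le_trans _ _ _ zr (Rmin_r _ _))).
have := cseries_plus H1 (@cseries_scal (- RtoC 1)%C _ _ H2).
rewrite (_ : (Cpow (z - p) 1 * (Cpow (z - p) m * Z z)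
    + - RtoC 1 * (Cpow (z - p) m * (Cpow (z - p) 1 * F z))
    = Cpow (z - p) m.+1 * (Z z - F z))%C); last by rewrite /=; ring.
apply: cseries_ext => k; ring.
Qed.

(** Residues are wanted at real points only, so it is enough that Z - F vanishes around them; [Z]
    then inherits the simple pole of [F]. *)
Theorem residue_of_continuation (Z F : C -> C) sigma (t : R) A : meromorphic Z ->
  (forall p, exists A, simple_pole F p A) ->
  (forall z, sigma < Re z -> Z z = F z) ->
  simple_pole F t A -> is_residue Z t A.
Proof.
move=> mZ sF ZF st.
have [|e e0 eP] := meromorphic_zero (sigma := sigma) (meromorphic_minus_simple mZ sF) _ t.
  by move=> z /ZF ->; apply: Cminus_diag.
apply: simple_pole_residue; apply: (@reg_ext _ _ _ _ (e / 2) _ _ st); first lra.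
move=> z zt; have := eP z ltac:(lra) => H.
by rewrite (_ : Z z = F z) //; transitivity (Z z - F z + F z)%C; [ring|rewrite H; ring].
Qed.

(** * Hilbert functions as quasipolynomials *)

Section FormalPowerSeries.

Local Open Scope ring_scope.
Import GRing.Theory Num.Theory ring.

Definition fps : Type := nat -> R.

Implicit Types (f g h e : fps) (p q : {poly R}).

HB.instance Definition _ := gen_eqMixin fps.
HB.instance Definition _ := gen_choiceMixin fps.

Lemma fpsP f g : f =1 g -> f = g. Proof. exact: funext. Qed.

Definition fps_add f g : fps := fun n => f n + g n.
Definition fps_opp f : fps := fun n => - f n.
Definition fps_zero : fps := fun=> 0.

Fact fps_addA : associative fps_add. Proof. by move=> f g h; apply: fpsP => n; apply: addrA. Qed.
Fact fps_addC : commutative fps_add. Proof. by move=> f g; apply: fpsP => n; apply: addrC. Qed.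
Fact fps_add0 : left_id fps_zero fps_add. Proof. by move=> f; apply: fpsP => n; apply: add0r. Qed.
Fact fps_addN : left_inverse fps_zero fps_opp fps_add.
Proof. by move=> f; apply: fpsP => n; apply: addNr. Qed.

HB.instance Definition _ := GRing.isZmodule.Build fps fps_addA fps_addC fps_add0 fps_addN.

Definition fps_mul f g : fps := fun n => \sum_(i < n.+1) f i * g (n - i)%N.
Definition fps_one : fps := fun n => (n == 0%N)%:R.

(** Coefficients of a product up to index [n] depend only on the truncations, so commutativity and
    associativity are borrowed from polynomials. *)
Let trunc n f : {poly R} := \poly_(i < n.+1) f i.

Let trunc_mul n f g k : (k <= n)%N -> (trunc n f * trunc n g)`_k = fps_mul f g k.
Proof.
move=> kn; rewrite coefM; apply: eq_bigr => i _; have ik := ltn_ord i.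
by rewrite !coef_poly !ifT //; lia.
Qed.

Fact fps_mulC : commutative fps_mul.
Proof. by move=> f g; apply: fpsP => n; rewrite -!(trunc_mul _ _ (leqnn n)) mulrC. Qed.

Fact fps_mulA : associative fps_mul.
Proof.
move=> f g h; apply: fpsP => n.
have E f1 f2 f3 : fps_mul f1 (fps_mul f2 f3) n = (trunc n f1 * (trunc n f2 * trunc n f3))`_n.
  rewrite coefM; apply: eq_bigr => i _; have ik := ltn_ord i.
  rewrite trunc_mul ?leq_subr //; congr (_ * _).
  by rewrite coef_poly ifT.
rewrite [fps_mul (fps_mul f g) h]fps_mulC !E; congr (polyseq _)`_n.
by rewrite mulrA mulrC.
Qed.

Fact fps_mul1 : left_id fps_one fps_mul.
Proof.
move=> f; apply: fpsP => n; rewrite /fps_mul big_ord_recl /fps_one eqxx mul1r subn0 big1 ?addr0 // => i _.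
by rewrite mul0r.
Qed.

Fact fps_mulDl : left_distributive fps_mul fps_add.
Proof.
move=> f g h; apply: fpsP => n; rewrite /fps_mul /fps_add -big_split.
by apply: eq_bigr => i _; rewrite mulrDl.
Qed.

Fact fps_one_neq0 : fps_one != fps_zero.
Proof. by apply/eqP => /(congr1 (fun f : fps => f 0%N)) /eqP; rewrite /fps_one eqxx oner_eq0. Qed.

HB.instance Definition _ := GRing.Zmodule_isComNzRing.Build fps
  fps_mulA fps_mulC fps_mul1 fps_mulDl fps_one_neq0.

Lemma fpsM f g n : (f * g) n = \sum_(i < n.+1) f i * g (n - i)%N. Proof. by []. Qed.
Lemma fpsD f g n : (f + g) n = f n + g n. Proof. by []. Qed.
Lemma fpsN f n : (- f) n = - f n. Proof. by []. Qed.
Lemma fps1 n : (1 : fps) n = (n == 0%N)%:R. Proof. by []. Qed.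
Lemma fps0 n : (0 : fps) n = 0. Proof. by []. Qed.

Lemma fps_sum (I : Type) (s : seq I) (P : pred I) (F : I -> fps) n :
  (\sum_(i <- s | P i) F i) n = \sum_(i <- s | P i) F i n.
Proof. exact: (big_morph (fun f : fps => f n) (fun f g => fpsD f g n) (fps0 n)). Qed.

Definition fconst (c : R) : fps := fun n => if n == 0%N then c else 0.

Arguments fconst c%_R.

Lemma fconstM c f n : (fconst c * f) n = c * f n.
Proof.
rewrite fpsM big_ord_recl /fconst /= subn0 big1 ?addr0 // => i _.
by rewrite mul0r.
Qed.

Fact fconst_zmod : zmod_morphism fconst.
Proof. by move=> c d; apply: fpsP => -[|n]; rewrite fpsD fpsN /fconst /= ?subr0. Qed.
Fact fconst_monoid : monoid_morphism fconst.
Proof.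
split=> [|c d]; apply: fpsP => -[|n]; rewrite ?fconstM ?fps1 /fconst //=.
by rewrite mulr0.
Qed.
HB.instance Definition _ := GRing.isZmodMorphism.Build R fps fconst fconst_zmod.
HB.instance Definition _ := GRing.isMonoidMorphism.Build R fps fconst fconst_monoid.

Definition fX (m : nat) : fps := fun n => (n == m)%:R.

Lemma fXM m f n : (fX m * f) n = if (m <= n)%N then f (n - m)%N else 0.
Proof.
rewrite fpsM; case: leqP => mn.
  have mn' : (m < n.+1)%N by [].
  rewrite (bigD1 (Ordinal mn')) //= /fX eqxx mul1r big1 ?addr0 // => i.
  by rewrite -val_eqE /= => /negPf ->; rewrite mul0r.
rewrite big1 // => i _; rewrite /fX ltn_eqF ?mul0r //.
by apply: leq_ltn_trans mn; rewrite -ltnS.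
Qed.

Lemma fXD m n : fX (m + n) = fX m * fX n.
Proof.
apply: fpsP => k; rewrite fXM /fX; case: leqP => km.
  by rewrite -[in LHS](subnKC km) eqn_add2l.
by rewrite ltn_eqF // (leq_trans km) // leq_addr.
Qed.

Lemma fX0 : fX 0 = 1. Proof. by apply: fpsP. Qed.

Lemma fX_exp m k : fX m ^+ k = fX (k * m).
Proof. by elim: k => [|k IHk]; rewrite ?expr0 ?fX0 // exprS IHk mulSn fXD. Qed.

Lemma fX_inj m : injective (fun f => fX m * f).
Proof.
move=> f g E; apply: fpsP => n; have := congr1 (fun f : fps => f (m + n)%N) E.
by rewrite /= !fXM leq_addr addKn.
Qed.

Lemma bdiff_fX m f : bdiff m f = (1 - fX m) * f.
Proof. by apply: fpsP => n; rewrite mulrBl mul1r fpsD fpsN fXM. Qed.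

(** Substitution of a series into a polynomial: [fX 1] gives the polynomial as a series in t,
    [fexp 1] gives its value at t = e^z. *)
Definition feval (e : fps) (p : {poly R}) : fps := (map_poly fconst p).[e].

Lemma fevalE e p : feval e p = \sum_(i < size p) fconst p`_i * e ^+ i.
Proof.
rewrite /feval horner_coef size_map_poly.
by apply: eq_bigr => i _; rewrite coef_map.
Qed.

Lemma feval_wide e p n : (size p <= n)%N -> feval e p = \sum_(i < n) fconst p`_i * e ^+ i.
Proof.
move=> pn; rewrite fevalE -(subnKC pn) big_split_ord /= [X in _ = _ + X]big1 ?addr0 // => i _.
by rewrite nth_default ?leq_addr // rmorph0 mul0r.
Qed.

Lemma fevalM e p q : feval e (p * q) = feval e p * feval e q.
Proof. by rewrite /feval rmorphM hornerM. Qed.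

Lemma feval_prod e (I : Type) (s : seq I) (F : I -> {poly R}) :
  feval e (\prod_(i <- s) F i) = \prod_(i <- s) feval e (F i).
Proof. by rewrite /feval rmorph_prod horner_prod. Qed.

Lemma feval_fX1 p n : feval (fX 1) p n = p`_n.
Proof.
rewrite (feval_wide _ (leq_maxl (size p) n.+1)) fps_sum.
have np : (n < maxn (size p) n.+1)%N by rewrite leq_max ltnSn orbT.
rewrite (bigD1 (Ordinal np)) //= fconstM fX_exp muln1 /fX eqxx mulr1 big1 ?addr0 // => i.
by rewrite -val_eqE /= fconstM fX_exp muln1 /fX eq_sym => /negPf ->; rewrite mulr0.
Qed.

(* [fexp x] is the series e^(x z) and [fden x] the series (e^(x z) - 1) / z. *)
Definition fexp (x : R) : fps := fun n => x ^+ n / n`!%:R.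
Definition fden (x : R) : fps := fun n => x ^+ n.+1 / n.+1`!%:R.

Arguments fexp x%_R.
Arguments fden x%_R.

Lemma fact_neq0 n : n`!%:R != 0 :> R.
Proof. by rewrite pnatr_eq0 -lt0n fact_gt0. Qed.

Lemma fexpD x y : fexp (x + y) = fexp x * fexp y.
Proof.
apply: fpsP => n; rewrite fpsM /fexp [x + y]addrC exprDn mulr_suml; apply: eq_bigr => i _.
have ik : (i <= n)%N by rewrite -ltnS.
have c0 : ('C(n, i))%:R != 0 :> R by rewrite pnatr_eq0 -lt0n bin_gt0.
have cancel (u v w : R) : v != 0 -> u * v / (v * w) = u / w.
  by move=> v0; rewrite -mulrA invfM [v * _]mulrA divff // mul1r.
rewrite -mulr_natr -(bin_fact ik) !natrM cancel //.
by rewrite [_ ^+ _ * _]mulrC invfM mulrACA.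
Qed.

Lemma fexp0 : fexp 0 = 1.
Proof. by apply: fpsP => -[|n]; rewrite /fexp fps1 ?expr0 ?divr1 // exprS !mul0r. Qed.

Lemma fexp_nat x n : fexp (x *+ n) = fexp x ^+ n.
Proof. by elim: n => [|n IHn]; rewrite ?fexp0 // mulrS exprS fexpD IHn. Qed.

Lemma fX_fden x : fX 1 * fden x = fexp x - 1.
Proof.
apply: fpsP => -[|n]; rewrite fXM fpsD fpsN fps1 /fexp /fden /=.
  by rewrite expr0 divr1 subrr.
by rewrite subn1 subr0.
Qed.

Lemma fps_unit f : f 0%N != 0 -> exists g, g * f = 1.
Proof.
move=> f0; exists (ps_div (1 : fps) f : fps); apply: fpsP => n.
have := @PS_mult_ps_div (1 : fps) f _ n; rewrite /PS_mult sum_f_R0E => <-.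
  by rewrite fpsM big_mkord.
by apply/eqP.
Qed.

Lemma PS_mult_fps f g : PS_mult f g = f * g.
Proof. by apply: fpsP => n; rewrite /PS_mult sum_f_R0E fpsM big_mkord. Qed.

Lemma bdiff_foldl (r : nat) (a : 'I_r -> nat) (s : seq 'I_r) h :
  foldl (fun f i => bdiff (a i) f : fps) h s = (\prod_(i <- s) (1 - fX (a i))) * h.
Proof.
elim: s h => [|i s IHs] h; first by rewrite big_nil mul1r.
by rewrite big_cons /= IHs bdiff_fX mulrCA mulrA.
Qed.

Lemma feval_geom e b k : feval e (\sum_(s < k) 'X^b ^+ s) * (1 - e ^+ b) = 1 - e ^+ (b * k).
Proof.
have -> : feval e (\sum_(s < k) 'X^b ^+ s) = \sum_(s < k) (e ^+ b) ^+ s.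
  rewrite /feval rmorph_sum horner_sum; apply: eq_bigr => s _.
  by rewrite !rmorphXn /= map_polyX !horner_exp hornerX.
by rewrite exprM -[RHS]opprB subrX1 mulrC -mulNr opprB.
Qed.

(** * The coefficients of N(t) / (1 - t^D)^r *)

Section Quasipolynomial.

Variable D : nat.
Hypothesis D_gt0 : (0 < D)%N.

Let D_neq0 : D%:R != 0 :> R. Proof. by rewrite pnatr_eq0 -lt0n. Qed.

Lemma fden_inv_ex : exists g, g * fden D%:R = 1.
Proof. by apply: fps_unit; rewrite /fden expr1 divr1. Qed.

(** The series z / (e^(D z) - 1). *)
Definition fdinv : fps := sval (cid fden_inv_ex).

Lemma fdinvE : fdinv * fden D%:R = 1. Proof. exact: (svalP (cid fden_inv_ex)). Qed.

Let F := fdinv.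

(* psi r t = [z^(r-1)] e^(-D t z) (z / (e^(D z) - 1))^r, which is
   (-1)^(r-1) binomial(t + r - 1, r - 1) / D. *)
Let psi (r : nat) (t : R) : R := ((fexp (- (D%:R * t)) * F ^+ r : fps) r.-1)%R.

Arguments psi r%_N t%_R.

(** Pascal's rule: e^(-D t z) - e^(-D (t+1) z) contains e^(D z) - 1, which cancels one factor [F]
    and leaves a factor z. *)
Let psi_rec r t : psi r.+2 t - psi r.+2 (t + 1) = psi r.+1 (t + 1).
Proof.
set u := fexp (- (D%:R * (t + 1))).
have E : fexp (- (D%:R * t)) - u = u * (fX 1 * fden D%:R).
  rewrite fX_fden mulrBr mulr1 -fexpD; congr (fexp _ - _).
  by rewrite mulrDr mulr1 opprD addrNK.
have E2 : fexp (- (D%:R * t)) * F ^+ r.+2 - u * F ^+ r.+2 = fX 1 * (u * F ^+ r.+1).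
  transitivity ((fexp (- (D%:R * t)) - u) * F ^+ r.+2); first by ring.
  transitivity (fX 1 * (u * F ^+ r.+1) * (F * fden D%:R)); first by rewrite E [F ^+ r.+2]exprS; move: (F ^+ r.+1) => v; ring.
  by rewrite fdinvE mulr1.
transitivity ((fexp (- (D%:R * t)) * F ^+ r.+2 - u * F ^+ r.+2) r.+1) => //.
by rewrite E2 fXM /= subn1.
Qed.

(** The derivation z d/dz. *)
Let theta f : fps := fun n => n%:R * f n.

Let thetaM f g : theta (f * g) = theta f * g + f * theta g.
Proof.
apply: fpsP => n; rewrite fpsD /theta !fpsM mulr_sumr -big_split /=.
apply: eq_bigr => i _; have ik : (i <= n)%N by rewrite -ltnS.
by rewrite -{1}(subnKC ik) natrD mulrDl mulrA mulrCA.
Qed.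

Let theta_exp f r : theta (f ^+ r.+1) = (f ^+ r * theta f) *+ r.+1.
Proof.
elim: r => [|r IHr]; first by rewrite expr1 expr0 mul1r.
by rewrite exprS thetaM IHr mulrnAr mulrA -exprS mulrC -mulrS.
Qed.

(** This is the residue at 0 of e^(D z) / (e^(D z) - 1)^(r+2), an exact derivative. On coefficients,
    (r+1) D e^(D z) F^(r+2) = (r+1) F^(r+1) - theta F^(r+1), whose coefficient of z^(r+1) is
    zero. *)
Let psi_m1 r : psi r.+2 (- 1)%R = 0.
Proof.
rewrite /psi mulrN mulr1 opprK /=; set E := fexp _.
have dden : theta (fden D%:R) + fden D%:R = fconst D%:R * E.
  apply: fpsP => n; rewrite fpsD fconstM /theta /fden /E /fexp.
  rewrite -[X in _ + X]mul1r -mulrDl natr1 factS natrM exprS invfM.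
  by rewrite mulrCA [n.+1%:R * _]mulrA mulfV ?pnatr_eq0 // mul1r mulrA.
have dF : fconst D%:R * E * F ^+ 2 = F - theta F.
  have : theta (F * fden D%:R) = 0.
    by rewrite fdinvE; apply: fpsP => -[|n]; rewrite /theta ?mul0r // fps1 mulr0.
  rewrite thetaM => /eqP; rewrite addr_eq0 => /eqP H.
  have H1 : theta F = - (F * theta (fden D%:R)) * F by rewrite -H -mulrA [_ * F]mulrC fdinvE mulr1.
  rewrite H1 -dden; set d := fden _; set td := theta d.
  transitivity (td * F ^+ 2 + F * (F * d)); first by ring.
  by rewrite fdinvE; ring.
have key : (fconst D%:R * (E * F ^+ r.+2)) *+ r.+1 = F ^+ r.+1 *+ r.+1 - theta (F ^+ r.+1).
  rewrite theta_exp -mulrnBl; congr (_ *+ _).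
  have -> : fconst D%:R * (E * F ^+ r.+2) = fconst D%:R * E * F ^+ 2 * F ^+ r.
    by rewrite -addn2 exprD; ring.
  by rewrite dF exprS; ring.
have := congr1 (fun f : fps => f r.+1) key.
rewrite fpsD fpsN /theta.
have mulnE f k n : (f *+ k) n = k%:R * f n.
  by elim: k => [|k IHk]; rewrite ?mulr0n ?mul0r // mulrS fpsD IHk -natr1 mulrDl mul1r addrC.
rewrite !mulnE subrr fconstM => /eqP; rewrite !mulf_eq0 pnatr_eq0 (negPf D_neq0) /=.
by move/eqP.
Qed.

Let psi_0 r : psi r.+2 0%R = - psi r.+1 0%R.
Proof. by have := psi_rec r (- 1)%R; rewrite addNr psi_m1 sub0r => <-; rewrite opprK. Qed.

Let psi_1 t : psi 1 t = D%:R^-1.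
Proof.
have /(congr1 (fun f : fps => f 0%N)) := fdinvE.
rewrite /psi !fpsM !big_ord1 /fden /fexp !expr1 expr0 !divr1 mul1r => E.
by apply: (mulIf D_neq0); rewrite mulVf //; exact: E.
Qed.

(** The coefficients of (1 - t^D)^(-r). They are identified by the recursion in [r], so binomial
    coefficients do not appear. *)
Let Q (r : nat) : fps := fun n =>
  if r is r'.+1 then
    if (D %| n)%N then D%:R * (-1) ^+ r' * psi r (n %/ D)%:R else 0
  else (n == 0%N)%:R.

Let Q_rec r : (1 - fX D) * Q r.+1 = Q r.
Proof.
rewrite mulrBl mul1r; apply: fpsP => n; rewrite fpsD fpsN fXM /Q.
(* Below degree [D] only n = 0 matters, and there no value at n - D exists; [psi_0], that is the
   vanishing at -1, takes its place. *)
case: (leqP D n) => Dn; last first.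
  rewrite subr0; case: n Dn => [|n] Dn; last first.
    have Dn1 : (D %| n.+1)%N = false by rewrite gtnNdvd.
    by case: r => [|r]; rewrite Dn1.
  rewrite dvdn0 div0n; case: r => [|r].
    by rewrite psi_1 expr0 mulr1 mulfV.
  by rewrite psi_0 ?dvdn0 ?div0n exprS mulN1r !mulrN mulNr opprK.
have n0 : (n == 0%N) = false by apply/eqP; lia.
rewrite dvdn_subl // n0; case: ifP => Dvd; last by rewrite subrr; case: r => // r; rewrite Dvd.
have nE : (n %/ D)%:R = ((n - D) %/ D)%:R + 1 :> R.
  rewrite natr1; congr _%:R.
  by rewrite -[in LHS](subnK Dn) divnDr ?dvdnn // divnn D_gt0 addn1.
case: r => [|r]; first by rewrite !psi_1 subrr.
by rewrite nE -mulrBr -[X in _ * X]opprB psi_rec exprS mulN1r !mulrN mulNr opprK.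
Qed.

Let Q_inv r : (1 - fX D) ^+ r * Q r = 1.
Proof. by elim: r => [|r IHr]; [rewrite expr0 mul1r; apply: fpsP|rewrite exprSr -mulrA Q_rec]. Qed.

(** The factor e^(-(D m + x) z) is expanded and e^(x z) is kept with F^r. The condition on [m]
    avoids the coefficient 1 of [Q 0], for which the sum over [l] is empty. *)
Let Q_expand r x m : (0 < m)%N -> Q r (D * m)%N = \sum_(l < r) (D%:R * m%:R + x) ^+ l *
  (D%:R * (-1) ^+ (r.-1 - l) / l`!%:R * (fexp x * F ^+ r) (r.-1 - l)%N).
Proof.
case: r => [|r] m0; first by rewrite big_ord0 /Q muln_eq0 !gtn_eqF.
rewrite /Q dvdn_mulr // mulKn //= /psi.
have -> : fexp (- (D%:R * m%:R)) * F ^+ r.+1 = fexp (- (D%:R * m%:R + x)) * (fexp x * F ^+ r.+1).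
  by rewrite mulrA -fexpD opprD subrK.
rewrite fpsM mulr_sumr; apply: eq_bigr => l _; have lr : (l <= r)%N by rewrite -ltnS.
have -> : (-1) ^+ r = (-1) ^+ l * (-1) ^+ (r - l) :> R by rewrite -exprD subnKC.
rewrite [fexp _ _]/fexp; set Y := D%:R * m%:R + x; rewrite [(- Y) ^+ l]exprNn /=.
move: ((fexp x * F ^+ r.+1 : fps) (r - l)%N) => v.
set s := (-1) ^+ l; set y := Y ^+ l; set t := (-1) ^+ (r - l); set u := _^-1.
have ss : s * s = 1 by rewrite -expr2 sqrr_sign.
by transitivity (D%:R * (s * s) * t * (y * u * v)); [ring|rewrite ss; ring].
Qed.

Theorem quasipolynomial (r : nat) (a : 'I_r -> nat) (h : fps) (K : {poly R}) :
  (forall i, (0 < a i)%N) -> (forall i, (a i %| D)%N) ->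
  (forall j, foldl (fun f i => bdiff (a i) f) h (enum 'I_r) j = K`_j) ->
  exists (N : {poly R}) (q : nat -> R) (c : R -> nat -> R),
  [/\ forall n, h n = \sum_(j < size N) N`_j * (if (j <= n)%N then q (n - j)%N else 0),
      forall n, ~~ (D %| n)%N -> q n = 0,
      forall x m, (0 < m)%N -> q (D * m)%N = \sum_(l < r) (D%:R * m%:R + x) ^+ l * c x l &
      forall w l, (l < r)%N -> \sum_(j < size N) N`_j * (c (w + j%:R) l / D%:R) =
        \sum_(j < size K) K`_j * ((-1) ^+ (r.-1 - l) / (l`!%:R * (r.-1 - l)`!%:R) *
          bernoulli_barnes a (r.-1 - l) (w + j%:R))].
Proof.
move=> a_gt0 aD hK.
(* The polynomial (1 - t^D) / (1 - t^(a_i)), which brings all denominators to 1 - t^D. *)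
pose G i : {poly R} := \sum_(s < D %/ a i) 'X^(a i) ^+ s.
have GE e i : feval e (G i) * (1 - e ^+ a i) = 1 - e ^+ D.
  by rewrite feval_geom mulnC divnK.
pose N := K * \prod_(i <- enum 'I_r) G i.
exists N, (Q r), (fun x l => D%:R * (-1) ^+ (r.-1 - l) / l`!%:R * (fexp x * F ^+ r : fps) (r.-1 - l)%N).
have prod_enum (e : fps) : \prod_(i <- enum 'I_r) e = e ^+ r.
  by rewrite big_const_seq count_predT size_enum_ord iter_mulr_1.
have E2 : h = feval (fX 1) N * Q r.
  have E1 : (1 - fX D) ^+ r * h = feval (fX 1) N.
    rewrite fevalM feval_prod -(prod_enum (1 - fX D)).
    have -> : feval (fX 1) K = (\prod_(i <- enum 'I_r) (1 - fX (a i))) * h.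
      by rewrite -bdiff_foldl; apply: fpsP => j; rewrite hK feval_fX1.
    rewrite mulrAC -big_split /=; congr (_ * h); apply: eq_bigr => i _.
    by have := GE (fX 1) i; rewrite !fX_exp !muln1 mulrC.
  by rewrite -E1 mulrAC Q_inv mul1r.
split=> [n|n nD|x m m0|w l lr].
- rewrite E2 fevalE mulr_suml fps_sum; apply: eq_bigr => j _.
  by rewrite -mulrA fconstM fX_exp muln1 fXM.
- by rewrite /Q; case: (r) => [|r']; [case: n nD => [|n] //; rewrite dvdn0 | rewrite (negPf nD)].
- exact: Q_expand.
have fexp1 x j : fexp (x + j%:R) = fexp x * fexp 1 ^+ j by rewrite fexpD -fexp_nat.
have evw (p : {poly R}) : fexp w * feval (fexp 1) p = \sum_(j < size p) fconst p`_j * fexp (w + j%:R).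
  rewrite fevalE mulr_sumr; apply: eq_bigr => j _; rewrite fexp1; ring.
pose k := (r.-1 - l)%N.
(* At t = e^z, [G i] turns z / (e^(D z) - 1) into z / (e^(a_i z) - 1). As e^z - 1 has no constant
   term, both sides are compared after multiplication by z. *)
have GF i : F * feval (fexp 1) (G i) * fden (a i)%:R = 1.
  rewrite -fdinvE -/F -mulrA; congr (F * _); apply: (@fX_inj 1) => /=.
  by rewrite mulrCA !fX_fden !fexp_nat -(opprB 1) mulrN GE opprB.
pose den : fps := \prod_(i <- enum 'I_r) fden (a i)%:R.
pose P : fps := F ^+ r * \prod_(i <- enum 'I_r) feval (fexp 1) (G i).
have Pden : P * den = 1.
  rewrite /P /den -prod_enum -!big_split /= big1 // => i _; exact: GF.
have denE : barnes_den a = den.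
  rewrite /barnes_den /den; elim: (enum 'I_r) => [|i s IHs] /=.
    by rewrite big_nil; apply: fpsP => n; rewrite /ps_one fps1; case: eqP.
  have -> : ps_expm1_div (INR (a i)) = fden (a i)%:R.
    by apply: fpsP => n; rewrite /ps_expm1_div /fden !RealsE.
  by rewrite IHs (@PS_mult_fps (fden (a i)%:R)) big_cons.
have bernE x m : bernoulli_barnes a m x / m`!%:R = (fexp x * P : fps) m.
  have E3 : ((fun m => bernoulli_barnes a m x / m`!%:R) : fps) * den = fexp x.
    rewrite -denE -PS_mult_fps; apply: fpsP => n; have := bernoulli_barnesP x a_gt0 n.
    rewrite /ps_exp /fexp !RealsE => <-; rewrite /PS_mult; apply: PartSum.sum_eq => i _.
    by rewrite !RealsE.
  by rewrite -E3 -mulrA [den * P]mulrC Pden mulr1.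
rewrite -/k.
transitivity ((-1) ^+ k / l`!%:R * (fexp w * feval (fexp 1) N * F ^+ r : fps) k).
  rewrite evw mulr_suml fps_sum mulr_sumr; apply: eq_bigr => j _.
  rewrite -[fconst _ * _ * _]mulrA fconstM.
  move: ((fexp (w + j%:R) * F ^+ r : fps) k) (fact_neq0 l) => v l0.
  by field; rewrite D_neq0 l0.
rewrite fevalM feval_prod.
have -> : fexp w * (feval (fexp 1) K * \prod_(i <- enum 'I_r) feval (fexp 1) (G i)) * F ^+ r
    = fexp w * feval (fexp 1) K * P by rewrite /P; ring.
rewrite evw mulr_suml fps_sum mulr_sumr; apply: eq_bigr => j _.
rewrite -[fconst _ * _ * _]mulrA fconstM -bernE; have := fact_neq0 l; have := fact_neq0 k => k0 l0.
by field; rewrite l0 k0.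
Qed.

End Quasipolynomial.
End FormalPowerSeries.

(** * Residues *)

Import GRing.Theory.

Lemma is_series_dilate (K : AbsRing) (V : NormedModule K) (u : nat -> V) l D : (0 < D)%N ->
  is_series u l -> is_series (fun n => if (D %| n)%N then u (n %/ D)%N else zero) l.
Proof.
move=> D0 ul; pose v n : V := if (D %| n)%N then u (n %/ D)%N else zero.
have E n : sum_n u (n %/ D) = sum_n v n.
  elim: n => [|n IHn]; first by rewrite div0n !sum_O /v dvdn0 div0n.
  rewrite sum_Sn -IHn /v; have := divnS n D0; case: ifP => Dn /=.
    by rewrite add1n => ->; rewrite sum_Sn.
  by rewrite add0n plus_zero_r => ->.
apply: (@filterlim_ext nat V eventually (locally l) _ (fun n => sum_n u (n %/ D)) (sum_n v) E).
apply: (@filterlim_comp _ _ _ (fun n => n %/ D)%N (sum_n u) _ eventually) ul => P [N NP].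
exists (N * D)%N => n /leP Nn; apply: NP; apply/leP.
by rewrite leq_divRL.
Qed.

(** * Dirichlet series over shifted integers and their residues *)

Section ZetaWeights.

Variables (X : nat -> R) (r : nat).

Let term (u : nat -> R) (z : C) (n : nat) : C := (RtoC (u n) * rpow (X n) z)%C.

(* [A l] is the residue at [l]. *)
Definition zeta_weight (u A : nat -> R) : Prop := exists F sigma,
  [/\ forall p, exists B, simple_pole F p B,
      forall l, (1 <= l <= r)%N -> simple_pole F (RtoC (INR l)) (RtoC (A l)) &
      forall z, sigma < Re z -> ex_series (fun n => Cmod (term u z n)) /\ cseries (term u z) (F z)].

Lemma zeta_weight_ext u v A B : (forall n, u n = v n) ->
  (forall l, (1 <= l <= r)%N -> A l = B l) -> zeta_weight u A -> zeta_weight v B.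
Proof.
move=> uv AB [F [s [F1 F2 F3]]]; exists F, s; split=> // [l lr|z /F3[E1 E2]].
  by rewrite -AB //; apply: F2.
by split; [apply: rex_series_ext E1|apply: cseries_ext E2] => n; rewrite /term uv.
Qed.

Lemma zeta_weight_finite u N : (forall n, (N < n)%N -> u n = 0) -> zeta_weight u (fun=> 0).
Proof.
move=> uN; pose F z := csum (term u z) N.
have rF p : simple_pole F p 0.
  apply: (@reg_simple_pole _ _ (csum (fun n => u n * rpow (X n) p)%C N)).
  by apply: reg_csum => n _; apply: reg_mult (reg_const _ _) (reg_rpow _ _).
exists F, 0; split=> [p|l _|z _]; [by exists (RtoC 0)|exact: rF|split].
  exists (sum_n (fun n => Cmod (term u z n)) N); apply: is_series_finite => n /uN un.
  by rewrite /term un Cmult_0_l Cmod_0.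
by apply: is_series_finite => n /uN un; rewrite /term un Cmult_0_l.
Qed.

Lemma zeta_weight_plus u v A B : zeta_weight u A -> zeta_weight v B ->
  zeta_weight (fun n => u n + v n) (fun l => A l + B l).
Proof.
move=> [F [s [F1 F2 F3]]] [G [t [G1 G2 G3]]].
exists (fun z => F z + G z)%C, (Rmax s t); split=> [p|l lr|z sz].
- by have [a /simple_pole_plus Fa] := F1 p; have [b /Fa] := G1 p; exists (a + b)%C.
- by rewrite RtoC_plus; apply: simple_pole_plus; [apply: F2|apply: G2].
have [E1 E2] := F3 z (Rle_lt_trans _ _ _ (Rmax_l _ _) sz).
have [E3 E4] := G3 z (Rle_lt_trans _ _ _ (Rmax_r _ _) sz).
have E n : (term u z n + term v z n)%C = term (fun n => u n + v n) z n.
  by rewrite /term RtoC_plus; ring.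
split; last by apply: cseries_ext (cseries_plus E2 E4).
apply: (@ex_series_le_pos _ (fun n => Cmod (term u z n) + Cmod (term v z n))).
  by move=> n; split; [apply: Cmod_ge_0|rewrite -E; apply: Cmod_triangle].
exact: (@ex_series_plus R_AbsRing R_NormedModule).
Qed.

Lemma zeta_weight_scal c u A : zeta_weight u A ->
  zeta_weight (fun n => c * u n) (fun l => c * A l).
Proof.
move=> [F [s [F1 F2 F3]]].
have sc p a : simple_pole F p a -> simple_pole (fun z => c * F z)%C p (c * a)%C.
  exact: simple_pole_mult (reg_const _ _).
exists (fun z => c * F z)%C, s; split=> [p|l lr|z sz].
- by have [a /sc] := F1 p; exists (c * a)%C.
- by rewrite RtoC_mult; apply/sc/F2.
have [E1 E2] := F3 z sz.
have E n : (c * term u z n)%C = term (fun n => c * u n) z n.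
  by rewrite /term RtoC_mult; ring.
split; last by apply: cseries_ext (@cseries_scal c _ _ E2).
apply: (@rex_series_ext (fun n => Cmod c * Cmod (term u z n))).
  by move=> n; rewrite -E Cmod_mult.
exact: (@ex_series_scal R_AbsRing R_NormedModule).
Qed.

Lemma zeta_weight_sum n (c : nat -> R) (u A : nat -> nat -> R) :
  (forall i, (i < n)%N -> zeta_weight (u i) (A i)) ->
  zeta_weight (fun k => \sum_(i < n) c i * u i k)%R (fun l => \sum_(i < n) c i * A i l)%R.
Proof.
elim: n => [|n IHn] H.
  by apply: zeta_weight_ext (@zeta_weight_finite (fun=> 0) 0 _) => // [k|l _]; rewrite big_ord0.
apply: zeta_weight_ext (zeta_weight_plus (IHn _) (zeta_weight_scal (c n) (H n _))) => //.
- by move=> k; rewrite big_ord_recr.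
- by move=> l _; rewrite big_ord_recr.
by move=> i /ltnW; apply: H.
Qed.

(** Along the progression X^k X^(-z) = D^(k-z) (m + x)^(k-z), a Hurwitz series at z - k. Its pole
    sits at z = k + 1, where the factor D^(k-z) equals 1/D. *)
Lemma zeta_weight_progression D n1 k x : (0 < D)%N -> 2 <= x ->
  (forall m, X (n1 + D * m)%N = INR D * (INR m + x)) ->
  zeta_weight (fun n => if (n1 <= n)%N && (D %| n - n1)%N then X n ^ k else 0)
    (fun l => if l == k.+1 then / INR D else 0).
Proof.
move=> D0 x2 XE; have DR : 0 < INR D by apply: lt_0_INR; apply/ltP.
pose F z := (rpow (INR D) (z + - RtoC (INR k)) * hzeta x (z + - RtoC (INR k)))%C.
have rD p : reg (fun z => rpow (INR D) (z + - RtoC (INR k))%C) p (rpow (INR D) (p + - RtoC (INR k))%C).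
  exact/reg_shift/reg_rpow.
have pole1 p : (p + - RtoC (INR k))%C = 1 -> simple_pole F p (rpow (INR D) 1).
  move=> p1; rewrite -[rpow _ _]Cmult_1_r -{1}p1; apply: simple_pole_mult (rD p) _.
  by apply: simple_pole_shift; apply: (proj2 (hzeta_pole x2 _) p1).
have pole0 p : (p + - RtoC (INR k))%C <> 1 -> simple_pole F p 0.
  move=> p1; have [v vP] := proj1 (hzeta_pole x2 _) p1.
  exact: reg_simple_pole (reg_mult (rD p) (reg_shift vP)).
exists F, (2 + INR k); split=> [p|l _|z zk].
- by have [/pole1|/pole0] := pselect ((p + - RtoC (INR k))%C = 1); [exists (rpow (INR D) 1)|exists (RtoC 0)].
- case: eqP => [->|lk].
    have -> : RtoC (/ INR D) = rpow (INR D) 1.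
      rewrite /rpow (_ : (- RtoC 1 * RtoC (ln (INR D)))%C = RtoC (- ln (INR D))); last by rewrite RtoC_opp; ring.
      by rewrite Cexp_RtoC exp_Ropp exp_ln.
    by apply: pole1; rewrite S_INR RtoC_plus; ring.
  apply: pole0 => E; apply: lk; apply: INR_eq; rewrite S_INR.
  by move: E => /(congr1 (@fst R R)) /=; lra.
pose z' := (z + - RtoC (INR k))%C; pose t m := rpow (X (n1 + D * m)%N) z'.
have tE m : (rpow (INR D) z' * rpow (INR m + x) z')%C = t m.
  by rewrite /t XE rpow_mult //; have := pos_INR m; lra.
have z2 : 2 < Re z' by move: zk; rewrite /z'; case: (z) => u v /=; lra.
have [H1 H2] := hzeta_series x2 z2.
have E n : (if (n1 <= n)%N then (if (D %| n - n1)%N then t ((n - n1) %/ D)%N else RtoC 0) else RtoC 0)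
    = term (fun n => if (n1 <= n)%N && (D %| n - n1)%N then X n ^ k else 0) z n :> C.
  rewrite /term; case: ifP => n1n /=; last by rewrite Cmult_0_l.
  case: ifP => Dn /=; last by rewrite Cmult_0_l.
  have Xn : X n = X (n1 + D * ((n - n1) %/ D))%N by congr X; rewrite mulnC divnK // subnKC.
  rewrite -rpow_nat; last by rewrite Xn XE; have := pos_INR ((n - n1) %/ D)%N; nra.
  by rewrite Cmult_comm -rpowD /t -Xn.
have S (K : AbsRing) (V : NormedModule K) (v : nat -> V) s : is_series v s ->
    is_series (fun n => if (n1 <= n)%N then (if (D %| n - n1)%N then v ((n - n1) %/ D)%N else zero) else zero) s.
  by move=> vs; apply: (@is_series_delay _ _ (fun n => if (D %| n)%N then v (n %/ D)%N else zero)); apply: is_series_dilate.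
split.
  have [s sP] : ex_series (fun m => Cmod (t m)).
    apply: (@rex_series_ext (fun m => Cmod (rpow (INR D) z') * Cmod (rpow (INR m + x) z'))).
      by move=> m; rewrite -tE Cmod_mult.
    exact: (@ex_series_scal R_AbsRing R_NormedModule).
  exists s; apply: rseries_ext (S _ _ _ _ sP) => n; rewrite -E.
  by case: ifP => _ //=; [case: ifP => _ //=|]; rewrite Cmod_0.
apply: cseries_ext E (S _ _ _ _ _); apply: cseries_ext tE _.
exact: cseries_scal.
Qed.

End ZetaWeights.

(** * From the Hilbert series to the residues *)

Section General.

Variables (r : nat) (a : 'I_r -> nat) (a_gt0 : forall i, (0 < a i)%N).
Variables (h : nat -> R) (K : {poly R}).
Hypothesis hK : forall j, foldl (fun f i => bdiff (a i) f) h (enum 'I_r) j = (K`_j)%R.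
Variables (n0 : nat) (w : R).
Hypothesis w_gt : 0 < INR n0 + w.

Let X n := INR (n0 + n) + w.

(** The offset [n0] lets one statement serve both zeta functions: n0 = 0 with w > 0, and n0 = 1 with
    w = 0. *)
Theorem zeta_weight_hilbert : zeta_weight X r (fun n => h (n0 + n)%N)
  (fun l => \sum_(j < size K) K`_j * ((-1) ^+ (r - l) / ((l - 1)`!%:R * (r - l)`!%:R) *
     bernoulli_barnes a (r - l) (w + j%:R)))%R.
Proof.
pose D := (\prod_(i < r) a i)%N.
have D0 : (0 < D)%N by apply: prodn_gt0.
have aD i : (a i %| D)%N by rewrite /D (bigD1 i) //= dvdn_mulr.
have [N [q [c [hE qD qE cE]]]] := quasipolynomial D0 a_gt0 aD hK.
(* The pole at z = l comes from the power of exponent l - 1, whose residue is 1/D. *)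
pose A j l := c (w + INR j) (l - 1)%N / INR D.
apply: (@zeta_weight_ext _ _ (fun n => \sum_(j < size N) N`_j * (if (j <= n0 + n)%N then q (n0 + n - j)%N else 0))%R
  _ (fun l => \sum_(j < size N) N`_j * A j l)%R).
- by move=> n; rewrite hE.
- move=> l /andP[l0 lr]; have lr' : (l - 1 < r)%N by lia.
  have := cE w _ lr'; rewrite (_ : (r.-1 - (l - 1))%N = (r - l)%N); last by lia.
  by move=> <-; apply: eq_bigr => j _; rewrite /A !RealsE.
apply: (@zeta_weight_sum X r (size N) (fun j => N`_j)%R
  (fun j n => if (j <= n0 + n)%N then q (n0 + n - j)%N else 0) A) => j _.
(* The finitely many indices below [n1] contribute an entire function, so the progression may start
   late: D m1 >= n0 + 2 D and w > - n0 give the Hurwitz parameter m1 + (w + j)/D >= 2. *)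
pose m1 := n0.+2; pose n1 := (D * m1 + j - n0)%N.
have Dm1 : (n0 + 2 * D <= D * m1)%N.
  by rewrite /m1 -(addn2 n0) mulnDr [(D * 2)%N]mulnC leq_add2r leq_pmull.
have X1 m : X (n1 + D * m) = INR D * (INR m + (INR m1 + (w + INR j) / INR D)).
  have DR : 0 < INR D by apply: lt_0_INR; apply/ltP.
  rewrite /X /n1 (_ : (n0 + _)%N = (D * m + D * m1 + j)%N); last by lia.
  by rewrite !plus_INR !mult_INR; field; lra.
have x2 : 2 <= INR m1 + (w + INR j) / INR D.
  have D1 : 1 <= INR D by rewrite -[1]/(INR 1); apply: le_INR; apply/leP.
  apply: (Rmult_le_reg_l (INR D)); first lra.
  rewrite Rmult_plus_distr_l (_ : INR D * ((w + INR j) / INR D) = w + INR j); last by field; lra.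
  have : INR n0 + 2 * INR D <= INR D * INR m1.
    rewrite -mult_INR (_ : 2 = INR 2) // -mult_INR -plus_INR; apply: le_INR; exact/leP.
  by have := pos_INR j; lra.
pose T l n := if (n1 <= n)%N && (D %| n - n1)%N then X n ^ l else 0.
pose e n := if (n < n1)%N then (if (j <= n0 + n)%N then q (n0 + n - j)%N else 0) else 0.
have HT l : zeta_weight X r (T l) (fun l' => if l' == l.+1 then / INR D else 0).
  exact: zeta_weight_progression X1.
have He : zeta_weight X r e (fun=> 0).
  by apply: (@zeta_weight_finite _ _ _ n1) => n nn; rewrite /e ltnNge ltnW.
have Hs := @zeta_weight_sum X r r (c (w + INR j)) T _ (fun l _ => HT l).
apply: zeta_weight_ext (zeta_weight_plus He Hs) => [n|l /andP[l0 lr]].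
  rewrite /e; case: ltnP => nn.
    rewrite big1 ?Rplus_0_r // => l _; rewrite /T leqNgt nn /=.
    by rewrite mulr0.
  have jn : (j <= n0 + n)%N by rewrite /n1 in nn; lia.
  rewrite Rplus_0_l jn.
  have E : (n0 + n - j = D * m1 + (n - n1))%N by rewrite /n1 in nn *; lia.
  case: (boolP (D %| n - n1)%N) => Dn; last first.
    rewrite qD; last by rewrite E dvdn_addr // dvdn_mulr.
    by rewrite big1 // => l _; rewrite /T (negPf Dn) andbF mulr0.
  have Em : (n0 + n - j = D * ((n0 + n - j) %/ D))%N.
    by rewrite mulnC divnK // E dvdn_add // dvdn_mulr.
  have m0 : (0 < (n0 + n - j) %/ D)%N by rewrite divn_gt0 // E; lia.
  rewrite [in RHS]Em (qE (w + INR j) _ m0); apply: eq_bigr => l _.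
  rewrite /T nn Dn /= mulrC; congr (_ * _)%R.
  rewrite -natrM -Em RealsE; congr (_ ^+ _)%R.
  by rewrite /X natrB // -!INRE plus_INR; cbn; ring.
have lr' : (l - 1 < r)%N by lia.
rewrite Rplus_0_l (bigD1 (Ordinal lr')) //= big1 ?addr0; last first.
  by move=> i; rewrite -val_eqE /= => /negPf il; rewrite ifF ?mulr0 //; lia.
by rewrite ifT //; lia.
Qed.

End General.

Lemma zeta_weight_continuation (h : nat -> nat) (X : nat -> R) r A :
  zeta_weight X r (fun n => INR (h n)) A ->
  (exists Z, zeta_continuation h X Z) /\
  forall Z, zeta_continuation h X Z -> forall l, (1 <= l <= r)%N ->
    is_residue Z (RtoC (INR l)) (RtoC (A l)).
Proof.
move=> [F [s [F1 F2 F3]]].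
have E z n : (RtoC (INR (h n)) * rpow (X n) z)%C = zeta_term h X z n by rewrite rpowE.
split.
  exists F; split; first exact: simple_pole_meromorphic.
  exists s => z /F3[E1 E2]; split; last by apply: cseries_ext E2 => n; apply: E.
  by apply: rex_series_ext E1 => n; rewrite E.
move=> Z [mZ [t tZ]] l lr; apply: (@residue_of_continuation Z F (Rmax s t)) (F2 l lr) => // z zst.
have [_ E2] := F3 z (Rle_lt_trans _ _ _ (Rmax_l _ _) zst).
have [_ E3] := tZ z (Rle_lt_trans _ _ _ (Rmax_r _ _) zst).
by apply: cseries_unique E3 (cseries_ext _ E2) => n; apply: E.
Qed.

Lemma sum_n_big (u : nat -> R) n : sum_n u n = (\sum_(i < n.+1) u i)%R.
Proof.
elim: n => [|n IHn]; first by rewrite sum_O big_ord1.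
by rewrite sum_Sn IHn [RHS]big_ord_recr.
Qed.

(** A common bound [J] for all i <= p makes the inner series finite sums, which are then exchanged
    with the sum over [i]. *)
Lemma betti_residueE (r : nat) (a : 'I_r -> nat) p beta J x l : 
  (forall i j, (i <= p)%N -> (J < j)%N -> beta i j = 0%N) ->
  betti_residue a p beta x l =
  (\sum_(j < J.+1) (\sum_(i < p.+1) (-1) ^+ i * (beta i j)%:R) *
    ((-1) ^+ (r - l) / ((l - 1)`!%:R * (r - l)`!%:R) * bernoulli_barnes a (r - l) (x + j%:R)))%R.
Proof.
move=> betaJ; rewrite /betti_residue sum_n_big.
under [RHS]eq_bigr => j _ do rewrite mulr_suml.
rewrite exchange_big /=; apply: eq_bigr => i _; have ip : (i <= p)%N by rewrite -ltnS.
transitivity (sum_n (fun j => INR (beta i j) * ((-1) ^ (i + (r - l))%N / (INR (fact (l - 1)%N) * INR (fact (r - l)%N)))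
    * bernoulli_barnes a (r - l)%N (x + INR j)) J).
  apply: is_series_unique; apply: is_series_finite => j jJ.
  by rewrite (betaJ _ _ ip jJ) (_ : INR 0 = 0) // !Rmult_0_l.
rewrite sum_n_big; apply: eq_bigr => j _.
rewrite !RealsE exprD; set s := ((-1) ^+ i)%R; rewrite -!mulrA mulrCA; congr (_ * _)%R.
Qed.

Theorem corollary2p2
    (K : fieldType) (r : nat) (a : 'I_r -> nat) (a_gt0 : forall i, (0 < a i)%N)
    (M : grModule K a) (M_fg : finitely_generated M)
    (w : R) (w_gt0 : 0 < w)
    (H : nat -> nat) (H_dim : forall n, has_dim (grcomp (g := M) n) (H n))
    (p : nat) (p_pd : proj_dim M p)
    (beta : nat -> nat -> nat)
    (beta_tor : forall i j, betti_number M i j (beta i j)) :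
  let zetaw_ext := zeta_continuation H (fun n => INR n + w) in
  let zeta_ext := zeta_continuation (fun n => H n.+1) (fun n => INR n.+1) in
  ((exists Z, zetaw_ext Z) /\
   forall Z, zetaw_ext Z -> forall l, (1 <= l <= r)%N ->
     is_residue Z (RtoC (INR l)) (RtoC (betti_residue a p beta w l)))
  /\
  ((exists Z, zeta_ext Z) /\
   forall Z, zeta_ext Z -> forall l, (1 <= l <= r)%N ->
     is_residue Z (RtoC (INR l)) (RtoC (betti_residue a p beta 0 l))).
Proof.
have [J betaJ] : exists J, forall i j, (i <= p)%N -> (J < j)%N -> beta i j = 0%N.
  elim: (p) => [|q [J HJ]].
    have [J HJ] := betti_finite a_gt0 M_fg H_dim p_pd beta_tor 0.
    by exists J => i j; rewrite leqn0 => /eqP ->; apply: HJ.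
  have [J' HJ'] := betti_finite a_gt0 M_fg H_dim p_pd beta_tor q.+1.
  exists (maxn J J') => i j; rewrite leq_eqVlt gtn_max => /orP[/eqP -> /andP[_]|iq /andP[+ _]].
    exact: HJ'.
  exact: HJ.
(* The numerator of the Hilbert series; by [betaJ] nothing is lost beyond [J]. *)
pose P : {poly R} := (\poly_(j < J.+1) \sum_(i < p.+1) (-1) ^+ i * (beta i j)%:R)%R.
have hP j : foldl (fun f i => bdiff (a i) f) (fun n => INR (H n)) (enum 'I_r) j = (P`_j)%R.
  rewrite coef_poly (_ : (fun n => INR (H n)) = (fun n => (H n)%:R)%R); last by apply: funext => n; rewrite INRE.
  rewrite -(betti_euler a_gt0 M_fg H_dim p_pd beta_tor R j).
  case: ltnP => // jJ; rewrite big1 // => i _; rewrite betaJ ?mulr0 //.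
  by rewrite -ltnS.
have zw n0 w' : 0 < INR n0 + w' -> zeta_weight (fun n => INR (n0 + n) + w') r (fun n => INR (H (n0 + n)%N))
    (fun l => betti_residue a p beta w' l).
  move=> w'0; apply: zeta_weight_ext (zeta_weight_hilbert a_gt0 hP w'0) => // l lr.
  rewrite (betti_residueE _ _ _ betaJ); set G := bernoulli_barnes a _; set c := (_ / _)%R.
  have PJ : (size P <= J.+1)%N by apply: size_poly.
  rewrite (big_ord_widen _ (fun j => P`_j * (c * G (w' + j%:R)))%R PJ) big_mkcond /=.
  apply: eq_bigr => j _; case: ltnP => jP; first by rewrite coef_poly ltn_ord.
  have := nth_default 0%R jP; rewrite coef_poly ltn_ord => ->.
  by rewrite mul0r.
move=> zetaw_ext zeta_ext; split; apply: zeta_weight_continuation.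
  by apply: (zw 0%N); rewrite /= Rplus_0_l.
have := zw 1%N 0 ltac:(rewrite /=; lra).
by rewrite (_ : (fun n => INR (1 + n) + 0) = (fun n => INR n.+1)) //; apply: funext => n; rewrite Rplus_0_r.
Qed.
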